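(* Let $n\ge1$ and $p\ge n+1$ be integers, let $\Gamma=\mathbb R\times(\{0,1,\ldots,n\}\cup\{p\})\subset\mathbb R^2$, and let $\Lambda\subset\mathbb R^2$ be a closed set which is $2$-periodic with respect to the second variable. Suppose that the projection $\Pi(\Lambda)$ is dense in $\mathbb R$. If $(\Gamma,\Lambda)$ is a Heisenberg uniqueness pair, then the set $$\widetilde\Pi(\Lambda)=\Pi^{n+2}(\Lambda)\cup\bigcup_{m=1}^{n+1}\left[\Pi^{m}(\Lambda)\smallsetminus\Pi^{m^\ast}(\Lambda)\right]$$ is dense in $\mathbb R$. Conversely, if the set $$\widetilde\Pi_p(\Lambda)=\Pi^{n+2}(\Lambda)\cup\bigcup_{m=2}^{n+1}\left[\Pi^{m}(\Lambda)\smallsetminus\Pi^{p}_{m^\ast}(\Lambda)\right]\cup\left[\Pi^1(\Lambda)\smallsetminus\Pi^{1^\ast}(\Lambda)\right]$$ is dense in $\mathbb R$, then $(\Gamma,\Lambda)$ is a Heisenberg uniqueness pair.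
   Context: Heisenberg uniqueness pairs. $X(\Gamma)$ is the space of finite complex Borel measures $\mu$ on $\mathbb R^2$ supported on $\Gamma$ and absolutely continuous with respect to arc length on $\Gamma$; $\hat\mu(\xi,\eta)=\int_\Gamma e^{-i\pi(x\xi+y\eta)}d\mu(x,y)$. $(\Gamma,\Lambda)$ is a Heisenberg uniqueness pair if the only $\mu\in X(\Gamma)$ with $\hat\mu|_\Lambda=0$ is $\mu=0$. For $\varphi\in L^1(\mathbb R)$, $\hat\varphi(\xi)=\int_{\mathbb R}e^{-i\pi x\xi}\varphi(x)\,dx$. Notation: $F_s=\{0,1,\ldots,s\}$. ''$2$-periodic in the second variable'' means $(\xi,\eta)\in\Lambda\iff(\xi,\eta+2)\in\Lambda$. Local function spaces. Let $E\subset\mathbb R$, $\xi\in E$; $I_\xi$ denotes an open interval containing $\xi$. - $L^{E,\xi}_{loc}$ is the set of $\psi:E\to\mathbb C$ for which there are an interval $I_\xi$ and $\varphi\in L^1(\mathbb R)$ with $\psi=\hat\varphi$ on $I_\xi\cap E$. - $P^{1,p}[L^{E,\xi}_{loc}]$ is the set of $\psi:E\to\mathbb C$ for which there are an interval $I_\xi$ and $\varphi_j\in L^1(\mathbb R)$, $j\in F_n$, with $\psi^p+\hat\varphi_n\psi^n+\cdots+\hat\varphi_1\psi+\hat\varphi_0=0$ on $I_\xi\cap E$. Partition of the projection. $\Pi(\Lambda)=\{\xi:(\xi,\eta)\in\Lambda\text{ for some }\eta\}$ and, for $\xi\in\Pi(\Lambda)$, $\Sigma_\xi=\{\eta\in[0,2):(\xi,\eta)\in\Lambda\}$.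 Let $h_k(x_1,\ldots,x_s)=\sum_{\alpha_1+\cdots+\alpha_s=k}x_1^{\alpha_1}\cdots x_s^{\alpha_s}$ be the complete homogeneous symmetric polynomial of degree $k$. - For $1\le m\le n$: $\Pi^m(\Lambda)$ is the set of $\xi\in\Pi(\Lambda)$ such that $\Sigma_\xi$ has exactly $m$ elements. - $\Pi^{n+2}(\Lambda)$ is the set of $\xi\in\Pi(\Lambda)$ for which there are $n+2$ distinct $\eta_j\in\Sigma_\xi$, $j\in F_{n+1}$, such that, with $a_j=e^{\pi i\eta_j}$, $h_{p-n}(a_0,\ldots,a_{n-1},a_n)\ne h_{p-n}(a_0,\ldots,a_{n-1},a_{n+1})$. - $\Pi^{n+1}(\Lambda)$ is the set of $\xi\in\Pi(\Lambda)$ such that $\Sigma_\xi$ has at least $n+1$ elements and, for any $n+2$ distinct $\eta_j\in\Sigma_\xi$ (if such exist), $h_{p-n}(a_0,\ldots,a_{n-1},a_n)=h_{p-n}(a_0,\ldots,a_{n-1},a_{n+1})$. Thus $\Pi(\Lambda)$ is the disjoint union of $\Pi^1(\Lambda),\ldots,\Pi^{n+2}(\Lambda)$. Dispensable sets. For $1\le m\le n+1$ and $\xi\in\Pi^m(\Lambda)$ fix $m$ distinct elements $\eta_0(\xi),\ldots,\eta_{m-1}(\xi)$ of $\Sigma_\xi$ (all of $\Sigma_\xi$ if $m\le n$) and put $a_j(\xi)=e^{\pi i\eta_j(\xi)}$, $j\in F_{m-1}$. - $\Pi^{1^\ast}(\Lambda)=\{\xi\in\Pi^1(\Lambda): a_0\in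 P^{1,p}[L^{\Pi^1(\Lambda),\xi}_{loc}]\}$. - For $2\le m\le n+1$: let $\tau_0,\ldots,\tau_{m-1}$ be the functions on $\Pi^m(\Lambda)$ uniquely determined by $\tau_0+\tau_1a_j+\cdots+\tau_{m-1}a_j^{m-1}=-a_j^m$ for all $j\in F_{m-1}$. Then $\Pi^{m^\ast}(\Lambda)$ is the set of $\xi\in\Pi^m(\Lambda)$ such that $\tau_j\in L^{\Pi^m(\Lambda),\xi}_{loc}$ for all $j\in F_{m-1}$. - For $2\le m\le n+1$: $\Pi^p_{m^\ast}(\Lambda)$ is the set of $\xi\in\Pi^m(\Lambda)$ for which there exist $n+1$ functions $\tau_0,\ldots,\tau_n$ on $\Pi^m(\Lambda)$ satisfying $\tau_0+\tau_1a_j+\cdots+\tau_na_j^n=-a_j^p$ on $\Pi^m(\Lambda)$ for all $j\in F_{m-1}$, with $\tau_k\in L^{\Pi^m(\Lambda),\xi}_{loc}$ for all $k\in F_n$. *)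

(* Defs.v *)
From HB Require Import structures.
From mathcomp Require Import all_boot all_order all_algebra.
From mathcomp Require Import all_classical all_reals all_analysis.
From mathcomp.real_closed Require Import complex.
Set Implicit Arguments.
Unset Strict Implicit.
Unset Printing Implicit Defensive.
Import Order.TTheory GRing.Theory Num.Theory.
Import numFieldNormedType.Exports.
Local Open Scope classical_set_scope.
Local Open Scope ring_scope.
Local Open Scope complex_scope.
Local Open Scope card_scope.

(* A finite complex measure is given by its real and imaginary parts, which are
   charges (finite signed measures). *)
Record complex_measure d (T : measurableType d) (R : realType) :=
  ComplexMeasure {
    re_part : {charge set T -> \bar R} ;
    im_part : {charge set T -> \bar R} }.

Definition cmeasure d (T : measurableType d) (R : realType)
    (mu : complex_measure T R) (A : set T) : R[i] :=
  fine (re_part mu A) +i* fine (im_part mu A).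

Coercion cmeasure : complex_measure >-> Funclass.

(* The Jordan parts do not depend on the chosen Hahn decomposition. *)
Definition charge_integral d (T : measurableType d) (R : realType)
    (nu : {charge set T -> \bar R}) (D : set T) (f : T -> R) : R :=
  let P := cid (Hahn_decomposition nu) in
  let N := cid (projT2 P) in
  \int[jordan_pos (projT2 N)]_(x in D) f x
    - \int[jordan_neg (projT2 N)]_(x in D) f x.

Definition cmeasure_integral d (T : measurableType d) (R : realType)
    (mu : complex_measure T R) (D : set T) (f : T -> R[i]) : R[i] :=
  let I nu g := charge_integral nu D g in
  (I (re_part mu) (fun x => complex.Re (f x)) - I (im_part mu) (fun x => complex.Im (f x))) +i*
  (I (re_part mu) (fun x => complex.Im (f x)) + I (im_part mu) (fun x => complex.Re (f x))).

Definition cintegral d (T : measurableType d) (R : realType)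
    (m : {measure set T -> \bar R}) (D : set T) (f : T -> R[i]) : R[i] :=
  (\int[m]_(x in D) complex.Re (f x)) +i* (\int[m]_(x in D) complex.Im (f x)).

Definition cintegrable d (T : measurableType d) (R : realType)
    (m : {measure set T -> \bar R}) (D : set T) (f : T -> R[i]) : Prop :=
  m.-integrable D (fun x => (complex.Re (f x))%:E) /\
  m.-integrable D (fun x => (complex.Im (f x))%:E).

Section Heisenberg.
Variable R : realType.
Implicit Types (H E : set R) (Lam : set (R * R)) (psi : R -> R[i]) (xi : R).

(* e^(i t) *)
Definition expi (t : R) : R[i] := cos t +i* sin t.

Definition L1 (phi : R -> R[i]) : Prop :=
  cintegrable (@lebesgue_measure R) setT phi.

Definition fourier (phi : R -> R[i]) (xi : R) : R[i] :=
  cintegral (@lebesgue_measure R) setT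
    (fun x => expi (- (pi * (x * xi))) * phi x).

(* The curves considered are unions R x H of horizontal lines, on which arc
   length is Lebesgue measure on each line. *)
Definition lines H : set (R * R) := setT `*` H.

Definition arc_length H (A : set (R * R)) : \bar R :=
  (\esum_(y in H) lebesgue_measure [set x : R | A (x, y)])%E.

Definition X_lines H (mu : complex_measure (R * R)%type R) : Prop :=
  (forall A, measurable A -> A `<=` ~` lines H -> mu A = 0) /\
  (forall A, measurable A -> arc_length H A = 0%E -> mu A = 0).

Definition fourier_measure H (mu : complex_measure (R * R)%type R)
    (z : R * R) : R[i] :=
  cmeasure_integral mu (lines H)
    (fun w => expi (- (pi * (w.1 * z.1 + w.2 * z.2)))).

Definition heisenberg_uniqueness_pair H Lam : Prop :=
  forall mu : complex_measure (R * R)%type R, X_lines H mu ->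
    (forall z, Lam z -> fourier_measure H mu z = 0) ->
    forall A, measurable A -> mu A = 0.

Definition heights (n p : nat) : set R :=
  [set k%:R | k in `I_n.+1] `|` [set p%:R].

Definition periodic2 Lam : Prop :=
  forall xi eta, Lam (xi, eta) <-> Lam (xi, eta + 2).

(* Functions on E are represented by total functions; only their values on E
   matter below. *)
Definition Lloc E xi psi : Prop :=
  exists I : interval R, [/\ open [set` I], xi \in I &
    exists2 phi, L1 phi &
      forall x, x \in I -> E x -> psi x = fourier phi x].

Definition P1loc (n p : nat) E xi psi : Prop :=
  exists I : interval R, [/\ open [set` I], xi \in I &
    exists2 phi : nat -> R -> R[i], (forall j, (j <= n)%N -> L1 (phi j)) &
      forall x, x \in I -> E x ->
        psi x ^+ p + \sum_(j < n.+1) fourier (phi j) x * psi x ^+ j = 0].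

Definition Pi Lam : set R := [set xi | exists eta, Lam (xi, eta)].

Definition Sigma Lam xi : set R :=
  [set eta | 0 <= eta < 2 /\ Lam (xi, eta)].

(* Complete homogeneous symmetric polynomial of degree k in
   a 0, ..., a (s - 1). *)
Definition hsym (k s : nat) (a : nat -> R[i]) : R[i] :=
  \sum_(alpha : {ffun 'I_s -> 'I_k.+1} | (\sum_i alpha i == k)%N)
    \prod_(i < s) a i ^+ alpha i.

(* h_(p-n)(a_0, ..., a_(n-1), a_n) = h_(p-n)(a_0, ..., a_(n-1), a_(n+1))
   with a_j = e^(pi i eta_j) *)
Definition hsym_agree (n p : nat) (eta : nat -> R) : Prop :=
  let a j := expi (pi * eta j) in
  hsym (p - n) n.+1 a =
  hsym (p - n) n.+1 (fun j => if j == n then a n.+1 else a j).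

Definition distinct_in (m : nat) (S : set R) (eta : nat -> R) : Prop :=
  (forall j, (j < m)%N -> S (eta j)) /\ {in `I_m &, injective eta}.

(* The sets Pi^m(Lam), 1 <= m <= n + 2. *)
Definition Pi_part (n p : nat) Lam (m : nat) : set R :=
  if (m <= n)%N then
    [set xi | Pi Lam xi /\ Sigma Lam xi #= `I_m]
  else if m == n.+1 then
    [set xi | [/\ Pi Lam xi, `I_n.+1 #<= Sigma Lam xi &
      forall eta, distinct_in n.+2 (Sigma Lam xi) eta -> hsym_agree n p eta]]
  else if m == n.+2 then
    [set xi | Pi Lam xi /\
      exists2 eta, distinct_in n.+2 (Sigma Lam xi) eta & ~ hsym_agree n p eta]
  else set0.

(* The sets Pi^m(Lam) are disjoint, so one function eta records the points
   eta_j(xi) fixed on all of them. *)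
Definition selection (n p : nat) Lam (eta : R -> nat -> R) : Prop :=
  forall m xi, (1 <= m <= n.+1)%N -> Pi_part n p Lam m xi ->
    distinct_in m (Sigma Lam xi) (eta xi).

Section Dispensable.
Variables (n p : nat) (Lam : set (R * R)) (eta : R -> nat -> R).

Let PiL := Pi_part n p Lam.
Let a (j : nat) (xi : R) : R[i] := expi (pi * eta xi j).

Definition Pi1_star : set R :=
  [set xi | PiL 1 xi /\ P1loc n p (PiL 1) xi (a 0)].

Definition Pi_star (m : nat) : set R :=
  [set xi | PiL m xi /\
    exists2 tau : nat -> R -> R[i],
      (forall x j, PiL m x -> (j < m)%N ->
         \sum_(k < m) tau k x * a j x ^+ k = - a j x ^+ m) &
      forall k, (k < m)%N -> Lloc (PiL m) xi (tau k)].

Definition Pi_pstar (m : nat) : set R :=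
  [set xi | PiL m xi /\
    exists2 tau : nat -> R -> R[i],
      (forall x j, PiL m x -> (j < m)%N ->
         \sum_(k < n.+1) tau k x * a j x ^+ k = - a j x ^+ p) &
      forall k, (k <= n)%N -> Lloc (PiL m) xi (tau k)].

Definition Pi_tilde : set R :=
  PiL n.+2
    `|` \bigcup_(m in [set m | (2 <= m <= n.+1)%N]) (PiL m `\` Pi_star m)
    `|` (PiL 1 `\` Pi1_star).

Definition Pi_tilde_p : set R :=
  PiL n.+2
    `|` \bigcup_(m in [set m | (2 <= m <= n.+1)%N]) (PiL m `\` Pi_pstar m)
    `|` (PiL 1 `\` Pi1_star).

End Dispensable.

End Heisenberg.

(* Main.v *)
(* A measure in X(Gamma) is given by densities f_0, ..., f_n, f_p on the lines,
   and its transform at (xi, eta) is a combination of powers of e^(- i pi eta)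
   with the Fourier transforms of the densities at xi as coefficients.  After a
   complex conjugation, (Gamma, Lambda) is a Heisenberg uniqueness pair iff no
   nonzero functions F_0, ..., F_n, G of the Fourier algebra A(R) satisfy
   F_0 + F_1 a + ... + F_n a^n + G a^p = 0, a = e^(i pi eta), on Lambda.

   Necessity: suppose that an open set O misses the tilde set.  Near a point of
   Pi^m*, the a_j are the roots of a monic polynomial of degree m whose
   coefficients are continuous, so if a sequence of Pi^m converges, each a_j(x0)
   stays close to some root along it, and as Lambda is closed the limit has at
   least m points in its fibre.  Decreasing m, we find an interval contained in a
   single Pi^m.  There the coefficients tau_j, cut off by a bump function, form a
   nonzero relation; for m = n + 1 one first reduces a^p modulo the monic
   polynomial of degree n + 1, and the equality of the h_(p-n) extends the
   relation from the chosen a_j to the whole fibre.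

   Sufficiency: where G does not vanish, Wiener's lemma inverts G locally in
   A(R), so a^p is locally a combination of 1, ..., a^n with coefficients in
   A(R), which is impossible at points of the dense tilde set outside Pi^(n+2);
   on Pi^(n+2) all coefficients vanish by interpolation.  Hence G = 0 by
   continuity.  The same argument kills F_n, ..., F_1 in turn, reducing a^p
   modulo the remaining relation, and then F_0 = 0. *)

(* A(R) has no unit, whereas a monic relation has the constant leading coefficient 1. Coefficients
   are therefore handled as multipliers of A(R) and become transforms only after multiplication by a
   bump or a local unit. Integrals being real-valued, the facts on A(R) are drawn from cosine and
   sine transforms of real functions, and the Fejer kernels are the only explicit transforms:
   triangles give injectivity and bumps, their differences give functions equal to 1 on an interval,
   hence Wiener's lemma.

   The strata Pi^m are in general neither open nor closed, and the tau_j are tied to A(R) only on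
   Pi^m; this is why necessity looks for an interval inside one stratum before it cuts anything off.
   The selected a_j need not be continuous, only their symmetric functions tau_j are, so closeness
   to a root is read off a product of distances. The two directions use different conditions: a
   monic relation of degree m has the a_j as its only roots, which can then be followed to limit
   points, whereas a vanishing combination on Lambda yields a relation for a^p, which does not
   single out the a_j among its roots. *)
From HB Require Import structures.
Require Import Defs.
From mathcomp Require Import all_boot all_order all_algebra.
From mathcomp Require Import all_classical all_reals all_analysis.
From mathcomp Require Import measurable_realfun ring lra zify.
From mathcomp.real_closed Require Import complex.
Set Implicit Arguments.
Unset Strict Implicit.
Unset Printing Implicit Defensive.
Import Order.TTheory GRing.Theory Num.Theory.
Import numFieldNormedType.Exports.
Local Open Scope classical_set_scope.
Local Open Scope ring_scope.

(** * Integrable functions on the line *)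

Section RealL1.
Variable R : realType.
Implicit Types (f g u v w b : R -> R).

Local Notation leb := (@lebesgue_measure R).
Definition L1R f := leb.-integrable setT (EFin \o f).
Definition intR f : R := \int[leb]_x f x.

Lemma L1R_meas f : L1R f -> measurable_fun setT f.
Proof. by move/measurable_int/measurable_EFinP. Qed.

Lemma L1R_ext f g : f =1 g -> L1R f -> L1R g.
Proof. by move=> fg; rewrite (_ : f = g)//; apply/funext. Qed.

Lemma intR_ext f g : f =1 g -> intR f = intR g.
Proof. by move=> fg; rewrite (_ : f = g)//; apply/funext. Qed.

Lemma L1R_le f g : measurable_fun setT f -> (forall x, `|f x| <= g x) -> L1R g -> L1R f.
Proof.
move=> mf fg Lg; apply: le_integrable Lg => //; first exact/measurable_EFinP.
by move=> x _ /=; rewrite lee_fin (le_trans (fg x))// ler_norm.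
Qed.

Lemma L1R_D f g : L1R f -> L1R g -> L1R (fun x => f x + g x).
Proof.
move=> Lf Lg; have := integrableD measurableT Lf Lg.
by apply: eq_integrable.
Qed.

Lemma L1R_Z k f : L1R f -> L1R (fun x => k * f x).
Proof.
by move=> Lf; have := integrableZl measurableT k Lf; apply: eq_integrable.
Qed.

Lemma L1R_N f : L1R f -> L1R (fun x => - f x).
Proof. by move=> /(L1R_Z (-1)); apply: L1R_ext => x; rewrite mulN1r. Qed.

Lemma L1R_B f g : L1R f -> L1R g -> L1R (fun x => f x - g x).
Proof. by move=> Lf /L1R_N; exact: L1R_D. Qed.

Lemma L1R_norm f : L1R f -> L1R (fun x => `|f x|).
Proof. by move=> Lf; exact: integrable_norm Lf. Qed.

Lemma L1R_0 : L1R (fun=> 0).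
Proof. exact: integrable0. Qed.

Lemma L1R_Mb M f b : L1R f -> measurable_fun setT b -> (forall x, `|b x| <= M) ->
  L1R (fun x => f x * b x).
Proof.
move=> Lf mb bM; apply: (@L1R_le _ (fun x => M * `|f x|)).
- by apply: measurable_funM => //; exact: L1R_meas.
- by move=> x; rewrite normrM mulrC ler_wpM2r.
- by apply: L1R_Z; exact: L1R_norm.
Qed.

Lemma intR_D f g : L1R f -> L1R g -> intR (fun x => f x + g x) = intR f + intR g.
Proof. by move=> Lf Lg; apply: RintegralD. Qed.

Lemma intR_Z k f : L1R f -> intR (fun x => k * f x) = k * intR f.
Proof. by move=> Lf; apply: RintegralZl. Qed.

Lemma intR_N f : L1R f -> intR (fun x => - f x) = - intR f.
Proof.
by move=> Lf; rewrite -mulN1r -intR_Z//; apply: intR_ext => x; rewrite mulN1r.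
Qed.

Lemma intR_B f g : L1R f -> L1R g -> intR (fun x => f x - g x) = intR f - intR g.
Proof. by move=> Lf Lg; apply: RintegralB. Qed.

Lemma intR_0 : intR (fun=> 0) = 0.
Proof. by rewrite /intR /Rintegral integral0. Qed.

Lemma intR_le f g : L1R f -> L1R g -> (forall x, f x <= g x) -> intR f <= intR g.
Proof. by move=> Lf Lg fg; apply: le_Rintegral. Qed.

Lemma intR_ge0 f : (forall x, 0 <= f x) -> 0 <= intR f.
Proof. by move=> f0; apply: Rintegral_ge0. Qed.

Lemma intR_EFin f : L1R f -> (intR f)%:E = (\int[leb]_x (f x)%:E)%E.
Proof. by move=> Lf; rewrite /intR /Rintegral fineK//; exact: integrable_fin_num. Qed.

Lemma dominated_cvg_L1R (f_ : nat -> R -> R) f g : (forall n, measurable_fun setT (f_ n)) ->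
  (forall x, f_ ^~ x @ \oo --> f x) -> (forall n x, `|f_ n x| <= g x) -> L1R g ->
  L1R f /\ intR (f_ n) @[n --> \oo] --> intR f.
Proof.
move=> mf cf fg Lg.
have H : {ae leb, forall x : R, setT x ->
    (fun n => (f_ n x)%:E) @ \oo --> (f x)%:E}.
  by apply: aeW => x _; apply/fine_cvgP; split; [exact: nearW|exact: cf].
have mf0 : measurable_fun setT f by exact: (measurable_fun_cvg (h := f_)).
have mf1 n : measurable_fun [set: R] (fun x => (f_ n x)%:E).
  exact/measurable_EFinP.
have mf2 : measurable_fun [set: R] (fun x => (f x)%:E) by exact/measurable_EFinP.
have H2 : {ae leb, forall (x : R) n, setT x -> (`|(f_ n x)%:E| <= (g x)%:E)%E}.
  by apply: aeW => x n _; rewrite lee_fin.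
have [Lf _ cI] := @dominated_convergence _ _ R leb setT measurableT _ _ _ mf1 mf2 H Lg H2.
split=> //.
by move: cI; rewrite -(intR_EFin Lf) => /fine_cvgP[].
Qed.

Section affine.
Variables (a c : R).
Hypothesis a0 : a != 0.
Let phi : measurableTypeR R -> measurableTypeR R := fun x => a * x + c.

Let mphi : measurable_fun setT phi.
Proof. by apply: measurable_funD => //; exact: measurable_funM. Qed.

Let k : {nonneg R} := NngNum (normr_ge0 a).

Let pf : {measure set (measurableTypeR R) -> \bar R} :=
  @measure_function_pushforward__canonical__measure_function_Measure
    _ _ _ _ _ leb phi mphi.

(** Uniqueness of Lebesgue measure reduces this to half-open intervals; for a < 0 the preimage of
    such an interval is open at the other end. *)
Let leb_affine A : measurable A -> leb A = mscale k pf A.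
Proof.
move=> mA; have Hphi := mphi; apply: lebesgue_measure_unique => //.
move=> _ [[x y] _ <-].
change (leb `]x, y]%classic = (`|a|%:E * leb (phi @^-1` `]x, y]))%E).
case: (ltgtP a 0) a0 => // [an|ap] _.
- have -> : phi @^-1` `]x, y] = `[(y - c) / a, (x - c) / a[%classic.
    apply/seteqP; split => z /=; rewrite !in_itv/= /phi => /andP[h1 h2].
      by rewrite ler_ndivrMr// ltr_ndivlMr//; apply/andP; split; lra.
    move: h1 h2; rewrite ler_ndivrMr// ltr_ndivlMr// => h1 h2.
    by apply/andP; split; lra.
  rewrite !lebesgue_measure_itv/= !lte_fin ltr_ndivrMr// divfK//.
  rewrite ltrD2r; case: ifPn => xy; last by rewrite mule0.
  by rewrite -!EFinD -EFinM ltr0_norm//; congr EFin; field.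
- have -> : phi @^-1` `]x, y] = `](x - c) / a, (y - c) / a]%classic.
    apply/seteqP; split => z /=; rewrite !in_itv/= /phi => /andP[h1 h2].
      by rewrite ltr_pdivrMr// ler_pdivlMr//; apply/andP; split; lra.
    move: h1 h2; rewrite ltr_pdivrMr// ler_pdivlMr// => h1 h2.
    by apply/andP; split; lra.
  rewrite !lebesgue_measure_itv/= !lte_fin ltr_pdivrMr// divfK//.
  rewrite ltrD2r; case: ifPn => xy; last by rewrite mule0.
  by rewrite -!EFinD -EFinM gtr0_norm//; congr EFin; field.
Qed.

Lemma ge0_integral_affine (f : R -> \bar R) : measurable_fun setT f ->
  (forall x, 0 <= f x)%E ->
  (\int[leb]_x f x = `|a|%:E * \int[leb]_x f (a * x + c)%R)%E.
Proof.
move=> mf f0; have Hphi := mphi.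
rewrite (eq_measure_integral (mscale k pf)); last first.
  by move=> A mA _; exact: leb_affine.
rewrite ge0_integral_mscale//; congr (_ * _)%E.
by rewrite /pf/= ge0_integral_pushforward.
Qed.

Lemma L1R_affine f : L1R f -> L1R (fun x => f (a * x + c)).
Proof.
move=> /integrableP[mf foo]; apply/integrableP; split.
  exact: (measurableT_comp mf mphi).
move: foo; rewrite ge0_integral_affine//; last exact: measurableT_comp.
case: (\int[_]_x _)%E => [r _||_]; rewrite ?ltey ?ltNye//.
by rewrite gt0_muley// lte_fin normr_gt0.
Qed.

Lemma intR_affine f : L1R f -> intR f = `|a| * intR (fun x => f (a * x + c)).
Proof.
move=> Lf; have mf := L1R_meas Lf.
(* The change of variables has been shown for nonnegative functions, hence the split into positive
   and negative parts. *)
have pn x : f x = f^\+ x - f^\- x by rewrite -[in LHS](funrposBneg f).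
have -> : intR f = intR (f^\+) - intR (f^\-).
  rewrite -intR_B; [|exact: integrable_funrpos|exact: integrable_funrneg].
  by apply: intR_ext => x.
have Lfc := L1R_affine Lf.
have -> : intR (fun x => f (a * x + c)) =
    intR (fun x => f^\+ (a * x + c)) - intR (fun x => f^\- (a * x + c)).
  rewrite -intR_B; last 2 first.
  - exact: (L1R_affine (integrable_funrpos measurableT Lf)).
  - exact: (L1R_affine (integrable_funrneg measurableT Lf)).
  by apply: intR_ext => x.
have H g : measurable_fun setT g -> (forall x, 0 <= g x) ->
    intR g = `|a| * intR (fun x => g (a * x + c)).
  move=> mg g0; rewrite /intR /Rintegral ge0_integral_affine//.
  - case: (\int[_]_x _)%E => [r||]/=; rewrite ?mulr0//.
      by rewrite gt0_muley ?lte_fin ?normr_gt0.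
    by rewrite gt0_muleNy ?lte_fin ?normr_gt0.
  - exact/measurable_EFinP.
have H1 := H _ (measurable_funrpos mf) (@funrpos_ge0 _ _ f).
have H2 := H _ (measurable_funrneg mf) (@funrneg_ge0 _ _ f).
by rewrite mulrBr -H1 -H2.
Qed.

End affine.

Lemma L1R_shift c f : L1R f -> L1R (fun x => f (x + c)).
Proof.
move=> /(L1R_affine c (oner_neq0 R)); apply: L1R_ext => x; by rewrite mul1r.
Qed.

Lemma intR_shift c f : L1R f -> intR (fun x => f (x + c)) = intR f.
Proof.
move=> /(intR_affine c (oner_neq0 R)) ->; rewrite normr1 mul1r.
by apply: intR_ext => x; rewrite mul1r.
Qed.

Lemma L1R_opp f : L1R f -> L1R (fun x => f (- x)).
Proof.
have N1 : -1 != 0 :> R by rewrite oppr_eq0 oner_neq0.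
by move=> /(L1R_affine 0 N1); apply: L1R_ext => x; rewrite mulN1r addr0.
Qed.

Lemma intR_opp f : L1R f -> intR (fun x => f (- x)) = intR f.
Proof.
have N1 : -1 != 0 :> R by rewrite oppr_eq0 oner_neq0.
move=> /(intR_affine 0 N1) ->; rewrite normrN1 mul1r.
by apply: intR_ext => x; rewrite mulN1r addr0.
Qed.

Lemma intR_odd f : L1R f -> (forall x, f (- x) = - f x) -> intR f = 0.
Proof.
move=> Lf fN; have := intR_opp Lf; rewrite (intR_ext fN) intR_N// => /eqP.
by rewrite -subr_eq0 -opprD oppr_eq0 -mulr2n mulrn_eq0/= => /eqP.
Qed.

(** Fubini's theorem returns marginals with values in the extended reals; being integrable they are
    finite almost everywhere, so [fine] preserves the integral. *)
Lemma L1R_fine (F : R -> \bar R) : leb.-integrable setT F ->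
  L1R (fine \o F) /\ (intR (fine \o F))%:E = (\int[leb]_x F x)%E.
Proof.
move=> iF; have mF := measurable_int _ iF.
have LF : L1R (fine \o F).
  apply: le_integrable iF => //=; first exact/measurable_EFinP/measurableT_comp.
  by move=> x _; case: (F x) => [r||]//=; rewrite ?normr0 ?leey.
split=> //; rewrite intR_EFin//; apply: ae_eq_integral => //.
  exact: measurable_int LF.
have := integrable_ae measurableT iF; apply: filterS => x /(_ I) /=.
by move=> /fineK ->.
Qed.

Section fubini.
Variable h : R * R -> R.
Hypothesis mh : measurable_fun setT h.
Variable g : R -> R.
Hypothesis hL : forall y, L1R (fun x => h (x, y)).
Hypothesis hg : forall y, intR (fun x => `|h (x, y)|) <= g y.
Hypothesis Lg : L1R g.

Let H : R * R -> \bar R := EFin \o h.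
Let mH : measurable_fun setT H. Proof. exact/measurable_EFinP. Qed.
Let mA : measurable_fun setT (abse \o H). Proof. exact: measurableT_comp. Qed.
Let A0 x : (0 <= (abse \o H) x)%E. Proof. exact: abse_ge0. Qed.

(** By Tonelli, an integrable bound [g] on the L1 norms of the slices in x yields integrability on
    the plane; the convolution and kernel estimates below come in this form. *)
Let hle : (\int[leb]_y \int[leb]_x `|(h (x, y))%:E| <= (intR g)%:E)%E.
Proof.
rewrite intR_EFin//; apply: ge0_le_integral => //.
- by move=> y _; exact: integral_ge0.
- exact: (measurable_fun_fubini_tonelli_G (m1 := leb) _ mA A0).
- exact: measurable_int Lg.
- by move=> y _; rewrite -(intR_EFin (L1R_norm (hL y))) lee_fin.
Qed.

Let hoo : (\int[leb]_y \int[leb]_x `|(h (x, y))%:E| < +oo)%E.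
Proof. by apply: le_lt_trans hle _; rewrite ltry. Qed.

Let iH : (leb \x leb)%E.-integrable setT H.
Proof. by have [_ +] := @integrable21ltyP _ _ _ _ R leb leb H mH; apply. Qed.

Let iG : leb.-integrable setT (fubini_G leb H).
Proof.
apply/integrableP; split; first exact: measurable_fubini_G iH.
apply: le_lt_trans hoo; apply: ge0_le_integral => //.
- by apply: measurableT_comp => //; exact: measurable_fubini_G iH.
- exact: (measurable_fun_fubini_tonelli_G (m1 := leb) _ mA A0).
- move=> y _; apply: (le_abse_integral leb measurableT).
  exact: (measurableT_comp mH (pair2_measurable y)).
Qed.

Lemma fubini_L1R : L1R (fun x => intR (fun y => h (x, y))).
Proof. by have [] := L1R_fine (integrable_fubini_F iH). Qed.

Lemma fubini_I :
  intR (fun x => intR (fun y => h (x, y))) = intR (fun y => intR (fun x => h (x, y))).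
Proof.
have [_ h1] := L1R_fine (integrable_fubini_F iH).
have [_ h2] := L1R_fine iG.
apply: EFin_inj; rewrite [LHS]h1 [RHS]h2.
exact: (Fubini iH).
Qed.

(** Minkowski's integral inequality in L1. *)
Lemma fubini_norm : intR (fun x => `|intR (fun y => h (x, y))|) <= intR g.
Proof.
rewrite -lee_fin; apply: le_trans hle.
rewrite intR_EFin; last exact/L1R_norm/fubini_L1R.
rewrite -(fubini_tonelli (m1 := leb) (m2 := leb) _ mA A0).
apply: ge0_le_integral => //=.
- apply/measurable_EFinP; apply: measurableT_comp => //.
  exact: L1R_meas fubini_L1R.
- exact: (measurable_fun_fubini_tonelli_F (m2 := leb) _ mA A0).
move=> x _; apply: (@le_trans _ _ `|fubini_F leb H x|%E); last first.
  apply: (le_abse_integral leb measurableT).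
  exact: (measurableT_comp mH (pair1_measurable x)).
rewrite /intR /Rintegral -/(fubini_F leb H x).
by case: fubini_F => [r||]//=; rewrite ?normr0 ?leey.
Qed.

Lemma fubini_ae_L1R : {ae leb, forall x, L1R (fun y => h (x, y))}.
Proof. exact: ae_integrable1 iH. Qed.

End fubini.

Lemma intR_ae f g : measurable_fun setT f -> measurable_fun setT g ->
  {ae leb, forall x, f x = g x} -> intR f = intR g.
Proof.
move=> mf mg fg; congr fine; apply: ae_eq_integral => //.
- exact/measurable_EFinP.
- exact/measurable_EFinP.
- case: fg => N [mN N0 sN]; exists N; split=> //.
  by apply: subset_trans sN => x /=; apply: contra_not => ->.
Qed.

Definition convolution u v x := intR (fun y => u y * v (x - y)).

Section convolution.
Variables (u v : R -> R).
Hypotheses (Lu : L1R u) (Lv : L1R v).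

Section bounded.
Variables (b : R -> R) (M : R).
Hypotheses (mb : measurable_fun setT b) (bM : forall x, `|b x| <= M).

Let h (z : R * R) : R := u z.2 * v (z.1 - z.2) * b z.1.

Let mh : measurable_fun setT h.
Proof.
have mu := L1R_meas Lu; have mv := L1R_meas Lv.
apply: measurable_funM; last exact: measurableT_comp.
apply: measurable_funM; first exact: measurableT_comp.
by apply: measurableT_comp => //; exact: measurable_funB.
Qed.

Let hL y : L1R (fun x => h (x, y)).
Proof.
apply: (@L1R_Mb M (fun x => u y * v (x - y)) b) => //.
by apply: L1R_Z; exact: L1R_shift.
Qed.

Let g y := M * intR (fun x => `|v x|) * `|u y|.

Let hg y : intR (fun x => `|h (x, y)|) <= g y.
Proof.
rewrite /g -(intR_shift (- y) (L1R_norm Lv)) mulrAC -intR_Z; last first.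
  exact: (L1R_shift (- y) (L1R_norm Lv)).
apply: intR_le => //.
- exact/L1R_norm/hL.
- exact: (L1R_Z _ (L1R_shift (- y) (L1R_norm Lv))).
- by move=> x; rewrite /h !normrM mulrC !mulrA ler_wpM2r// ler_wpM2r.
Qed.

Let Lg : L1R g. Proof. exact/L1R_Z/L1R_norm. Qed.

(** The bounded weight [b] lets one application of Fubini serve several purposes: b = 1 gives
    integrability and the norm inequality, a cosine or a sine gives the transforms of a
    convolution. *)
Lemma convolution_bounded :
  [/\ L1R (fun x => intR (fun y => u y * v (x - y) * b x)),
    intR (fun x => `|intR (fun y => u y * v (x - y) * b x)|) <=
      M * intR (fun x => `|u x|) * intR (fun x => `|v x|),
    {ae leb, forall x, L1R (fun y => u y * v (x - y) * b x)} &
    intR (fun x => intR (fun y => u y * v (x - y) * b x)) =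
    intR (fun y => u y * intR (fun x => v x * b (x + y)))].
Proof.
split.
- exact: (fubini_L1R mh hL hg Lg).
- apply: (le_trans (fubini_norm mh hL hg Lg)).
  rewrite /g intR_Z; last exact: L1R_norm.
  by rewrite -!mulrA [_ * intR (fun x => `|v x|)]mulrC.
- exact: (fubini_ae_L1R mh hL hg Lg).
- rewrite [LHS](fubini_I mh hL hg Lg); apply: intR_ext => y; rewrite /h/=.
  rewrite -(@intR_shift y); last exact: hL.
  rewrite -intR_Z.
    by apply: intR_ext => x; rewrite addrK mulrA.
  apply: (L1R_Mb (M := M)) => //.
  apply: (measurableT_comp mb); exact: measurable_funD.
Qed.

End bounded.

Let b1 : forall x : R, `|(fun=> 1) x : R| <= 1. Proof. by move=> x; rewrite normr1. Qed.

Let convolutionE x : convolution u v x = intR (fun y => u y * v (x - y) * 1).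
Proof. by apply: intR_ext => y; rewrite mulr1. Qed.

Lemma convolution_L1R : L1R (convolution u v).
Proof.
have [+ _ _ _] := convolution_bounded (measurable_cst _) b1.
by apply: L1R_ext => x; rewrite convolutionE.
Qed.

Lemma convolution_norm : intR (fun x => `|convolution u v x|) <=
  intR (fun x => `|u x|) * intR (fun x => `|v x|).
Proof.
have [_ + _ _] := convolution_bounded (measurable_cst _) b1.
by rewrite mul1r; under eq_fun do rewrite -convolutionE.
Qed.

Lemma convolution_integral b M : measurable_fun setT b -> (forall x, `|b x| <= M) ->
  intR (fun x => convolution u v x * b x) =
  intR (fun y => u y * intR (fun x => v x * b (x + y))).
Proof.
move=> mb bM; have [Lb _ _ <-] := convolution_bounded mb bM.
have [_ _ ae1 _] := convolution_bounded (measurable_cst _) b1.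
apply: intR_ae.
- by apply: measurable_funM => //; exact: L1R_meas convolution_L1R.
- exact: L1R_meas Lb.
(* The factor [b x] leaves the inner integral by linearity, which applies where the inner integrand
   is integrable, that is for almost every x. *)
- case: ae1 => N [mN N0 sN]; exists N; split=> //.
  apply: subset_trans sN => x /=; apply: contra_not => Lx.
  rewrite mulrC /convolution -intR_Z; last by apply: L1R_ext Lx => y; rewrite mulr1.
  by apply: intR_ext => y; rewrite mulrC.
Qed.

End convolution.

End RealL1.

(** * The Fejer kernel *)

Section Fejer.
Variable R : realType.
Local Notation leb := (@lebesgue_measure R).
Implicit Types (f g u v w b : R -> R).

Lemma L1R_oneDsqrV : L1R (fun x : R => (oneDsqr x)^-1).
Proof.
pose f := fun x : R => (oneDsqr x)^-1.
have mf : measurable_fun setT f.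
  by apply: continuous_measurable_fun; exact: continuous_oneDsqrV.
have f0 x : 0 <= f x by rewrite invr_ge0 (le_trans ler01)// oneDsqr_ge1.
pose g := f \_ `[0, +oo[%classic.
have Lg : L1R g.
  rewrite /L1R (_ : EFin \o g = (EFin \o f) \_ `[0, +oo[%classic); last first.
    by rewrite restrict_EFin.
  have [+ _] := integrable_mkcond (mu := leb) (EFin \o f) (measurable_itv `[0, +oo[).
  apply.
  apply/integrableP; split.
    by apply/measurable_EFinP; exact: measurable_funTS.
  under eq_integral => x _ do rewrite /= ger0_norm//.
  by rewrite integral0y_oneDsqr ltry.
apply: (L1R_le mf _ (L1R_D Lg (L1R_opp Lg))) => x.
have gE y : g y = if 0 <= y then f y else 0.
  rewrite /g patchE; case: leP => y0; [rewrite mem_set|rewrite memNset] => //=.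
  - by rewrite in_itv/= y0.
  - by rewrite in_itv/= andbT; apply/negP; rewrite -ltNge.
have fN : f (- x) = f x by rewrite /f /oneDsqr sqrrN.
rewrite ger0_norm// !gE fN oppr_ge0; have [x0|x0] := leP 0 x.
  by rewrite lerDl; case: ifP.
by rewrite (ltW x0) add0r.
Qed.

Lemma normr_sin_le (x : R) : `|sin x| <= `|x|.
Proof.
have H (y : R) : 0 <= y -> `|sin y| <= `|y|.
  move=> y0.
  have dsin z : z \in `]0, y[%R -> is_derive z 1 sin (cos z).
    by move=> _; exact: is_derive_sin.
  have csin : {within `[0, y], continuous (@sin R)}.
    by apply: continuous_subspaceT => z; exact: continuous_sin.
  have [c _] := MVT_segment y0 dsin csin.
  by rewrite sin0 !subr0 => ->; rewrite normrM ler_piMl// cos_max.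
have [x0|/ltW x0] := leP 0 x; first exact: H.
by have := H (- x); rewrite sinN !normrN oppr_ge0 => /(_ x0).
Qed.

Lemma onem_cosE (x : R) : 1 - cos x = 2 * sin (x / 2) ^+ 2.
Proof.
rewrite {1}(splitr x) cosD -!expr2 cos2sin2; ring.
Qed.

Lemma measurable_invr : measurable_fun setT (fun x : R => x^-1).
Proof.
rewrite -(setUv [set (0 : R)]); apply/measurable_funU => //.
  by apply: measurableC.
split; first exact: measurable_fun_set1.
apply: open_continuous_measurable_fun.
  apply: closed_openC; apply: accessible_closed_set1.
  by apply: hausdorff_accessible; exact: Rhausdorff.
by move=> x /set_mem/eqP x0; by apply: cvgV => //; exact: cvg_id.
Qed.

Lemma measurable_cosM (h : R) : measurable_fun setT (fun x : R => cos (h * x)).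
Proof.
have mh : measurable_fun setT (fun x : R => h * x) by exact: measurable_funM.
exact: (measurableT_comp (continuous_measurable_fun (@continuous_cos R)) mh).
Qed.

Lemma measurable_sinM (h : R) : measurable_fun setT (fun x : R => sin (h * x)).
Proof.
have mh : measurable_fun setT (fun x : R => h * x) by exact: measurable_funM.
exact: (measurableT_comp (continuous_measurable_fun (@continuous_sin R)) mh).
Qed.

(** The Fejer kernel up to normalization. Division by 0 gives it the value 0 at the origin instead
    of the limit h^2 / 2: integrals do not see this, but continuity fails there for h != 0. *)
Definition fejer (h x : R) := (1 - cos (h * x)) / x ^+ 2.

Lemma measurable_fejer h : measurable_fun setT (fejer h).
Proof.
apply: measurable_funM.
  by apply: measurable_funB => //; exact: measurable_cosM.
have mx2 : measurable_fun setT (fun x : R => x ^+ 2) by exact: measurable_funX.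
exact: (measurableT_comp measurable_invr mx2).
Qed.

Lemma fejer_ge0 h x : 0 <= fejer h x.
Proof. by rewrite divr_ge0 ?sqr_ge0// subr_ge0 cos_le1. Qed.

Lemma onem_cos_le (x : R) : 1 - cos x <= x ^+ 2 / 2.
Proof.
have : sin (x / 2) ^+ 2 <= (x / 2) ^+ 2.
  rewrite -(real_normK (num_real (sin _))) -(real_normK (num_real (x / 2))).
  by rewrite lerXn2r ?nnegrE// normr_sin_le.
rewrite onem_cosE; lra.
Qed.

(** Multiply by 1 + x^2: against the term 1 use 1 - cos (h x) <= h^2 x^2 / 2, against the term x^2
    use 1 - cos (h x) <= 2. *)
Lemma fejer_le h x : fejer h x <= (h ^+ 2 / 2 + 2) * (oneDsqr x)^-1.
Proof.
have o0 : 0 < oneDsqr x by rewrite (lt_le_trans ltr01)// oneDsqr_ge1.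
have [->|x0] := eqVneq x 0.
  rewrite /fejer expr0n/= invr0 mulr0 mulr_ge0 ?invr_ge0 ?(ltW o0)//.
  by have := sqr_ge0 h; lra.
have x2 : 0 < x ^+ 2 by rewrite exprn_even_gt0.
rewrite ler_pdivrMr// mulrAC ler_pdivlMr// /oneDsqr.
have := onem_cos_le (h * x); have := cos_geN1 (h * x); rewrite exprMn; nra.
Qed.

Lemma fejer_norm_le h x : `|fejer h x| <= (h ^+ 2 / 2 + 2) * (oneDsqr x)^-1.
Proof. by rewrite ger0_norm ?fejer_ge0// fejer_le. Qed.

Lemma L1R_fejer h : L1R (fejer h).
Proof.
apply: (L1R_le (measurable_fejer h) (fejer_norm_le h)).
by apply: L1R_Z; exact: L1R_oneDsqrV.
Qed.

(** Equal to pi, but kept as an unevaluated normalizing constant; dividing by it requires its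
    positivity. *)
Definition fejerC : R := intR (fejer 1).

Lemma fejerC_gt0 : 0 < fejerC.
Proof.
(* A lower bound for the kernel on [1, 2]: this interval lies in [0, pi], so cos x <= cos 1 there,
   and x^2 <= 4. *)
pose c : R := (1 - cos 1) / 4.
have c1 : cos 1 < 1 :> R.
  rewrite -[ltRHS]cos0 ltr_cos ?in_itv/= ?lexx ?pi_ge0 ?ler01 ?ltr01//=.
  by rewrite (le_trans _ (pi_ge2 R))// ler1n.
have c0 : 0 < c by rewrite divr_gt0// subr_gt0.
have LI : L1R (\1_(`[1, 2]%classic : set R) : R -> R).
  exact: integrable_indic_itv.
apply: (@lt_le_trans _ _ (intR (fun x => c * \1_(`[1, 2]%classic : set R) x))).
  rewrite intR_Z// mulr_gt0// /intR /Rintegral integral_indic//= setIT.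
  rewrite lebesgue_measure_itv/= lte_fin ltr1n/=; lra.
apply: intR_le; [exact: L1R_Z|exact: L1R_fejer|] => x.
rewrite indicE; have [/set_mem|_] := boolP (x \in _); last first.
  by rewrite mulr0 fejer_ge0.
rewrite /= in_itv/= mulr1 => /andP[x1 x2].
have : cos x <= cos 1.
  have [->//|xn1] := eqVneq x 1.
  have p2 := pi_ge2 R.
  have xI : x \in `[0, pi] by rewrite in_itv/=; apply/andP; split; lra.
  have oI : 1 \in `[0, pi : R] by rewrite in_itv/=; apply/andP; split; lra.
  by rewrite ltW// ltr_cos// lt_neqAle eq_sym xn1.
rewrite /fejer mul1r /c => cx; rewrite ler_pdivlMr ?exprn_gt0 ?(lt_le_trans ltr01)//.
have : x ^+ 2 <= 4 by rewrite (_ : 4 = 2 ^+ 2) ?lerXn2r ?nnegrE//; lra.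
move: c1; nra.
Qed.

Lemma fejerE h x : h != 0 -> fejer h x = h ^+ 2 * fejer 1 (h * x).
Proof.
move=> h0; rewrite /fejer mul1r; have [->|x0] := eqVneq x 0.
  by rewrite mulr0 expr0n/= invr0 !mulr0.
by field; rewrite x0 h0.
Qed.

Lemma intR_fejer h : intR (fejer h) = `|h| * fejerC.
Proof.
have [->|h0] := eqVneq h 0.
  rewrite normr0 mul0r -[RHS](@intR_0 R); apply: intR_ext => x.
  by rewrite /fejer mul0r cos0 subrr mul0r.
have hn0 : `|h| != 0 by rewrite normr_eq0.
rewrite /fejerC (intR_affine 0 h0 (L1R_fejer 1)).
rewrite (intR_ext (fun x => fejerE x h0)) intR_Z; last first.
  have := L1R_affine 0 h0 (L1R_fejer 1).
  by apply: L1R_ext => x; rewrite addr0.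
rewrite mulrA -expr2 real_normK ?num_real//; congr (_ * _).
by apply: intR_ext => x; rewrite addr0.
Qed.

(** For h >= 0 this is the triangle function max (h - |k|, 0), in the shape in which it comes out of
    three Fejer integrals. *)
Definition tri (h k : R) : R := (`|h + k| + `|h - k|) / 2 - `|k|.

(* Writing (1 - cos a) cos b as a combination of 1 - cos b, 1 - cos (a + b) and
   1 - cos (a - b) gives the transform without any inversion formula. *)
Lemma fejer_cos h k : intR (fun x => fejer h x * cos (k * x)) = fejerC * tri h k.
Proof.
have E x : fejer h x * cos (k * x) =
    2^-1 * (fejer (h + k) x + fejer (h - k) x) - fejer k x.
  rewrite /fejer [(h + k) * x]mulrDl [(h - k) * x]mulrBl cosD cosB.
  have [->|x0] := eqVneq x 0.
    by rewrite expr0n/= invr0 !mulr0 mul0r addr0 mulr0 subr0.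
  by field.
rewrite (intR_ext E).
have L1 := L1R_fejer (h + k); have L2 := L1R_fejer (h - k).
have L3 := L1R_D L1 L2.
rewrite (intR_B (L1R_Z 2^-1 L3) (L1R_fejer k)) (intR_Z 2^-1 L3) (intR_D L1 L2).
by rewrite !intR_fejer /tri; ring.
Qed.

Lemma fejer_sin h k : intR (fun x => fejer h x * sin (k * x)) = 0.
Proof.
apply: intR_odd.
  apply: (L1R_Mb (M := 1)); first exact: L1R_fejer.
    exact: measurable_sinM.
  by move=> x; exact: sin_max.
by move=> x; rewrite /fejer !mulrN sinN cosN sqrrN mulrN.
Qed.

End Fejer.

(** * Cosine and sine transforms *)

Section Transform.
Variable R : realType.
Local Notation leb := (@lebesgue_measure R).
Implicit Types (f g u v w b : R -> R).

Definition cosT u (k : R) := intR (fun x => u x * cos (k * x)).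
Definition sinT u (k : R) := intR (fun x => u x * sin (k * x)).

Lemma L1R_cos u k : L1R u -> L1R (fun x => u x * cos (k * x)).
Proof.
by move=> Lu; apply: (L1R_Mb Lu (measurable_cosM k)) => x; exact: cos_max.
Qed.

Lemma L1R_sin u k : L1R u -> L1R (fun x => u x * sin (k * x)).
Proof.
by move=> Lu; apply: (L1R_Mb Lu (measurable_sinM k)) => x; exact: sin_max.
Qed.

Lemma cosT_shift u k c : L1R u ->
  intR (fun x => u x * cos (k * (x + c))) =
  cosT u k * cos (k * c) - sinT u k * sin (k * c).
Proof.
move=> Lu; have Lc := L1R_cos k Lu; have Ls := L1R_sin k Lu.
rewrite ![_ * cos (k * c)]mulrC ![_ * sin (k * c)]mulrC -!intR_Z//.
rewrite -intR_B; [|exact: L1R_Z..].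
by apply: intR_ext => x; rewrite mulrDr cosD; ring.
Qed.

Lemma sinT_shift u k c : L1R u ->
  intR (fun x => u x * sin (k * (x + c))) =
  sinT u k * cos (k * c) + cosT u k * sin (k * c).
Proof.
move=> Lu; have Lc := L1R_cos k Lu; have Ls := L1R_sin k Lu.
rewrite ![_ * cos (k * c)]mulrC ![_ * sin (k * c)]mulrC -!intR_Z//.
rewrite -intR_D; [|exact: L1R_Z..].
by apply: intR_ext => x; rewrite mulrDr sinD; ring.
Qed.

Lemma cosT_convolution u v k : L1R u -> L1R v ->
  cosT (convolution u v) k = cosT u k * cosT v k - sinT u k * sinT v k.
Proof.
move=> Lu Lv; have Lc := L1R_cos k Lu; have Ls := L1R_sin k Lu.
rewrite /cosT (convolution_integral Lu Lv (measurable_cosM k) (M := 1)); last first.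
  by move=> x; exact: cos_max.
transitivity (intR (fun y => cosT v k * (u y * cos (k * y)) -
                             sinT v k * (u y * sin (k * y)))).
  by apply: intR_ext => y; rewrite cosT_shift//; ring.
rewrite (intR_B (L1R_Z _ Lc) (L1R_Z _ Ls)) (intR_Z _ Lc) (intR_Z _ Ls).
by rewrite mulrC [X in _ - X]mulrC.
Qed.

Lemma sinT_convolution u v k : L1R u -> L1R v ->
  sinT (convolution u v) k = sinT u k * cosT v k + cosT u k * sinT v k.
Proof.
move=> Lu Lv; have Lc := L1R_cos k Lu; have Ls := L1R_sin k Lu.
rewrite /sinT (convolution_integral Lu Lv (measurable_sinM k) (M := 1)); last first.
  by move=> x; exact: sin_max.
transitivity (intR (fun y => sinT v k * (u y * cos (k * y)) +
                             cosT v k * (u y * sin (k * y)))).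
  by apply: intR_ext => y; rewrite sinT_shift//; ring.
rewrite (intR_D (L1R_Z _ Lc) (L1R_Z _ Ls)) (intR_Z _ Lc) (intR_Z _ Ls).
by rewrite addrC mulrC [X in _ + X]mulrC.
Qed.

Lemma tri_in (h k : R) : `|k| <= h -> tri h k = h - `|k|.
Proof.
rewrite ler_norml /tri => /andP[h1 h2].
by rewrite (ger0_norm (x := h + k)) ?(ger0_norm (x := h - k)); lra.
Qed.

Lemma tri_out (h k : R) : 0 <= h -> h <= `|k| -> tri h k = 0.
Proof.
rewrite /tri => h0; have [k0|k0] := ler0P k => hk.
  by rewrite (ler0_norm (x := h + k)) ?(ger0_norm (x := h - k)); lra.
by rewrite (ger0_norm (x := h + k)) ?(ler0_norm (x := h - k)); lra.
Qed.

Lemma tri_lip (h h' k : R) : `|tri h k - tri h' k| <= `|h - h'|.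
Proof.
have := ler_dist_dist (h + k) (h' + k); have := ler_dist_dist (h - k) (h' - k).
rewrite (_ : h + k - (h' + k) = h - h'); last by ring.
rewrite (_ : h - k - (h' - k) = h - h'); last by ring.
rewrite /tri !ler_norml => /andP[a1 a2] /andP[a3 a4]; lra.
Qed.

Section uniqueness.
Variable u : R -> R.
Hypotheses (Lu : L1R u) (cu0 : forall k, cosT u k = 0) (su0 : forall k, sinT u k = 0).

Lemma measurable_tri h t : measurable_fun setT (fun x : R => tri h (x - t)).
Proof.
have mxt : measurable_fun setT (fun x : R => x - t) by exact: measurable_funB.
have mabs (f : R -> R) : measurable_fun setT f -> measurable_fun setT (fun x => `|f x|).
  exact: measurableT_comp.
apply: measurable_funB; last exact: mabs.
apply: measurable_funM => //; apply: measurable_funD; apply: mabs.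
  exact: measurable_funD.
exact: measurable_funB.
Qed.

(** Integrate u(x) fejer_h(y) cos ((x - t) y) in both orders: y first gives [fejerC] times the
    integral in question, x first gives 0 because both transforms of u vanish. *)
Let tri0 h t : intR (fun x => u x * tri h (x - t)) = 0.
Proof.
have mu := L1R_meas Lu; have mfe := measurable_fejer h.
pose H (z : R * R) := u z.1 * (fejer h z.2 * cos ((z.1 - t) * z.2)).
have mH : measurable_fun setT H.
  apply: measurable_funM; first exact: measurableT_comp.
  apply: measurable_funM; first exact: measurableT_comp.
  apply: (measurableT_comp (continuous_measurable_fun (@continuous_cos R))).
  by apply: measurable_funM => //; exact: measurable_funB.
have mc y : measurable_fun setT (fun x : R => fejer h y * cos ((x - t) * y)).
  apply: measurable_funM => //.
  apply: (measurableT_comp (continuous_measurable_fun (@continuous_cos R))).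
  by apply: measurable_funM => //; exact: measurable_funB.
have bc y x : `|fejer h y * cos ((x - t) * y)| <= fejer h y.
  by rewrite normrM (ger0_norm (fejer_ge0 h y)) ler_piMr ?fejer_ge0// cos_max.
have HL y : L1R (fun x => H (x, y)) by exact: (L1R_Mb Lu (mc y) (bc y)).
pose g y := intR (fun x => `|u x|) * fejer h y.
have Hg y : intR (fun x => `|H (x, y)|) <= g y.
  rewrite /g mulrC -intR_Z; last exact: L1R_norm.
  apply: intR_le; [exact/L1R_norm/HL|exact/L1R_Z/L1R_norm|] => x.
  by rewrite /H normrM mulrC ler_wpM2r.
have Lg : L1R g by apply: L1R_Z; exact: L1R_fejer.
have := fubini_I mH HL Hg Lg.
under [X in intR X = _]eq_fun => x.
  rewrite /H/= intR_Z; last exact: L1R_cos (L1R_fejer h).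
  rewrite fejer_cos mulrCA; over.
rewrite intR_Z; last first.
  apply: (L1R_Mb Lu (measurable_tri h t) (M := `|h|)) => x.
  by have := tri_lip h 0 (x - t); rewrite (tri_out (lexx 0))// !subr0.
rewrite [RHS](_ : _ = 0) => [/eqP|].
  by rewrite mulf_eq0 gt_eqF ?fejerC_gt0//= => /eqP.
rewrite -[RHS](@intR_0 R); apply: intR_ext => y.
rewrite /H/= -[RHS](mulr0 (fejer h y)).
transitivity (fejer h y * intR (fun x => u x * cos (y * (x - t)))).
  rewrite -intR_Z; first by apply: intR_ext => x; rewrite mulrCA [(x - t) * y]mulrC.
  apply: (L1R_Mb Lu (M := 1)) => [|x]; last exact: cos_max.
  apply: (measurableT_comp (continuous_measurable_fun (@continuous_cos R))).
  by apply: measurable_funM => //; exact: measurable_funB.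
by rewrite cosT_shift// cu0 su0 !mul0r subrr.
Qed.

Let L1R_tri h t : L1R (fun x => u x * tri h (x - t)).
Proof.
apply: (L1R_Mb Lu (measurable_tri h t) (M := `|h|)) => x.
by have := tri_lip h 0 (x - t); rewrite (tri_out (lexx 0))// !subr0.
Qed.

(** The difference quotients of the triangle function in its half-width are trapezoids of height 1
    which converge to the indicator of the open ball; [tri_lip] bounds them by 1, so dominated
    convergence applies. *)
Let ball0 t h : 0 < h -> intR (fun x => u x * \1_(ball t h) x) = 0.
Proof.
move=> h0; pose d (n : nat) : R := h * n.+1%:R^-1.
have d0 n : 0 < d n by rewrite mulr_gt0// invr_gt0.
have dh n : d n <= h by rewrite ler_piMr ?(ltW h0)// invf_le1// ler1n.
pose f_ n x := u x * ((tri h (x - t) - tri (h - d n) (x - t)) / d n).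
have mf n : measurable_fun setT (f_ n).
  apply: measurable_funM; first exact: L1R_meas.
  by apply: measurable_funM => //; apply: measurable_funB; exact: measurable_tri.
have If n : intR (f_ n) = 0.
  have -> : intR (f_ n) = intR (fun x => (d n)^-1 * (u x * tri h (x - t) -
                                           u x * tri (h - d n) (x - t))).
    by apply: intR_ext => x; rewrite /f_; ring.
  by rewrite intR_Z ?intR_B ?tri0 ?subrr ?mulr0//; exact: L1R_B.
have fu n x : `|f_ n x| <= `|u x|.
  have dn := d0 n; rewrite normrM ler_piMr// normrM normfV (gtr0_norm dn).
  rewrite ler_pdivrMr// mul1r (le_trans (tri_lip _ _ _))//.
  by rewrite opprB addrC subrK gtr0_norm.
have cf x : f_ ^~ x @ \oo --> u x * \1_(ball t h) x.
  apply: cvgMr; rewrite indicE; have [/set_mem|/negP] := boolP (x \in _).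
    rewrite /ball/= distrC => xt.
    have e0 : 0 < (h - `|x - t|) / h by rewrite divr_gt0// subr_gt0.
    apply: cvg_near_cst; have := near_infty_natSinv_lt (PosNum e0).
    apply: filterS => n /=; rewrite ltr_pdivlMr// mulrC -/(d n) => dn.
    have dn0 := d0 n; rewrite !tri_in; last 2 first.
    - lra.
    - lra.
    by rewrite (_ : _ - _ = d n) ?divff ?gt_eqF//; lra.
  rewrite inE /ball/= distrC => /negP; rewrite -leNgt => xt.
  apply: cvg_near_cst; apply: nearW => n.
  have := dh n; have := d0 n => h1 h2.
  by rewrite !tri_out ?subrr ?mul0r//; lra.
have [_] := dominated_cvg_L1R mf cf fu (L1R_norm Lu).
under eq_fun do rewrite If.
by move=> If0; exact: (cvg_unique _ If0 (cvg_cst _)).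
Qed.

(** All averages of u over balls vanish, so u vanishes at each of its Lebesgue points. *)
Lemma transform_inj : {ae leb, forall x, u x = 0}.
Proof.
pose E (x : R) (n : nat) := ball x (n.+1%:R^-1 : R).
have hE x : nicely_shrinking x (E x).
  split; first by move=> n; exact: measurable_ball.
  have n0 n : 0 < (n.+1%:R^-1 : R) by rewrite invr_gt0.
  exists (1, fun n => PosNum (n0 n)); split => //=.
  - exact: cvg_harmonic.
  - by move=> n.
  - by move=> n; rewrite mul1e.
have lu : locally_integrable setT u.
  exact: open_integrable_locally openT Lu.
have [N [mN N0 sN]] := lebesgue_differentiation lu.
exists N; split=> //; apply: subset_trans sN => x /=; apply: contra_not.
move=> /(nice_lebesgue_differentiation hE lu).
have E0 n : (\int[leb]_(y in E x n) (u y)%:E = 0)%E.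
  rewrite integral_mkcond.
  transitivity (\int[leb]_y (u y * \1_(ball x (n.+1%:R^-1 : R)) y)%:E)%E.
    apply: eq_integral => y _; rewrite patchE indicE /E.
    by case: (y \in _); rewrite ?mulr1 ?mulr0.
  rewrite -intR_EFin ?ball0 ?invr_gt0//.
  apply: (L1R_Mb (M := 1) Lu) => [|y].
    by apply: measurable_indic; exact: measurable_ball.
  by rewrite indicE normr_nat; case: (y \in _).
under eq_fun do rewrite E0 mule0.
by move=> h; apply: EFin_inj; exact: (cvg_unique _ h (cvg_cst _)).
Qed.

End uniqueness.
End Transform.

(** * Geometrically convergent series in L1 *)

Section L1series.
Variable R : realType.
Local Notation leb := (@lebesgue_measure R).

Lemma L1R_sum n (F : nat -> R -> R) : (forall k, L1R (F k)) ->
  L1R (fun x => \sum_(k < n) F k x).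
Proof.
move=> LF; elim: n => [|n IHn].
  by apply: L1R_ext (L1R_0 R) => x; rewrite big_ord0.
by apply: L1R_ext (L1R_D IHn (LF n)) => x; rewrite big_ord_recr.
Qed.

Lemma intR_sum n (F : nat -> R -> R) : (forall k, L1R (F k)) ->
  intR (fun x => \sum_(k < n) F k x) = \sum_(k < n) intR (F k).
Proof.
move=> LF; elim: n => [|n IHn].
  rewrite big_ord0 -[RHS](@intR_0 R); apply: intR_ext => x; by rewrite big_ord0.
rewrite big_ord_recr/= -IHn -intR_D//; last exact: L1R_sum.
by apply: intR_ext => x; rewrite big_ord_recr.
Qed.

Variables (s : nat -> R -> R) (B r : R).
Hypotheses (Ls : forall k, L1R (s k)) (r0 : 0 <= r) (r1 : r < 1).
Hypothesis sB : forall k, intR (fun x => `|s k x|) <= B * r ^+ k.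

Let D (x : R) : \bar R := (\sum_(k <oo) `|s k x|%:E)%E.

Let mD : measurable_fun setT D.
Proof.
apply: ge0_emeasurable_sum => // k _; apply/measurable_EFinP.
exact: L1R_meas (L1R_norm (Ls k)).
Qed.

Let D0 x : (0 <= D x)%E.
Proof. by apply: nneseries_ge0 => k _ _; rewrite lee_fin. Qed.

Let iD : leb.-integrable setT D.
Proof.
apply/integrableP; split=> //.
under eq_integral => x _ do rewrite gee0_abs//.
rewrite integral_nneseries//; last first.
  move=> k; apply/measurable_EFinP; exact: L1R_meas (L1R_norm (Ls k)).
have B0 : 0 <= B.
  by have := sB 0; rewrite expr0 mulr1; apply: le_trans; exact: intR_ge0.
apply: (@le_lt_trans _ _ (B / (1 - r))%:E); last exact: ltry.
apply: lime_le.
  by apply: is_cvg_nneseries => k _ _; exact: integral_ge0.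
apply: nearW => n; rewrite big_mkord.
under eq_bigr => k _ do rewrite -(intR_EFin (L1R_norm (Ls k))).
rewrite sumEFin lee_fin; apply: (@le_trans _ _ (\sum_(k < n) B * r ^+ k)).
  by apply: ler_sum.
have := @geometric_seriesE R B r (negbT (lt_eqF r1)).
move=> /(congr1 (fun f => f n)); rewrite /series/= big_mkord => ->.
rewrite ler_pM2r ?invr_gt0 ?subr_gt0// ler_piMr// lerBlDr lerDl.
exact: exprn_ge0.
Qed.

(** Dominated convergence with the sum [D] of the absolute values as majorant. Testing against every
    [b] bounded by 1 covers the cosine and sine transforms at all frequencies. *)
Lemma L1R_series : exists2 S : R -> R, L1R S &
  forall b : R -> R, measurable_fun setT b -> (forall x, `|b x| <= 1) ->
  series (fun k => intR (fun x => s k x * b x)) @ \oo --> intR (fun x => S x * b x).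
Proof.
(* Terms are replaced by 0 on the null set where [D] is infinite, so that the series converges at
   every point. *)
pose s' k x := if D x \is a fin_num then s k x else 0.
pose E := [set x | D x \is a fin_num].
have mE : measurable E.
  by rewrite -[E]setTI; exact: emeasurable_fin_num.
have ms' k : measurable_fun setT (s' k).
  rewrite (_ : s' k = fun x => s k x * \1_E x).
    by apply: measurable_funM; [exact: L1R_meas|exact: measurable_indic].
  apply/funext => x; rewrite /s' indicE; case: ifPn => h.
    by rewrite mem_set// mulr1.
  by rewrite memNset ?mulr0//; exact/negP.
have Ls' k : L1R (s' k).
  apply: (L1R_le (ms' k) _ (L1R_norm (Ls k))) => x.
  by rewrite /s'; case: ifP; rewrite ?normr0.
have [LD _] := L1R_fine iD.
have dom n x : \sum_(k < n) `|s' k x| <= fine (D x).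
  rewrite /s'; have [Dx|Dx] := boolP (D x \is a fin_num); last first.
    by rewrite big1 ?fine_ge0// => k _; rewrite normr0.
  rewrite -lee_fin fineK// -sumEFin -(big_mkord xpredT (fun k => `|s k x|%:E)).
  by apply: nneseries_lim_ge => k _ _; rewrite lee_fin.
have cs' x : cvgn (series (s' ^~ x)).
  apply: normed_cvg; apply: nondecreasing_is_cvgn.
    by apply: nondecreasing_series => k _ _; exact: normr_ge0.
  exists (fine (D x)) => _ [n _ <-]; rewrite /= /series/= big_mkord; exact: dom.
pose S x := limn (series (s' ^~ x)).
have key (b : R -> R) : measurable_fun setT b -> (forall x, `|b x| <= 1) ->
    L1R (fun x => S x * b x) /\
    series (fun k => intR (fun x => s k x * b x)) @ \oo -->
      intR (fun x => S x * b x).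
  move=> mb b1.
  pose f_ n x := (\sum_(k < n) s' k x) * b x.
  have mf n : measurable_fun setT (f_ n).
    by apply: measurable_funM => //; apply: L1R_meas; exact: L1R_sum.
  have cf x : f_ ^~ x @ \oo --> S x * b x.
    apply: cvgMl.
    rewrite (_ : (fun n => \sum_(k < n) s' k x) = series (s' ^~ x)).
      exact: cs'.
    by apply/funext => n; rewrite /series/= big_mkord.
  have df n x : `|f_ n x| <= (fine \o D) x.
    rewrite normrM; apply: le_trans (dom n x).
    by apply: le_trans (ler_norm_sum _ _ _); rewrite ler_piMr.
  have [LS cS] := dominated_cvg_L1R mf cf df LD; split=> //.
  rewrite (_ : series _ = fun n => intR (f_ n))//; apply/funext => n.
  have Lsb k := L1R_Mb (Ls k) mb b1.
  rewrite /series/= big_mkord -(intR_sum n Lsb).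
  apply: intR_ae => //.
    exact: L1R_meas (L1R_sum n Lsb).
  have [N [mN N0 sN]] := integrable_ae measurableT iD.
  exists N; split=> //; apply: subset_trans sN => x /=.
  apply: contra_not => /(_ I) Dx; rewrite /f_ mulr_suml.
  by apply: eq_bigr => k _; rewrite /s' Dx.
exists S; last by move=> b mb b1; have [] := key b mb b1.
have [|+ _] := key (fun=> 1) (measurable_cst _); first by move=> x; rewrite normr1.
by apply: L1R_ext => x; rewrite mulr1.
Qed.

End L1series.

(** * Local inversion of Fourier transforms *)

Section Wiener.
Variable R : realType.
Local Notation leb := (@lebesgue_measure R).
Implicit Types (h k x y t : R).

(* The de la Vallee Poussin kernel: its transform is 1 on [-h, h]. *)
Definition vp h x : R := (fejer (2 * h) x - fejer h x) / (fejerC R * h).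

Lemma L1R_vp h : L1R (vp h).
Proof.
have := L1R_Z (fejerC R * h)^-1 (L1R_B (L1R_fejer (2 * h)) (L1R_fejer h)).
by apply: L1R_ext => x; rewrite /vp mulrC.
Qed.

Lemma cosT_vp h k : 0 < h -> `|k| <= h -> cosT (vp h) k = 1.
Proof.
move=> h0 kh; have C0 := fejerC_gt0 R.
pose a := (fejerC R * h)^-1.
have L1 := L1R_cos k (L1R_fejer (2 * h)); have L2 := L1R_cos k (L1R_fejer h).
transitivity (intR (fun x => a * (fejer (2 * h) x * cos (k * x) -
                                  fejer h x * cos (k * x)))).
  by apply: intR_ext => x; rewrite /vp -/a; ring.
rewrite (intR_Z _ (L1R_B L1 L2)) (intR_B L1 L2) !fejer_cos !tri_in//; last lra.
by rewrite /a; field; rewrite !gt_eqF.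
Qed.

Lemma sinT_vp h k : sinT (vp h) k = 0.
Proof.
pose a := (fejerC R * h)^-1.
have L1 := L1R_sin k (L1R_fejer (2 * h)); have L2 := L1R_sin k (L1R_fejer h).
transitivity (intR (fun x => a * (fejer (2 * h) x * sin (k * x) -
                                  fejer h x * sin (k * x)))).
  by apply: intR_ext => x; rewrite /vp -/a; ring.
by rewrite (intR_Z _ (L1R_B L1 L2)) (intR_B L1 L2) !fejer_sin subrr mulr0.
Qed.

Lemma vpE h x : 0 < h -> vp h x = h * vp 1 (h * x).
Proof.
move=> h0; have C0 := fejerC_gt0 R.
have f2 : fejer (2 * h) x = h ^+ 2 * fejer 2 (h * x).
  rewrite fejerE ?mulf_neq0 ?gt_eqF// (@fejerE _ 2)// -[2 * h * x]mulrA; ring.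
rewrite /vp f2 (fejerE x (lt0r_neq0 h0)) !mulr1.
by field; rewrite !gt_eqF.
Qed.

Let M : R := ((2 ^+ 2 / 2 + 2) + (1 / 2 + 2)) / fejerC R.

Let M0 : 0 < M. Proof. by rewrite divr_gt0 ?fejerC_gt0//; lra. Qed.

Let vp1_le x : `|vp 1 x| <= M * (oneDsqr x)^-1.
Proof.
have C0 := fejerC_gt0 R.
have h1 := fejer_norm_le (2 * 1) x; have h2 := fejer_norm_le 1 x.
rewrite /vp (mulr1 (fejerC R)) normrM normfV (gtr0_norm C0) ler_pdivrMr//.
have -> : M * (oneDsqr x)^-1 * fejerC R =
    (2 ^+ 2 / 2 + 2) * (oneDsqr x)^-1 + (1 / 2 + 2) * (oneDsqr x)^-1.
  by rewrite /M mulrAC divfK ?gt_eqF// mulrDl.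
rewrite (le_trans (ler_normB _ _))// lerD//; first by move: h1; rewrite mulr1.
by move: h2; rewrite expr1n.
Qed.

Let vp1_bounded x : `|vp 1 x| <= M.
Proof.
rewrite (le_trans (vp1_le x))// ler_piMr ?(ltW M0)// oneDsqrV_le1//.
Qed.

Let mvp : measurable_fun setT (vp 1).
Proof. exact: L1R_meas (L1R_vp 1). Qed.

Let vp1_continuous x : x != 0 -> {for x, continuous (vp 1)}.
Proof.
move=> x0; rewrite /vp; apply: cvgMl; apply: cvgB.
  apply: cvgM; last first.
    apply: cvgV; first by rewrite expf_neq0.
    exact: exprn_continuous.
  apply: cvgB; first exact: cvg_cst.
  apply: (@continuous_comp _ _ _ (fun x => 2 * 1 * x) (@cos R)).
    by apply: cvgMr; exact: cvg_id.
  exact: continuous_cos.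
apply: cvgM; last first.
  apply: cvgV; first by rewrite expf_neq0.
  exact: exprn_continuous.
apply: cvgB; first exact: cvg_cst.
apply: (@continuous_comp _ _ _ (fun x => 1 * x) (@cos R)).
  by apply: cvgMr; exact: cvg_id.
exact: continuous_cos.
Qed.

Definition modulus t : R := intR (fun x => `|vp 1 x - vp 1 (x - t)|).

Let L1R_diff t : L1R (fun x => vp 1 x - vp 1 (x - t)).
Proof. by apply: L1R_B; [|apply: L1R_shift]; exact: L1R_vp. Qed.

Let modulus_ge0 t : 0 <= modulus t. Proof. exact: intR_ge0. Qed.

Let modulus_le t : modulus t <= 2 * intR (fun x => `|vp 1 x|).
Proof.
have L1 := L1R_norm (L1R_vp 1); have L2 := L1R_shift (- t) L1.
rewrite mulr_natl mulr2n -[X in _ + X](intR_shift (- t))// -intR_D//.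
apply: intR_le; [exact/L1R_norm/L1R_diff|exact: L1R_D|] => x.
exact: ler_normB.
Qed.

Let measurable_modulus : measurable_fun setT modulus.
Proof.
pose H (z : R * R) : \bar R := `|vp 1 z.1 - vp 1 (z.1 - z.2)|%:E.
have mH : measurable_fun setT H.
  apply/measurable_EFinP; apply: measurableT_comp => //.
  apply: measurable_funB; first exact: measurableT_comp.
  apply: (measurableT_comp mvp); exact: measurable_funB.
have H0 z : (0 <= H z)%E by rewrite lee_fin.
have := measurable_fun_fubini_tonelli_G (m1 := leb) H mH H0.
exact: measurableT_comp.
Qed.

(** Continuity of translation in L1, obtained here by dominated convergence since [vp 1] is
    continuous off 0 and decays like 1 / (1 + x^2). *)
Let modulus_cvg t : modulus (n.+1%:R^-1 * t) @[n --> \oo] --> 0.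
Proof.
(* The indicator masks the origin, where the value of [vp 1] is the default of a division by 0. *)
pose f_ (n : nat) x := `|vp 1 x - vp 1 (x - n.+1%:R^-1 * t)| * \1_(~` [set 0]) x.
have m0 : measurable (~` [set (0 : R)]) by exact: measurableC.
have mf n : measurable_fun setT (f_ n).
  apply: measurable_funM; last exact: measurable_indic.
  exact: L1R_meas (L1R_norm (L1R_diff _)).
have cf x : f_ ^~ x @ \oo --> (0 : R).
  have [->|x0] := eqVneq x 0.
    apply: cvg_near_cst; apply: nearW => n.
    by rewrite /f_ indicE memNset ?mulr0//; apply.
  have tn : x - n.+1%:R^-1 * t @[n --> \oo] --> x.
    rewrite -[X in _ --> X]subr0; apply: cvgB; first exact: cvg_cst.
    rewrite -(mul0r t); apply: cvgMl; exact: cvg_harmonic.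
  have := cvg_comp _ _ tn (vp1_continuous x0) => vn.
  have h : vp 1 x - vp 1 (x - n.+1%:R^-1 * t) @[n --> \oo] --> vp 1 x - vp 1 x.
    by apply: cvgB; [exact: cvg_cst|exact: vn].
  rewrite -(mul0r (\1_(~` [set 0]) x)); apply: cvgMl.
  by have := cvg_norm h; rewrite subrr normr0; apply.
(* The second summand majorizes the translates: 1 + x^2 <= 2 (1 + t^2) (1 + (x - s)^2) whenever s^2
   <= t^2. *)
pose G x := (M + M * (2 * (1 + t ^+ 2))) * (oneDsqr x)^-1.
have LG : L1R G by apply: L1R_Z; exact: L1R_oneDsqrV.
have o0 x : 0 < oneDsqr x by rewrite (lt_le_trans ltr01)// oneDsqr_ge1.
have df n x : `|f_ n x| <= G x.
  rewrite /f_ normrM normr_id [X in _ * X]ger0_norm ?indicE ?ler0n//.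
  apply: (@le_trans _ _ `|vp 1 x - vp 1 (x - n.+1%:R^-1 * t)|).
    by rewrite ler_piMr// lern1; case: (_ \in _).
  rewrite (le_trans (ler_normB _ _))// /G mulrDl lerD//.
  rewrite (le_trans (vp1_le _))// -mulrA ler_wpM2l ?(ltW M0)//.
  rewrite ler_pdivlMr// mulrC ler_pdivrMr// /oneDsqr.
  set s := n.+1%:R^-1 * t.
  have st : s ^+ 2 <= t ^+ 2.
    rewrite /s exprMn ler_piMl ?sqr_ge0// exprn_ile1 ?invr_ge0//.
    by rewrite invf_le1// ler1n.
  have := sqr_ge0 (x - 2 * s); have := sqr_ge0 (x - s); have := sqr_ge0 t.
  move: st; nra.
have [_] := dominated_cvg_L1R mf cf df LG; rewrite intR_0.
rewrite (_ : (fun n => intR (f_ n)) = (fun n => modulus (n.+1%:R^-1 * t)))//.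
apply/funext => n; apply: intR_ae => //.
  exact: L1R_meas (L1R_norm (L1R_diff _)).
exists [set 0]; split=> //; first exact: lebesgue_measure_set1.
move=> x /= h; apply: contrapT => x0; apply: h.
by rewrite /f_ indicE mem_set// mulr1.
Qed.

Let modulus_vp h t : 0 < h ->
  intR (fun x => `|vp h x - vp h (x - t)|) = modulus (h * t).
Proof.
move=> h0; have hn0 := lt0r_neq0 h0.
rewrite /modulus (intR_affine 0 hn0 (L1R_norm (L1R_diff _))) (gtr0_norm h0).
rewrite -intR_Z; last first.
  exact: (L1R_affine 0 hn0 (L1R_norm (L1R_diff _))).
apply: intR_ext => x; rewrite addr0 (vpE x h0) (vpE (x - t) h0) -mulrBr normrM.
by rewrite (gtr0_norm h0) mulrBr.
Qed.

Section small_kernel.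
Variable w : R -> R.
Hypotheses (Lw : L1R w) (w0 : intR w != 0).

Let small h : R -> R := fun x => vp h x - (intR w)^-1 * convolution w (vp h) x.

Let L1R_small h : L1R (small h).
Proof.
apply: L1R_B; first exact: L1R_vp.
by apply: L1R_Z; apply: convolution_L1R => //; exact: L1R_vp.
Qed.

(** As w / [intR w] has integral 1, [small h] is the average of vp_h(x) - vp_h(x - y) with this
    weight in y. Minkowski's inequality and the dilation [vpE] then bring in the modulus at h y. *)
Let small_norm h : 0 < h -> intR (fun x => `|small h x|) <=
  `|intR w|^-1 * intR (fun y => `|w y| * modulus (h * y)).
Proof.
move=> h0; have mw := L1R_meas Lw; have mh := L1R_meas (L1R_vp h).
pose H (z : R * R) := w z.2 * (vp h z.1 - vp h (z.1 - z.2)).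
have mH : measurable_fun setT H.
  apply: measurable_funM; first exact: measurableT_comp.
  apply: measurable_funB; first exact: measurableT_comp.
  by apply: (measurableT_comp mh); exact: measurable_funB.
have LD y : L1R (fun x => vp h x - vp h (x - y)).
  by apply: L1R_B; [|apply: L1R_shift]; exact: L1R_vp.
have HL y : L1R (fun x => H (x, y)) := L1R_Z (w y) (LD y).
pose g y := `|w y| * modulus (h * y).
have Hg y : intR (fun x => `|H (x, y)|) <= g y.
  rewrite /g -modulus_vp// -intR_Z; last exact: L1R_norm.
  by under eq_fun do rewrite /H/= normrM.
have Lg : L1R g.
  apply: (L1R_Mb (L1R_norm Lw) (M := 2 * intR (fun x => `|vp 1 x|))).
    apply: (measurableT_comp measurable_modulus); exact: measurable_funM.
  by move=> y; rewrite ger0_norm ?modulus_ge0// modulus_le.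
have vpb x : `|vp h x| <= h * M.
  by rewrite vpE// normrM (gtr0_norm h0) ler_pM2l// vp1_bounded.
have smallE x : small h x = (intR w)^-1 * intR (fun y => H (x, y)).
  rewrite /small -[vp h x](mulKf w0) -mulrBr; congr (_ * _).
  rewrite mulrC -intR_Z// -intR_B.
  - by apply: intR_ext => y; rewrite /H/=; ring.
  - exact: L1R_Z.
  - apply: (L1R_Mb Lw (M := h * M)) => [|y]; last exact: vpb.
    by apply: (measurableT_comp mh); exact: measurable_funB.
under eq_fun do rewrite smallE normrM normfV.
rewrite intR_Z; last exact: L1R_norm (fubini_L1R mH HL Hg Lg).
by rewrite ler_pM2l ?invr_gt0 ?normr_gt0//; exact: (fubini_norm mH HL Hg Lg).
Qed.

Let small_exists : exists2 h, 0 < h & intR (fun x => `|small h x|) <= 2^-1.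
Proof.
pose f_ (n : nat) y := `|w y| * modulus (n.+1%:R^-1 * y).
have Lf n : L1R (f_ n).
  apply: (L1R_Mb (L1R_norm Lw) (M := 2 * intR (fun x => `|vp 1 x|))).
    apply: (measurableT_comp measurable_modulus); exact: measurable_funM.
  by move=> y; rewrite ger0_norm ?modulus_ge0// modulus_le.
have cf y : f_ ^~ y @ \oo --> 0.
  by rewrite -(mulr0 `|w y|); apply: cvgMr; exact: modulus_cvg.
pose G y := (2 * intR (fun x => `|vp 1 x|)) * `|w y|.
have df n y : `|f_ n y| <= G y.
  by rewrite normrM normr_id mulrC ler_wpM2r// ger0_norm ?modulus_ge0// modulus_le.
have [_] := dominated_cvg_L1R (fun n => L1R_meas (Lf n)) cf df (L1R_Z _ (L1R_norm Lw)).
rewrite intR_0 => /cvgrPdist_lt /(_ (2^-1 * `|intR w|)) [|N _ /(_ N (leqnn N))].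
  by rewrite mulr_gt0 ?invr_gt0 ?normr_gt0.
rewrite /= sub0r normrN => /ltr_normlW h2.
exists N.+1%:R^-1; first by rewrite invr_gt0.
rewrite (le_trans (small_norm _)) ?invr_gt0//.
by rewrite mulrC ler_pdivrMr ?normr_gt0// ltW.
Qed.

(* With c = 1 / intR w and v = vp h, the function g = v - c (w * v) has L1 norm
   at most 1/2 for small h, and its transform is 1 - c w^ on [-h, h].  Hence the
   series of the v * g * ... * g converges to some S with S^ = 1 / (c w^) there. *)
Lemma wiener_real : exists z d, [/\ L1R z, 0 < d & forall k, `|k| <= d ->
  cosT w k * cosT z k - sinT w k * sinT z k = 1 /\
  sinT w k * cosT z k + cosT w k * sinT z k = 0].
Proof.
have [h h0 nh] := small_exists; set g := small h in nh.
have Lg : L1R g by exact: L1R_small.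
pose s n := iter n (fun s => convolution s g) (vp h).
have Ls n : L1R (s n).
  by elim: n => [|n IHn]; [exact: L1R_vp|exact: convolution_L1R].
have sB n : intR (fun x => `|s n x|) <= intR (fun x => `|vp h x|) * 2^-1 ^+ n.
  elim: n => [|n IHn]; first by rewrite expr0 mulr1.
  rewrite (le_trans (convolution_norm (Ls n) Lg))// exprSr mulrA.
  by rewrite ler_pM// intR_ge0.
have r1 : 2^-1 < 1 :> R by lra.
have [S LS cS] := L1R_series Ls (ltac:(lra) : 0 <= 2^-1 :> R) r1 sB.
exists (fun x => (intR w)^-1 * S x), h; split=> //; first exact: L1R_Z.
move=> k kh.
have cc : series (fun j => cosT (s j) k) @ \oo --> cosT S k.
  by apply: cS => [|x]; [exact: measurable_cosM|exact: cos_max].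
have dd : series (fun j => sinT (s j) k) @ \oo --> sinT S k.
  by apply: cS => [|x]; [exact: measurable_sinM|exact: sin_max].
have shift (c : nat -> R) (l : R) : series c @ \oo --> l ->
    series (fun j => c j.+1) @ \oo --> l - c 0%N.
  move=> cl; rewrite (_ : series _ = (fun n => series c n.+1 - c 0%N)).
    by apply: cvgB; [rewrite (cvg_shiftS (series c))|exact: cvg_cst].
  apply/funext => n; rewrite /series/= !big_mkord big_ord_recl/=.
  by rewrite addrC addKr.
have lin (c d : nat -> R) (a b l m : R) : series c @ \oo --> l -> series d @ \oo --> m ->
    series (fun j => c j * a + d j * b) @ \oo --> l * a + m * b.
  move=> cl dm; rewrite (_ : series _ = (fun n => series c n * a + series d n * b)).
    by apply: cvgD; apply: cvgMl.
  by apply/funext => n; rewrite /series/= big_split/= !mulr_suml.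
(* Removing the first term of the series amounts to multiplying its transform by that of g: S^ - 1 =
   S^ g^ on [-h, h]. [E1] and [E2] are the cosine and sine parts. *)
have E1 : cosT S k - 1 = cosT S k * cosT g k + sinT S k * - sinT g k.
  apply: (cvg_unique _ _ (lin _ _ _ _ _ _ cc dd)) => //.
  rewrite -(cosT_vp h0 kh); have := shift _ _ cc.
  by under eq_fun do rewrite /= cosT_convolution// -mulrN.
have E2 : sinT S k = sinT S k * cosT g k + cosT S k * sinT g k.
  apply: (cvg_unique _ _ (lin _ _ _ _ _ _ dd cc)) => //.
  have := shift _ _ dd; rewrite /= sinT_vp subr0.
  by under eq_fun do rewrite /= sinT_convolution//.
have Lv := L1R_vp h; have Lwv := convolution_L1R Lw Lv.
have Cg : cosT g k = 1 - (intR w)^-1 * cosT w k.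
  transitivity (intR (fun x => vp h x * cos (k * x) -
      (intR w)^-1 * (convolution w (vp h) x * cos (k * x)))).
    by apply: intR_ext => x; rewrite /g /small; ring.
  have L2 := L1R_cos k Lwv.
  rewrite (intR_B (L1R_cos k Lv) (L1R_Z _ L2)) (intR_Z _ L2).
  rewrite -/(cosT _ _) -/(cosT (convolution _ _) _) cosT_convolution//.
  by rewrite cosT_vp// sinT_vp mulr1 mulr0 subr0.
have Sg : sinT g k = - ((intR w)^-1 * sinT w k).
  transitivity (intR (fun x => vp h x * sin (k * x) -
      (intR w)^-1 * (convolution w (vp h) x * sin (k * x)))).
    by apply: intR_ext => x; rewrite /g /small; ring.
  have L2 := L1R_sin k Lwv.
  rewrite (intR_B (L1R_sin k Lv) (L1R_Z _ L2)) (intR_Z _ L2).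
  rewrite -/(sinT _ _) -/(sinT (convolution _ _) _) sinT_convolution//.
  by rewrite cosT_vp// sinT_vp mulr1 mulr0 addr0 sub0r.
have Cz : cosT (fun x => (intR w)^-1 * S x) k = (intR w)^-1 * cosT S k.
  rewrite /cosT -intR_Z; last exact: L1R_cos.
  by apply: intR_ext => x; rewrite mulrA.
have Sz : sinT (fun x => (intR w)^-1 * S x) k = (intR w)^-1 * sinT S k.
  rewrite /sinT -intR_Z; last exact: L1R_sin.
  by apply: intR_ext => x; rewrite mulrA.
move: E1 E2; rewrite Cz Sz Cg Sg; set c := (intR w)^-1 => E1 E2.
by split; lra.
Qed.

End small_kernel.
End Wiener.

Local Open Scope complex_scope.

(** * Linearity, symmetries and continuity of the transforms *)

Section TransformLinear.
Variable R : realType.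
Implicit Types (u v w : R -> R) (k : R).

Lemma cosT_D u v k : L1R u -> L1R v ->
  cosT (fun x => u x + v x) k = cosT u k + cosT v k.
Proof.
move=> Lu Lv; rewrite /cosT -intR_D; [|exact: L1R_cos..].
by apply: intR_ext => x; rewrite mulrDl.
Qed.

Lemma sinT_D u v k : L1R u -> L1R v ->
  sinT (fun x => u x + v x) k = sinT u k + sinT v k.
Proof.
move=> Lu Lv; rewrite /sinT -intR_D; [|exact: L1R_sin..].
by apply: intR_ext => x; rewrite mulrDl.
Qed.

Lemma cosT_Z a u k : L1R u -> cosT (fun x => a * u x) k = a * cosT u k.
Proof.
move=> Lu; rewrite /cosT -intR_Z; last exact: L1R_cos.
by apply: intR_ext => x; rewrite mulrA.
Qed.

Lemma sinT_Z a u k : L1R u -> sinT (fun x => a * u x) k = a * sinT u k.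
Proof.
move=> Lu; rewrite /sinT -intR_Z; last exact: L1R_sin.
by apply: intR_ext => x; rewrite mulrA.
Qed.

Lemma cosT_opp u k : L1R u -> cosT (fun x => u (- x)) k = cosT u k.
Proof.
move=> Lu; rewrite -[RHS](intR_opp (L1R_cos k Lu)).
by apply: intR_ext => x; rewrite mulrN cosN.
Qed.

Lemma sinT_opp u k : L1R u -> sinT (fun x => u (- x)) k = - sinT u k.
Proof.
move=> Lu; have Ls := L1R_sin k Lu.
rewrite /sinT -(intR_opp Ls) -intR_N; last exact: (L1R_opp Ls).
by apply: intR_ext => x; rewrite mulrN sinN mulrN opprK.
Qed.

Lemma cosT_freqN u k : cosT u (- k) = cosT u k.
Proof. by apply: intR_ext => x; rewrite mulNr cosN. Qed.

Lemma sinT_freqN u k : L1R u -> sinT u (- k) = - sinT u k.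
Proof.
move=> Lu; rewrite /sinT -intR_N; last exact: L1R_sin.
by apply: intR_ext => x; rewrite mulNr sinN mulrN.
Qed.

Lemma cosT0 u : cosT u 0 = intR u.
Proof. by apply: intR_ext => x; rewrite mul0r cos0 mulr1. Qed.

Lemma sinT0 u : sinT u 0 = 0.
Proof.
rewrite /sinT -[RHS](@intR_0 R); apply: intR_ext => x.
by rewrite mul0r sin0 mulr0.
Qed.

Lemma continuous_cosT u : L1R u -> continuous (cosT u).
Proof.
move=> Lu k.
have kI : k \in [set` `]k - 1, k + 1[].
  by rewrite inE/= in_itv/=; apply/andP; split; lra.
have i1 (l : R) : `]k - 1, k + 1[%classic l ->
    (@lebesgue_measure R).-integrable setT (EFin \o (fun x => u x * cos (l * x))).
  by move=> _; exact: L1R_cos.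
have i2 : {ae @lebesgue_measure R, forall x : R, setT x ->
    {in `]k - 1, k + 1[%classic, continuous (fun l : R => u x * cos (l * x))}}.
  apply: aeW => x _ y _; apply: cvgMr.
  apply: (@continuous_comp _ _ _ (fun k : R => k * x) (@cos R)).
    by apply: cvgMl; exact: cvg_id.
  exact: continuous_cos.
have i3 (l : R) : `]k - 1, k + 1[%classic l ->
    {ae @lebesgue_measure R, forall x : R, setT x -> `|u x * cos (l * x)| <= `|u x|}.
  by move=> _; apply: aeW => x _; rewrite normrM ler_piMr// cos_max.
exact: (continuity_under_integral measurableT i1 i2 (L1R_norm Lu) i3 kI).
Qed.

Lemma continuous_sinT u : L1R u -> continuous (sinT u).
Proof.
move=> Lu k.
have kI : k \in [set` `]k - 1, k + 1[].
  by rewrite inE/= in_itv/=; apply/andP; split; lra.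
have i1 (l : R) : `]k - 1, k + 1[%classic l ->
    (@lebesgue_measure R).-integrable setT (EFin \o (fun x => u x * sin (l * x))).
  by move=> _; exact: L1R_sin.
have i2 : {ae @lebesgue_measure R, forall x : R, setT x ->
    {in `]k - 1, k + 1[%classic, continuous (fun l : R => u x * sin (l * x))}}.
  apply: aeW => x _ y _; apply: cvgMr.
  apply: (@continuous_comp _ _ _ (fun k : R => k * x) (@sin R)).
    by apply: cvgMl; exact: cvg_id.
  exact: continuous_sin.
have i3 (l : R) : `]k - 1, k + 1[%classic l ->
    {ae @lebesgue_measure R, forall x : R, setT x -> `|u x * sin (l * x)| <= `|u x|}.
  by move=> _; apply: aeW => x _; rewrite normrM ler_piMr// sin_max.
exact: (continuity_under_integral measurableT i1 i2 (L1R_norm Lu) i3 kI).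
Qed.

End TransformLinear.

(** * The Fourier algebra *)

Section FourierAlgebra.
Variable R : realType.
Local Notation Re := complex.Re.
Local Notation Im := complex.Im.
Implicit Types (F G : R -> R[i]) (u v w : R -> R) (x : R).

Lemma addcE (a b c d : R) : (a +i* b) + (c +i* d) = (a + c) +i* (b + d).
Proof. by []. Qed.

Lemma mulcE (a b c d : R) :
  (a +i* b) * (c +i* d) = (a * c - b * d) +i* (a * d + b * c).
Proof. by []. Qed.

(** The Fourier transform of u + i v for real u and v, separated into real and imaginary parts; the
    frequency pi x comes from the normalization of [fourier]. *)
Definition transform u v x : R[i] :=
  (cosT u (pi * x) + sinT v (pi * x)) +i* (cosT v (pi * x) - sinT u (pi * x)).

Lemma fourierE (phi : R -> R[i]) x : L1 phi ->
  fourier phi x = transform (fun y => Re (phi y)) (fun y => Im (phi y)) x.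
Proof.
move=> [Lu Lv]; rewrite /fourier /cintegral /transform.
rewrite -(intR_D (L1R_cos _ Lu) (L1R_sin _ Lv)).
rewrite -(intR_B (L1R_cos _ Lv) (L1R_sin _ Lu)).
congr (_ +i* _); apply: eq_Rintegral => y _; rewrite /expi cosN sinN;
  case: (phi y) => a b /=; rewrite (_ : pi * (y * x) = pi * x * y);
  by [ring | ring].
Qed.

(* The algebra of Fourier transforms of integrable functions. *)
Definition FA F : Prop := exists2 phi, L1 phi & forall x, F x = fourier phi x.

Lemma FA_transform u v : L1R u -> L1R v -> FA (transform u v).
Proof.
move=> Lu Lv; exists (fun x => u x +i* v x); first by split.
by move=> x; rewrite fourierE//; split.
Qed.

Lemma FAP F : FA F -> exists u v, [/\ L1R u, L1R v & F =1 transform u v].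
Proof.
move=> [phi Lphi Fphi]; exists (fun y => Re (phi y)), (fun y => Im (phi y)).
by case: (Lphi) => Lu Lv; split=> // x; rewrite Fphi fourierE.
Qed.

Lemma FA_ext F G : F =1 G -> FA F -> FA G.
Proof. by move=> FG; rewrite (_ : F = G)//; apply/funext. Qed.

Lemma FA_D F G : FA F -> FA G -> FA (fun x => F x + G x).
Proof.
move=> /FAP[u [v [Lu Lv FE]]] /FAP[u' [v' [Lu' Lv' GE]]].
apply: FA_ext (FA_transform (L1R_D Lu Lu') (L1R_D Lv Lv')) => x.
rewrite FE GE /transform !cosT_D// !sinT_D//.
by rewrite addcE; congr (_ +i* _); ring.
Qed.

Lemma FA_Z (c : R[i]) F : FA F -> FA (fun x => c * F x).
Proof.
case: c => a b /FAP[u [v [Lu Lv FE]]].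
have L1 := L1R_D (L1R_Z a Lu) (L1R_Z (- b) Lv).
have L2 := L1R_D (L1R_Z a Lv) (L1R_Z b Lu).
apply: FA_ext (FA_transform L1 L2) => x; rewrite FE /transform.
rewrite !cosT_D ?sinT_D ?cosT_Z ?sinT_Z//; try exact: L1R_Z.
by rewrite mulcE; congr (_ +i* _); ring.
Qed.

Lemma FA_M F G : FA F -> FA G -> FA (fun x => F x * G x).
Proof.
move=> /FAP[u [v [Lu Lv FE]]] /FAP[u' [v' [Lu' Lv' GE]]].
have L1 := convolution_L1R Lu Lu'; have L2 := convolution_L1R Lv Lv'.
have L3 := convolution_L1R Lu Lv'; have L4 := convolution_L1R Lv Lu'.
apply: FA_ext (FA_transform (L1R_D L1 (L1R_Z (-1) L2)) (L1R_D L3 L4)) => x.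
rewrite FE GE /transform.
rewrite !cosT_D ?sinT_D ?cosT_Z ?sinT_Z//; try exact: L1R_Z.
rewrite !cosT_convolution// !sinT_convolution//.
by rewrite mulcE; congr (_ +i* _); ring.
Qed.

Lemma FA_conj F : FA F -> FA (fun x => (F x)^*%C).
Proof.
move=> /FAP[u [v [Lu Lv FE]]].
have L1 := L1R_opp Lu; have L2 := L1R_opp Lv.
apply: FA_ext (FA_transform L1 (L1R_Z (-1) L2)) => x; rewrite FE /transform.
rewrite cosT_Z// sinT_Z// !cosT_opp// !sinT_opp//=.
by congr (_ +i* _); ring.
Qed.

(** Translating the transform modulates the density by e^(i pi t y). *)
Lemma FA_shift t F : FA F -> FA (fun x => F (x - t)).
Proof.
move=> /FAP[u [v [Lu Lv FE]]]; pose s := pi * t.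
have L1 := L1R_cos s Lu; have L2 := L1R_sin s Lu.
have L3 := L1R_cos s Lv; have L4 := L1R_sin s Lv.
apply: FA_ext (FA_transform (L1R_B L1 L4) (L1R_D L3 L2)) => x.
rewrite FE /transform mulrBr -/s; set k := pi * x; congr (_ +i* _).
  rewrite -(intR_D (L1R_cos k (L1R_B L1 L4)) (L1R_sin k (L1R_D L3 L2))).
  rewrite -(intR_D (L1R_cos (k - s) Lu) (L1R_sin (k - s) Lv)).
  by apply: intR_ext => y; rewrite [(k - s) * y]mulrBl cosB sinB; ring.
rewrite -(intR_B (L1R_cos k (L1R_D L3 L2)) (L1R_sin k (L1R_B L1 L4))).
rewrite -(intR_B (L1R_cos (k - s) Lv) (L1R_sin (k - s) Lu)).
by apply: intR_ext => y; rewrite [(k - s) * y]mulrBl cosB sinB; ring.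
Qed.

Lemma FA_0 : FA (fun=> 0).
Proof.
apply: FA_ext (FA_Z 0 (FA_transform (L1R_0 R) (L1R_0 R))) => x.
by rewrite mul0r.
Qed.

Lemma transform_real u x : transform u (fun=> 0) x = cosT u (pi * x) -i* sinT u (pi * x).
Proof.
rewrite /transform; have -> : cosT (fun=> 0) (pi * x) = 0 :> R.
  by rewrite /cosT -[RHS](@intR_0 R); apply: intR_ext => y; rewrite mul0r.
have -> : sinT (fun=> 0) (pi * x) = 0 :> R.
  by rewrite /sinT -[RHS](@intR_0 R); apply: intR_ext => y; rewrite mul0r.
by rewrite addr0 sub0r.
Qed.

(** The transform of a Fejer kernel is a triangle, hence compactly supported. *)
Lemma FA_bump x0 d : 0 < d -> exists F, [/\ FA F, F x0 != 0 &
  forall x, d <= `|x - x0| -> F x = 0].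
Proof.
move=> d0; have p0 := pi_gt0 R; have pd : 0 < pi * d by rewrite mulr_gt0.
pose F0 := transform (fejer (pi * d)) (fun=> 0).
have F0E x : F0 x = (fejerC R * tri (pi * d) (pi * x))%:C.
  by rewrite /F0 transform_real /cosT /sinT fejer_cos fejer_sin oppr0.
exists (fun x => F0 (x - x0)); split.
- by apply: FA_shift; apply: FA_transform; [exact: L1R_fejer|exact: L1R_0].
- rewrite F0E subrr mulr0 tri_in ?normr0 ?(ltW pd)// subr0.
  by rewrite eq_complex/= eqxx andbT gt_eqF// mulr_gt0// fejerC_gt0.
- move=> x dx; rewrite F0E tri_out ?mulr0// ?(ltW pd)//.
  by rewrite normrM (gtr0_norm p0) ler_pM2l.
Qed.

(** A local substitute for the missing unit of A(R), from the de la Vallee Poussin kernel. *)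
Lemma FA_unit x0 d : 0 < d -> exists2 F, FA F &
  forall x, `|x - x0| <= d -> F x = 1.
Proof.
move=> d0; have p0 := pi_gt0 R; have pd : 0 < pi * d by rewrite mulr_gt0.
pose F0 := transform (vp (pi * d)) (fun=> 0).
exists (fun x => F0 (x - x0)).
  by apply: FA_shift; apply: FA_transform; [exact: L1R_vp|exact: L1R_0].
move=> x dx; rewrite /F0 transform_real cosT_vp// ?sinT_vp ?oppr0//.
by rewrite normrM (gtr0_norm p0) ler_pM2l.
Qed.

(** [wiener_real] inverts transforms of real densities. With F = u^ + i v^, the product F (u^ - i
    v^) = u^^2 + v^^2 is the transform of the real function u * u + v * v (convolutions), and its
    value at 0, where u^ and v^ are real, is |F(0)|^2. *)
Let FA_inv0 F : FA F -> F 0 != 0 -> exists G d, [/\ FA G, 0 < d &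
  forall x, `|x| < d -> F x * G x = 1].
Proof.
move=> /FAP[u [v [Lu Lv FE]]] F0.
pose w x := convolution u u x + convolution v v x.
have Luu := convolution_L1R Lu Lu; have Lvv := convolution_L1R Lv Lv.
have Lw : L1R w by exact: L1R_D.
have w0 : intR w != 0.
  rewrite -cosT0 cosT_D// !cosT_convolution// !sinT0 !mul0r !subr0 !cosT0.
  apply: contra F0; rewrite -!expr2 paddr_eq0 ?sqr_ge0// !sqrf_eq0.
  move=> /andP[/eqP u0 /eqP v0]; rewrite FE /transform mulr0 !cosT0 !sinT0.
  by rewrite u0 v0 subr0 addr0.
have [z [d [Lz d0 zd]]] := wiener_real Lw w0.
pose G x := transform u (fun x => -1 * v x) x * transform z (fun=> 0) x.
exists G, (d / pi); split.
- apply: FA_M; apply: FA_transform => //; [exact: L1R_Z|exact: L1R_0].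
- by rewrite divr_gt0// pi_gt0.
move=> x; rewrite ltr_pdivlMr ?pi_gt0// => xd.
have kd : `|pi * x| <= d by rewrite normrM (gtr0_norm (pi_gt0 R)) mulrC ltW.
have [] := zd _ kd; rewrite /w cosT_D// sinT_D// !cosT_convolution// !sinT_convolution//.
rewrite FE /G transform_real /transform cosT_Z// sinT_Z//.
set cu := cosT u _; set su := sinT u _; set cv := cosT v _; set sv := sinT v _.
set cz := cosT z _; set sz := sinT z _ => h1 h2.
rewrite !mulcE; congr (_ +i* _); first by rewrite -[RHS]h1; ring.
by rewrite -[RHS]oppr0 -[X in _ = - X]h2; ring.
Qed.

Lemma FA_inv F x0 : FA F -> F x0 != 0 -> exists G d, [/\ FA G, 0 < d &
  forall x, `|x - x0| < d -> F x * G x = 1].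
Proof.
move=> FF Fx0; have F1 := FA_shift (- x0) FF.
have [|G [d [FG d0 Gd]]] := FA_inv0 F1; first by rewrite sub0r opprK.
exists (fun x => G (x - x0)), d; split => //; first exact: FA_shift.
by move=> x xd; rewrite -(Gd _ xd) opprK subrK.
Qed.

Lemma FA_continuous F : FA F ->
  continuous (fun x => Re (F x)) /\ continuous (fun x => Im (F x)).
Proof.
move=> /FAP[u [v [Lu Lv FE]]].
have H (f : R -> R) : continuous f -> continuous (fun x => f (pi * x)).
  move=> cf x; apply: (@continuous_comp _ _ _ (fun x => pi * x) f).
    by apply: cvgMr; exact: cvg_id.
  exact: cf.
split.
- rewrite (_ : (fun x => _) = (fun x => cosT u (pi * x) + sinT v (pi * x))).
    by move=> x; apply: cvgD; apply: H; [exact: continuous_cosT|exact: continuous_sinT].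
  by apply/funext => x; rewrite FE.
- rewrite (_ : (fun x => _) = (fun x => cosT v (pi * x) - sinT u (pi * x))).
    by move=> x; apply: cvgB; apply: H; [exact: continuous_cosT|exact: continuous_sinT].
  by apply/funext => x; rewrite FE.
Qed.

Lemma fourier_inj (phi : R -> R[i]) : L1 phi -> (forall x, fourier phi x = 0) ->
  {ae @lebesgue_measure R, forall x, Re (phi x) = 0} /\
  {ae @lebesgue_measure R, forall x, Im (phi x) = 0}.
Proof.
move=> Lphi F0; pose u x := Re (phi x); pose v x := Im (phi x).
have [Lu Lv] : L1R u /\ L1R v := Lphi.
have E k : cosT u k + sinT v k = 0 /\ cosT v k - sinT u k = 0.
  have := F0 (pi^-1 * k); rewrite fourierE// /transform mulVKf ?gt_eqF ?pi_gt0//.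
  by case.
(* Comparing the equations at k and -k separates the even cosine transforms from the odd sine
   transforms. *)
have U k : [/\ cosT u k = 0, sinT u k = 0, cosT v k = 0 & sinT v k = 0].
  have [] := E k; have [] := E (- k); rewrite !cosT_freqN !sinT_freqN// => *.
  by split; lra.
by split; apply: transform_inj => // k; have [] := U k.
Qed.

(** Multipliers of A(R): an algebra that contains both A(R) and the constants. *)
Definition MA G : Prop := forall F, FA F -> FA (fun x => G x * F x).

Lemma FA_MA F : FA F -> MA F.
Proof. by move=> FF G FG; exact: FA_M. Qed.

Lemma MA_cst c : MA (fun=> c).
Proof. by move=> F; exact: FA_Z. Qed.

Lemma MA_D F G : MA F -> MA G -> MA (fun x => F x + G x).
Proof.
move=> MF MG H FH; apply: FA_ext (FA_D (MF _ FH) (MG _ FH)) => x.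
by rewrite mulrDl.
Qed.

Lemma MA_M F G : MA F -> MA G -> MA (fun x => F x * G x).
Proof.
move=> MF MG H FH; apply: FA_ext (MF _ (MG _ FH)) => x.
by rewrite mulrA.
Qed.

End FourierAlgebra.

(** * Complete homogeneous polynomials and lacunary sums *)

Section CompleteHomogeneous.
Variable K : fieldType.
Implicit Types (c x y z : K) (E : nat -> K) (a : nat -> K).

(* Adjoins the variable c to a sequence of complete homogeneous polynomials. *)
Definition hadjoin c E k : K := \sum_(j < k.+1) c ^+ j * E (k - j)%N.

Lemma hadjoin0 c E : hadjoin c E 0 = E 0.
Proof. by rewrite /hadjoin big_ord1 mul1r. Qed.

Lemma hadjoinS c E k : hadjoin c E k.+1 = E k.+1 + c * hadjoin c E k.
Proof.
rewrite /hadjoin big_ord_recl/= mul1r subn0 mulr_sumr; congr (_ + _).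
by apply: eq_bigr => i _; rewrite /bump/= add1n exprS mulrA subSS.
Qed.

(** The divided-difference identity of complete homogeneous polynomials, which makes them the
    quotients in Newton's division scheme. *)
Lemma hadjoin_sub y c E k :
  hadjoin y E k.+1 - hadjoin c E k.+1 = (y - c) * hadjoin y (hadjoin c E) k.
Proof.
elim: k => [|k IHk]; first by rewrite !hadjoinS !hadjoin0; ring.
rewrite [in RHS]hadjoinS mulrDr mulrCA -IHk (hadjoinS y E) (hadjoinS c E) ; ring.
Qed.

(** Recursion on the variables instead of a sum over exponents; [hsymE] identifies the result with
    [hsym]. *)
Fixpoint hcomplete a s : nat -> K :=
  if s is s'.+1 then hadjoin (a s') (hcomplete a s') else fun k => (k == 0)%:R.

Lemma hcomplete_ext a b s : (forall j, (j < s)%N -> a j = b j) ->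
  hcomplete a s = hcomplete b s.
Proof.
elim: s => //= s IHs ab; rewrite IHs ?ab// => j js; exact/ab/ltnW.
Qed.

Lemma prod_sub_eq0 a s j : (j < s)%N -> \prod_(i < s) (a j - a i) = 0.
Proof. by move=> js; rewrite (bigD1 (Ordinal js))//= subrr mul0r. Qed.

(** Newton division, one node at a time: the quotient by the first s factors is divided by z - a_s
    through [hadjoin_sub], and its value at a_s contributes to the remainder. *)
Lemma expr_hadjoin a s k : exists2 r : {poly K}, (size r <= s)%N &
  forall z, z ^+ (k + s) =
    (\prod_(j < s) (z - a j)) * hadjoin z (hcomplete a s) k + r.[z].
Proof.
elim: s k => [|s IHs] k.
  exists 0; first by rewrite size_poly0.
  move=> z; rewrite big_ord0 mul1r horner0 addr0 addn0 /hadjoin big_ord_recr/=.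
  rewrite subnn eqxx mulr1 big1 ?add0r// => j _.
  by rewrite subn_eq0 leqNgt ltn_ord mulr0.
have [r sr rE] := IHs k.+1.
pose c := hadjoin (a s) (hcomplete a s) k.+1.
exists (r + c *: \prod_(j < s) ('X - (a j)%:P)).
  rewrite (leq_trans (size_polyD _ _))// geq_max (leq_trans sr)//=.
  by rewrite (leq_trans (size_scale_leq _ _))// size_prod_XsubC /index_enum
    -enumT size_enum_ord.
move=> z; rewrite addnS -addSn rE hornerD hornerZ horner_prod big_ord_recr/=.
under [X in _ = _ + (_ + _ * X)]eq_bigr do rewrite hornerXsubC.
have -> : hadjoin z (hcomplete a s) k.+1 =
    (z - a s) * hadjoin z (hadjoin (a s) (hcomplete a s)) k + c.
  by rewrite -hadjoin_sub subrK.
ring.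
Qed.

Lemma poly_eq0_of_roots (r : {poly K}) a s : {in gtn s &, injective a} ->
  (size r <= s)%N -> (forall j, (j < s)%N -> r.[a j] = 0) -> r = 0.
Proof.
move=> a_inj sr r0; apply/eqP; apply: contraTT sr => rn0; rewrite -ltnNge.
have := @max_poly_roots _ r (map a (iota 0 s)) rn0.
rewrite size_map size_iota; apply.
  by apply/allP => _ /mapP[j + ->]; rewrite mem_iota add0n => /r0 h; apply/rootP.
rewrite map_inj_in_uniq ?iota_uniq// => i j; rewrite !mem_iota !add0n => hi hj.
exact: a_inj.
Qed.

Lemma sum_expr_eq0 (f : nat -> K) a s : {in gtn s &, injective a} ->
  (forall j, (j < s)%N -> \sum_(i < s) f i * a j ^+ i = 0) ->
  forall i, (i < s)%N -> f i = 0.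
Proof.
move=> a_inj fa i si; pose r := \poly_(i < s) f i.
have -> : f i = r`_i by rewrite coef_poly si.
suff -> : r = 0 by rewrite coef0.
apply: (poly_eq0_of_roots a_inj (size_poly _ _)) => j js.
by rewrite horner_poly fa.
Qed.

(* The quotient of z^p by the product of the z - a_j, j < n, is
   h_(p-n)(a_0, ..., a_(n-1), z). *)
Lemma lacunary_value (f : nat -> K) (g : K) a n p b :
  {in gtn n &, injective a} -> (n <= p)%N ->
  (forall j, (j <= n)%N -> \sum_(i < n.+1) f i * a j ^+ i + g * a j ^+ p = 0) ->
  a n \notin [seq a j | j <- iota 0 n] ->
  \sum_(i < n.+1) f i * b ^+ i + g * b ^+ p =
  g * (\prod_(j < n) (b - a j)) *
  (hadjoin b (hcomplete a n) (p - n) - hadjoin (a n) (hcomplete a n) (p - n)).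
Proof.
move=> a_inj np Pa an.
have [r sr rE] := expr_hadjoin a n (p - n); rewrite subnK// in rE.
have [q sq qE] := expr_hadjoin a n 0.
(* What remains in degree below n once z^n and z^p are both divided by the product. It vanishes at n
   distinct nodes, hence is 0, and the node a_n then expresses f_n through g. *)
pose w := \poly_(i < n) f i + f n *: q + g *: r.
have PE z : \sum_(i < n.+1) f i * z ^+ i + g * z ^+ p =
    (\prod_(j < n) (z - a j)) * (f n * hcomplete a n 0 +
      g * hadjoin z (hcomplete a n) (p - n)) + w.[z].
  rewrite big_ord_recr/= -{1}[n in z ^+ n]add0n qE rE hadjoin0 !hornerD !hornerZ.
  by rewrite horner_poly; ring.
have w0 : w = 0.
  apply: (poly_eq0_of_roots a_inj).
    rewrite (leq_trans (size_polyD _ _))// geq_max (leq_trans (size_scale_leq _ _))// andbT.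
    rewrite (leq_trans (size_polyD _ _))// geq_max size_poly/=.
    exact: leq_trans (size_scale_leq _ _) sq.
  move=> j jn; have := PE (a j); rewrite (Pa j (ltnW jn)) (prod_sub_eq0 a jn).
  by rewrite mul0r add0r => <-.
have : f n * hcomplete a n 0 + g * hadjoin (a n) (hcomplete a n) (p - n) = 0.
  have := PE (a n); rewrite (Pa n (leqnn n)) w0 horner0 addr0 => /esym/eqP.
  rewrite mulf_eq0 => /orP[|/eqP//]; rewrite prodf_seq_eq0 => /hasP[j _ /=].
  rewrite subr_eq0 => /eqP anj; case/mapP: an; exists (j : nat) => //.
  by rewrite mem_iota add0n ltn_ord.
rewrite PE w0 horner0 addr0 => /eqP; rewrite addr_eq0 => /eqP ->; ring.
Qed.

(** The remainder of -X^p modulo the nodal polynomial has the prescribed values, even if nodes are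
    repeated. *)
Lemma expr_interpolation a m n p : (m <= n)%N -> exists t : nat -> K,
  forall j, (j < m)%N -> \sum_(k < n) t k * a j ^+ k = - a j ^+ p.
Proof.
move=> mn; pose w := \prod_(j < m) ('X - (a j)%:P).
pose r := (- 'X^p) %% w; exists (fun k => r`_k) => j jm.
have wj : w.[a j] = 0.
  by rewrite horner_prod (bigD1 (Ordinal jm))//= hornerXsubC subrr mul0r.
have sr : (size r <= n)%N.
  have w0 : w != 0.
    by rewrite monic_neq0// monic_prod// => i _; exact: monicXsubC.
  have := ltn_modpN0 (- 'X^p) w0; rewrite size_prod_XsubC /index_enum -enumT.
  by rewrite size_enum_ord ltnS => /leq_trans; apply.
have -> : \sum_(k < n) r`_k * a j ^+ k = r.[a j] by rewrite (horner_coef_wide _ sr).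
have := congr1 (fun q => q.[a j]) (divp_eq (- 'X^p) w).
by rewrite hornerD hornerM wj mulr0 add0r hornerN hornerXn => ->.
Qed.

(** Both sides are monic of degree m in z, so their difference has degree below m and m distinct
    zeros. *)
Lemma monic_factors (t a : nat -> K) m z : {in gtn m &, injective a} ->
  (forall j, (j < m)%N -> \sum_(k < m) t k * a j ^+ k = - a j ^+ m) ->
  z ^+ m + \sum_(k < m) t k * z ^+ k = \prod_(j < m) (z - a j).
Proof.
move=> a_inj ta.
have [q sq qE] := expr_hadjoin a m 0.
have h0 : hcomplete a m 0 = 1.
  by elim: (m) => //= s; rewrite hadjoin0.
pose w := \poly_(k < m) t k + q.
have PE y : y ^+ m + \sum_(k < m) t k * y ^+ k = \prod_(j < m) (y - a j) + w.[y].
  rewrite -{1}[m in y ^+ m]add0n qE hadjoin0 h0 mulr1 hornerD horner_poly.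
  by rewrite -addrA [q.[y] + _]addrC.
rewrite PE (_ : w = 0) ?horner0 ?addr0//; apply: (poly_eq0_of_roots a_inj).
  by rewrite (leq_trans (size_polyD _ _))// geq_max size_poly.
move=> j jm; have := PE (a j); rewrite (ta j jm) subrr (prod_sub_eq0 a jm).
by rewrite add0r => <-.
Qed.

End CompleteHomogeneous.

Section Hsym.
Variable R : realType.
Implicit Types (a : nat -> R[i]).

(** The generating function prod 1 / (1 - a_i X) of the complete homogeneous polynomials; truncating
    the geometric series at degree M keeps it polynomial and leaves the coefficients up to M
    unchanged. *)
Lemma coef_prod_geometric a M k s : (k <= M)%N ->
  (\prod_(i < s) \poly_(j < M.+1) a i ^+ j)`_k = hcomplete a s k.
Proof.
elim: s k => [|s IHs] k kM; first by rewrite big_ord0 coef1.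
rewrite big_ord_recr/= coefMr; apply: eq_bigr => j _.
rewrite coef_poly (leq_ltn_trans (leq_trans (leq_ord j) kM))// mulrC IHs//.
by rewrite (leq_trans (leq_subr _ _)).
Qed.

Lemma hsymE k s a : hsym k s a = hcomplete a s k.
Proof.
rewrite -(coef_prod_geometric a s (leqnn k)).
under eq_bigr do rewrite poly_def.
rewrite (bigA_distr_bigA (fun (i : 'I_s) (j : 'I_k.+1) => a i ^+ j *: 'X^j)) coef_sum.
rewrite /hsym big_mkcond/=; apply: eq_bigr => al _.
have -> : \prod_(i < s) (a i ^+ al i *: 'X^(al i)) =
    (\prod_(i < s) a i ^+ al i) *: 'X^(\sum_(i < s) al i)%N.
  by rewrite scaler_prod prodrXr.
by rewrite coefZ coefXn eq_sym; case: eqP; rewrite ?mulr1 ?mulr0.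
Qed.

End Hsym.

(** * Measures carried by parallel lines *)

Section SliceMeasure.
Variable R : realType.
Local Notation leb := (@lebesgue_measure R).

Variables (m : {finite_measure set (R * R)%type -> \bar R}) (y : R).

Definition slice_measure (B : set (measurableTypeR R)) : \bar R := m (B `*` [set y]).

Let mX (B : set (measurableTypeR R)) : measurable B -> measurable (B `*` [set y]).
Proof. by move=> mB; apply: measurableX. Qed.

Let slice0 : slice_measure set0 = 0%E.
Proof. by rewrite /slice_measure set0X measure0. Qed.

Let slice_ge0 B : (0 <= slice_measure B)%E. Proof. exact: measure_ge0. Qed.

Let slice_sigma_additive : semi_sigma_additive slice_measure.
Proof.
move=> F mF tF mUF; rewrite /slice_measure.
rewrite (_ : _ `*` _ = \bigcup_n (F n `*` [set y])); last first.
  apply/seteqP; split => [[x z] [[n _ Fx] zy]|[x z] [n _ [Fx zy]]].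
    by exists n.
  by split => //; exists n.
apply: measure_semi_sigma_additive.
- by move=> n; exact: mX.
- apply/trivIsetP => i j _ _ ij; apply/seteqP; split=> // -[x z] [[Fi _] [Fj _]].
  by move/trivIsetP : tF => /(_ i j I I ij); rewrite seteqP => -[/(_ x) + _]; apply.
- by apply: bigcupT_measurable => n; exact: mX.
Qed.

HB.instance Definition _ := isMeasure.Build _ _ _ slice_measure
  slice0 slice_ge0 slice_sigma_additive.

Let slice_finite : fin_num_fun slice_measure.
Proof. by move=> B mB; apply: fin_num_measure; exact: mX. Qed.

HB.instance Definition _ := Measure_isFinite.Build _ _ _ slice_measure slice_finite.

(** The density is the Radon-Nikodym derivative of the slice; as the slice is a finite measure,
    bounded test functions are integrable. *)
Lemma slice_density :
  (forall B, measurable B -> leb B = 0%E -> m (B `*` [set y]) = 0%E) ->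
  exists2 f : R -> R, L1R f & forall g : R * R -> R, measurable_fun setT g ->
    (forall z, `|g z| <= 1) ->
    \int[m]_(z in setT `*` [set y]) g z = intR (fun x => f x * g (x, y)).
Proof.
move=> m0; have dom : slice_measure `<< leb.
  by apply/null_content_dominatesP => B mB; exact: m0.
pose rn := Radon_Nikodym (charge_of_finite_measure slice_measure) leb.
have dom' : charge_of_finite_measure slice_measure `<< leb by [].
have irn : leb.-integrable setT rn by exact: Radon_Nikodym_integrable.
have [Lf _] := L1R_fine irn; exists (fine \o rn) => // g mg g1.
pose iota : measurableTypeR R -> (R * R)%type := fun x => (x, y).
have miota : measurable_fun setT iota by exact: measurable_fun_pair.
pose pf : {measure set (R * R)%type -> \bar R} :=
  @measure_function_pushforward__canonical__measure_function_Measure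
    _ _ _ _ _ slice_measure iota miota.
have ig : slice_measure.-integrable setT (EFin \o (fun x => g (x, y))).
  apply: measurable_bounded_integrable => //.
  - by rewrite -ge0_fin_numE// fin_num_measure.
  - exact: (measurableT_comp mg miota).
  - by exists 1; split=> // M M1 x _; rewrite /= (le_trans (g1 _))// ltW.
have mY : measurable ([set: R] `*` [set y]) by exact: measurableX.
(* On subsets of the line at height y, m is the image of its slice under x |-> (x, y). *)
rewrite /Rintegral (eq_measure_integral pf); last first.
  move=> A mA AY; rewrite /pf/= /pushforward /slice_measure; congr (m _).
  apply/seteqP; split=> [[x z] Axz|[x z] [/= Axy ->//]].
  by have [_ zy] := AY _ Axz; split=> //; move: Axz; rewrite [z]zy.
rewrite /pf/= integral_pushforward//; last 2 first.
- exact/measurable_EFinP.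
- rewrite (_ : iota @^-1` _ = setT)//; apply/seteqP; split=> // x _.
rewrite (_ : iota @^-1` _ = setT); last by apply/seteqP; split=> // x _.
rewrite -(Radon_Nikodym_change_of_variables dom measurableT ig).
rewrite /intR /Rintegral; apply: congr1; apply: eq_integral => x _.
have fx : rn x \is a fin_num by exact: Radon_Nikodym_fin_num.
transitivity ((g (x, y))%:E * rn x)%E; first by [].
by rewrite muleC -{1}(fineK fx).
Qed.

End SliceMeasure.

Section Lines.
Variable R : realType.
Local Notation leb := (@lebesgue_measure R).
Local Notation Re := complex.Re.
Local Notation Im := complex.Im.
Variables (N : nat) (hs : nat -> R).
Hypothesis hs_inj : {in `I_N &, injective hs}.
Let H : set R := [set hs i | i in `I_N].

Lemma measurable_slice (A : set (R * R)) (y : R) : measurable A ->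
  measurable [set x : R | A (x, y)].
Proof.
move=> mA; rewrite -[X in measurable X]setTI.
have mi : measurable_fun setT (fun x : R => (x, y)) by exact: measurable_fun_pair.
exact: mi.
Qed.

Lemma arc_length0 (A : set (R * R)) :
  (forall i, (i < N)%N -> leb [set x | A (x, hs i)] = 0%E) -> arc_length H A = 0%E.
Proof. by move=> A0; apply: esum1 => _ [i iN <-]; exact: A0. Qed.

Lemma arc_length0P (A : set (R * R)) : arc_length H A = 0%E ->
  forall i, (i < N)%N -> leb [set x | A (x, hs i)] = 0%E.
Proof.
move=> A0 i iN; apply/eqP; rewrite eq_le measure_ge0 andbT -A0 /arc_length.
apply: esum_ge; exists [set hs i]; last by rewrite fsbig_set1.
by split; [exact: finite_set1|move=> _ ->; exists i].
Qed.

Section Density.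
Variable nu : {charge set (R * R)%type -> \bar R}.
Hypothesis nu_lines : forall A, measurable A -> A `<=` ~` lines H -> nu A = 0%E.
Hypothesis nu_arc : forall A, measurable A -> arc_length H A = 0%E -> nu A = 0%E.

Let linesE : lines H = \big[setU/set0]_(i < N) ([set: R] `*` [set hs i]).
Proof.
rewrite -(bigcup_mkord N (fun i => [set: R] `*` [set hs i])); 
apply/seteqP; split=> [[x y] [_ [i iN /= <-]]|[x y] [i iN [_ /= ->]]].
  by exists i.
by split=> //; exists i.
Qed.

Lemma measurable_lines : measurable (lines H).
Proof. by rewrite linesE; apply: bigsetU_measurable => i _; exact: measurableX. Qed.

(** Made for the Jordan parts of nu: for a Hahn set P the value m A is, up to sign, nu (A [&] P),
    which is 0 as soon as A has arc length 0. *)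
Let density_measure (m : {finite_measure set (R * R)%type -> \bar R}) (P : set (R * R)) :
  measurable P -> (forall A, measurable A -> nu (A `&` P) = 0%E -> m A = 0%E) ->
  exists2 f : nat -> R -> R, (forall i, L1R (f i)) &
    forall g : R * R -> R, measurable_fun setT g -> (forall z, `|g z| <= 1) ->
    \int[m]_(z in lines H) g z = \sum_(i < N) intR (fun x => f i x * g (x, hs i)).
Proof.
move=> mP m0.
have ex (i : nat) : exists f : R -> R, L1R f /\ ((i < N)%N ->
    forall g : R * R -> R, measurable_fun setT g -> (forall z, `|g z| <= 1) ->
    \int[m]_(z in setT `*` [set hs i]) g z = intR (fun x => f x * g (x, hs i))).
  case: (ltnP i N) => iN; last by exists (fun=> 0); split=> //; exact: L1R_0.
  have [B mB B0|f Lf fg] := @slice_density R m (hs i); last by exists f.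
  have mBi : measurable (B `*` [set hs i]) by exact: measurableX.
  apply: m0 => //; apply: nu_arc; first exact: measurableI.
  apply: arc_length0 => j jN.
  apply: (subset_measure0 (B := B)) => //.
  - by apply: measurable_slice; exact: measurableI.
  - by move=> x [[]].
have [f /all_and2[Lf fg]] := choice ex; exists f => // g mg g1.
have ig D : measurable D -> m.-integrable D (EFin \o g).
  move=> mD; apply: measurable_bounded_integrable => //.
  - by rewrite -ge0_fin_numE// fin_num_measure.
  - exact: measurable_funTS.
  - by exists 1; split=> // M M1 x _; rewrite /= (le_trans (g1 _))// ltW.
rewrite linesE; elim: {-2}N (leqnn N) => [|k IHk] kN.
  by rewrite !big_ord0 Rintegral_set0.
rewrite !big_ord_recr/= Rintegral_setU.
- by rewrite IHk ?(ltnW kN)// fg.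
- by apply: bigsetU_measurable => i _; exact: measurableX.
- exact: measurableX.
- apply: ig; apply: measurableU; last exact: measurableX.
  by apply: bigsetU_measurable => i _; exact: measurableX.
- apply/disj_setPS => -[x y] []; 
    rewrite -(bigcup_mkord k (fun i => [set: R] `*` [set hs i])).
    move=> -[i /= ik [_ /= yi]] [_ /= yk].
  have := hs_inj (mem_set (ltn_trans ik kN : `I_N i)) (mem_set (kN : `I_N k)).
  by rewrite -yi -yk => /(_ erefl) ik'; move: ik; rewrite /= ik' ltnn.
Qed.

Lemma charge_density : exists2 f : nat -> R -> R, (forall i, L1R (f i)) &
  (forall g : R * R -> R, measurable_fun setT g -> (forall z, `|g z| <= 1) ->
    charge_integral nu (lines H) g = \sum_(i < N) intR (fun x => f i x * g (x, hs i))) /\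
  (forall A, measurable A ->
    fine (nu A) = \sum_(i < N) intR (fun x => f i x * \1_A (x, hs i))).
Proof.
pose P := cid (Hahn_decomposition nu); pose Q := cid (projT2 P).
have [[mP _] [mQ _] _ _] := projT2 Q.
set mpos := jordan_pos (projT2 Q); set mneg := jordan_neg (projT2 Q).
have [|fp Lfp fpE] := @density_measure mpos (projT1 P) mP.
  move=> A mA nA; have := jordan_posE (projT2 Q) A.
  by rewrite cjordan_posE /crestr0 mem_set// /crestr nA.
have [|fn Lfn fnE] := @density_measure mneg (projT1 Q) mQ.
  move=> A mA nA; have := jordan_negE (projT2 Q) A.
  by rewrite cjordan_negE /crestr0 mem_set// /crestr nA oppe0.
have gE (g : R * R -> R) : measurable_fun setT g -> (forall z, `|g z| <= 1) ->
    charge_integral nu (lines H) g =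
    \sum_(i < N) intR (fun x => (fp i x - fn i x) * g (x, hs i)).
  move=> mg g1; rewrite /charge_integral fpE// fnE// -sumrB; apply: eq_bigr => i _.
  have mgi : measurable_fun setT (fun x : R => g (x, hs i)).
    by apply: (measurableT_comp mg); exact: measurable_fun_pair.
  have gi1 x : `|g (x, hs i)| <= 1 by [].
  rewrite -(intR_B (L1R_Mb (Lfp i) mgi gi1) (L1R_Mb (Lfn i) mgi gi1)).
  by apply: intR_ext => x; rewrite mulrBl.
exists (fun i x => fp i x - fn i x); first by move=> i; exact: L1R_B.
split=> // A mA; rewrite -gE; last 2 first.
- exact: measurable_indic.
- by move=> z; rewrite indicE normr_nat; case: (_ \in _).
rewrite /charge_integral -/P -/Q -/mpos -/mneg /Rintegral.
have mL := measurable_lines.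
have mAL : measurable (A `&` lines H) by exact: measurableI.
rewrite !integral_indic// -fineB ?fin_num_measure//.
congr fine; have := jordan_decomp (projT2 Q) mAL.
rewrite /cadd/= cscaleN1 -/mpos -/mneg => <-.
rewrite -[in LHS](setIT A) -(setUv (lines H)) setIUr chargeU//.
- rewrite (nu_lines (A := A `&` ~` lines H)) ?adde0//.
    by apply: measurableI => //; exact: measurableC.
- by apply: measurableI => //; exact: measurableC.
- by rewrite setIACA setICr setI0.
Qed.

End Density.

Lemma charge_of_densities (f : nat -> R -> R) : (forall i, L1R (f i)) ->
  exists nu : {charge set (R * R)%type -> \bar R}, forall A, measurable A ->
    nu A = (\sum_(i < N) intR (fun x => f i x * \1_A (x, hs i)))%:E.
Proof.
move=> Lf; elim: N => [|k [nu nuE]].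
  by exists (@czero _ _ R : {charge set _ -> \bar R}) => A mA; rewrite big_ord0.
pose iota : measurableTypeR R -> (R * R)%type := fun x => (x, hs k).
have miota : measurable_fun setT iota by exact: measurable_fun_pair.
pose nuk : {charge set (measurableTypeR R) -> \bar R} := induced_charge (Lf k).
pose pf : {charge set (R * R)%type -> \bar R} :=
  @measure_function_pushforward__canonical__charge_Charge _ _ _ _ iota _ nuk miota.
exists (cadd nu pf) => A mA; rewrite big_ord_recr/= EFinD -nuE//; congr (_ + _)%E.
have mi := measurable_slice (hs k) mA.
rewrite intR_EFin; last first.
  apply: (L1R_Mb (M := 1) (Lf k)); first exact: measurable_indic mi.
  by move=> x; rewrite indicE normr_nat; case: (_ \in _).
transitivity (\int[leb]_(x in iota @^-1` A) (f k x)%:E)%E; first by [].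
rewrite integral_mkcond; apply: eq_integral => x _.
rewrite patchE [\1_A _]indicE; have [/set_mem|] := boolP (x \in iota @^-1` A).
  by move=> h; rewrite mem_set// mulr1.
by rewrite notin_setE => h; rewrite memNset// mulr0.
Qed.

End Lines.

(** * Uniqueness pairs in terms of the Fourier algebra *)

Section HeisenbergLines.
Variable R : realType.
Local Notation leb := (@lebesgue_measure R).
Local Notation Re := complex.Re.
Local Notation Im := complex.Im.
Variables (N : nat) (hs : nat -> R).
Hypothesis hs_inj : {in `I_N &, injective hs}.
Let H : set R := [set hs i | i in `I_N].

Lemma expiD (s t : R) : expi (s + t) = expi s * expi t.
Proof. by rewrite /expi cosD sinD mulcE; congr (_ +i* _); ring. Qed.

Lemma sumcE (I : Type) (r : seq I) (P : pred I) (a b : I -> R) :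
  \sum_(i <- r | P i) (a i +i* b i) =
  (\sum_(i <- r | P i) a i) +i* (\sum_(i <- r | P i) b i).
Proof.
elim/big_rec3: _ => // i x y z _ ->; by rewrite addcE.
Qed.

Lemma X_lines_density (mu : complex_measure (R * R)%type R) : X_lines H mu ->
  exists2 phi : nat -> R -> R[i], (forall i, L1 (phi i)) &
  (forall z, fourier_measure H mu z =
    \sum_(i < N) expi (- (pi * (hs i * z.2))) * fourier (phi i) z.1) /\
  (forall A, measurable A -> mu A =
    (\sum_(i < N) intR (fun x => Re (phi i x) * \1_A (x, hs i))) +i*
    (\sum_(i < N) intR (fun x => Im (phi i x) * \1_A (x, hs i)))).
Proof.
move=> [mu1 mu2].
have E0 A : measurable A -> mu A = 0 -> re_part mu A = 0%E /\ im_part mu A = 0%E.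
  move=> mA; rewrite /cmeasure => -[r0 i0].
  by rewrite -(fineK (fin_num_measure (re_part mu) A mA)) r0
    -(fineK (fin_num_measure (im_part mu) A mA)) i0.
have [||f Lf [fE fA]] := @charge_density R N hs hs_inj (re_part mu).
- by move=> A mA AL; have [] := E0 A mA (mu1 A mA AL).
- by move=> A mA AL; have [] := E0 A mA (mu2 A mA AL).
have [||g Lg [gE gA]] := @charge_density R N hs hs_inj (im_part mu).
- by move=> A mA AL; have [] := E0 A mA (mu1 A mA AL).
- by move=> A mA AL; have [] := E0 A mA (mu2 A mA AL).
have Lphi i : L1 (fun x => f i x +i* g i x) by split; [exact: Lf|exact: Lg].
exists (fun i x => f i x +i* g i x) => //; split=> [[x y]|A mA]; last first.
  by rewrite /cmeasure fA// gA.
pose th (w : R * R) := - (pi * (w.1 * x + w.2 * y)).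
have mth : measurable_fun setT th.
  apply: measurableT_comp => //; apply: measurable_funM => //.
  by apply: measurable_funD; apply: measurable_funM.
pose c (w : R * R) := cos (th w); pose s (w : R * R) := sin (th w).
have mc : measurable_fun setT c.
  exact: (measurableT_comp (continuous_measurable_fun (@continuous_cos R)) mth).
have ms : measurable_fun setT s.
  exact: (measurableT_comp (continuous_measurable_fun (@continuous_sin R)) mth).
have c1 w : `|c w| <= 1 by exact: cos_max.
have s1 w : `|s w| <= 1 by exact: sin_max.
rewrite /fourier_measure /cmeasure_integral/=.
rewrite (fE c)// (gE s)// (fE s)// (gE c)// -sumrB -big_split/= -sumcE.
apply: eq_bigr => i _; rewrite fourierE// /transform/= /expi mulcE.
set k := pi * x; set t := - (pi * (hs i * y)).
have thE z : th (z, hs i) = t - k * z by rewrite /th /t /k/=; ring.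
have cE z : c (z, hs i) = cos t * cos (k * z) + sin t * sin (k * z).
  by rewrite /c thE cosB.
have sE z : s (z, hs i) = sin t * cos (k * z) - cos t * sin (k * z).
  by rewrite /s thE sinB.
have Lfc := L1R_cos k (Lf i); have Lfs := L1R_sin k (Lf i).
have Lgc := L1R_cos k (Lg i); have Lgs := L1R_sin k (Lg i).
have intc (u : R -> R) : L1R u -> intR (fun z => u z * c (z, hs i)) =
    cos t * cosT u k + sin t * sinT u k.
  move=> Lu; have L1 := L1R_cos k Lu; have L2 := L1R_sin k Lu.
  rewrite -!intR_Z// -intR_D; [|exact: L1R_Z..].
  by apply: intR_ext => z; rewrite cE; ring.
have ints (u : R -> R) : L1R u -> intR (fun z => u z * s (z, hs i)) =
    sin t * cosT u k - cos t * sinT u k.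
  move=> Lu; have L1 := L1R_cos k Lu; have L2 := L1R_sin k Lu.
  rewrite -!intR_Z// -intR_B; [|exact: L1R_Z..].
  by apply: intR_ext => z; rewrite sE; ring.
rewrite !intc// !ints//; congr (_ +i* _); ring.
Qed.

Lemma L1R_ae0 (u b : R -> R) : measurable_fun setT u -> measurable_fun setT b ->
  {ae leb, forall x, u x = 0} -> intR (fun x => u x * b x) = 0.
Proof.
move=> mu mb [M [mM M0 sM]]; rewrite -[RHS](@intR_0 R); apply: intR_ae => //.
  exact: measurable_funM.
exists M; split=> //; apply: subset_trans sM => x /=; apply: contra_not => ->.
by rewrite mul0r.
Qed.

Lemma ae0_of_integrals (u : R -> R) : L1R u ->
  (forall B, measurable B -> intR (fun x => u x * \1_B x) = 0) ->
  {ae leb, forall x, u x = 0}.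
Proof.
move=> Lu u0; have := @integral_ae_eq _ _ R leb setT measurableT (cst 0%E) (EFin \o u) Lu
  (measurable_cst _).
case.
  move=> B _ mB; rewrite integral0 integral_mkcond.
  transitivity (\int[leb]_x (u x * \1_B x)%:E)%E.
    apply: eq_integral => x _; rewrite patchE indicE.
    by case: (x \in B); rewrite ?mulr1 ?mulr0.
  rewrite -intR_EFin ?u0//; apply: (L1R_Mb (M := 1) Lu).
    exact: measurable_indic.
  by move=> x; rewrite indicE normr_nat; case: (_ \in _).
move=> M [mM M0 sM]; exists M; split=> //; apply: subset_trans sM => x /=.
by apply: contra_not => /(_ I) [].
Qed.

(** A test set contained in one line isolates the density on that line. *)
Lemma slice_sum (f : nat -> R -> R) i (B : set R) : (i < N)%N ->
  \sum_(j < N) intR (fun x => f j x * \1_(B `*` [set hs i]) (x, hs j)) =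
  intR (fun x => f i x * \1_B x).
Proof.
move=> iN; rewrite (bigD1 (Ordinal iN))//= big1 ?addr0 => [|j ji].
  apply: intR_ext => x; rewrite !indicE; congr (_ * (nat_of_bool _)%:R).
  by apply/idP/idP => /set_mem h; apply/mem_set; [case: h|split].
rewrite -[RHS](@intR_0 R); apply: intR_ext => x; rewrite indicE memNset ?mulr0//.
move=> [_ /= hji]; move: ji; rewrite -val_eqE/=.
by rewrite (hs_inj (mem_set (ltn_ord j : `I_N j)) (mem_set (iN : `I_N i)) hji) eqxx.
Qed.

Lemma intR_ae_eq (u v b : R -> R) : L1R u -> L1R v -> measurable_fun setT b ->
  {ae leb, forall x, u x - v x = 0} ->
  intR (fun x => u x * b x) = intR (fun x => v x * b x).
Proof.
move=> Lu Lv mb [M [mM M0 sM]]; apply: intR_ae.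
- by apply: measurable_funM => //; exact: L1R_meas.
- by apply: measurable_funM => //; exact: L1R_meas.
exists M; split=> //; apply: subset_trans sM => x /=; apply: contra_not => /eqP.
by rewrite subr_eq0 => /eqP ->.
Qed.

Lemma L1R_indic (u : R -> R) B : measurable B -> L1R u -> L1R (fun x => u x * \1_B x).
Proof.
move=> mB Lu; apply: (L1R_Mb (M := 1) Lu); first exact: measurable_indic.
by move=> x; rewrite indicE normr_nat; case: (_ \in _).
Qed.

Lemma ae_eq_of_integrals (u v : R -> R) : L1R u -> L1R v ->
  (forall B, measurable B ->
    intR (fun x => u x * \1_B x) = intR (fun x => v x * \1_B x)) ->
  {ae leb, forall x, u x - v x = 0}.
Proof.
move=> Lu Lv uv; apply: ae0_of_integrals; first exact: L1R_B.
move=> B mB; have := uv B mB; have Lub := L1R_indic mB Lu.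
have Lvb := L1R_indic mB Lv => uvB.
transitivity (intR (fun x => u x * \1_B x - v x * \1_B x)).
  by apply: intR_ext => x; rewrite mulrBl.
by rewrite intR_B// uvB subrr.
Qed.

Lemma X_lines_of_densities (u v : nat -> R -> R)
    (nu nu' : {charge set (R * R)%type -> \bar R}) :
  (forall i, L1R (u i)) -> (forall i, L1R (v i)) ->
  (forall A, measurable A ->
    nu A = (\sum_(i < N) intR (fun x => u i x * \1_A (x, hs i)))%:E) ->
  (forall A, measurable A ->
    nu' A = (\sum_(i < N) intR (fun x => v i x * \1_A (x, hs i)))%:E) ->
  X_lines H (ComplexMeasure nu nu').
Proof.
move=> Lu Lv nuE nuE'.
have D0 (w : nat -> R -> R) A : (forall i, L1R (w i)) -> measurable A ->
    (forall i, (i < N)%N -> leb [set x | A (x, hs i)] = 0%E) ->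
    \sum_(i < N) intR (fun x => w i x * \1_A (x, hs i)) = 0.
  move=> Lw mA A0; rewrite big1// => i _; have mi := measurable_slice (hs i) mA.
  rewrite (_ : intR _ = intR (fun x => \1_[set x | A (x, hs i)] x * w i x)); last first.
    by apply: intR_ext => x; rewrite mulrC.
  apply: L1R_ae0; [exact: measurable_indic|exact: L1R_meas|].
  exists [set x | A (x, hs i)]; split=> //; first exact: A0.
  by move=> x /= h; apply: contrapT => nA; apply: h; rewrite indicE memNset.
split=> A mA A0; rewrite /cmeasure/= nuE// nuE'//=.
- have A0' i : (i < N)%N -> leb [set x | A (x, hs i)] = 0%E.
    move=> iN; rewrite (_ : [set x | _] = set0) ?measure0//.
    apply/seteqP; split=> // x /= /A0; apply; split=> //=; by exists i.
  by rewrite !D0.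
- by rewrite !D0//; apply: arc_length0P.
Qed.

Lemma fourier_ae_eq (phi psi : R -> R[i]) : L1 phi -> L1 psi ->
  {ae leb, forall x, Re (phi x) - Re (psi x) = 0} ->
  {ae leb, forall x, Im (phi x) - Im (psi x) = 0} ->
  fourier phi =1 fourier psi.
Proof.
move=> Lphi Lpsi re im x; rewrite !fourierE// /transform.
case: (Lphi) (Lpsi) => [L1 L2] [L3 L4].
have mc := measurable_cosM (pi * x); have ms := measurable_sinM (pi * x).
rewrite /cosT /sinT (intR_ae_eq L1 L3 mc re) (intR_ae_eq L2 L4 ms im).
by rewrite (intR_ae_eq L2 L4 mc im) (intR_ae_eq L1 L3 ms re).
Qed.

Lemma L1_0 : L1 (fun _ : R => 0 : R[i]).
Proof. by split; exact: L1R_0. Qed.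

Lemma fourier_0 (x : R) : fourier (fun=> 0) x = 0.
Proof.
rewrite fourierE ?transform_real; last exact: L1_0.
have -> : cosT (fun=> 0) (pi * x) = 0 :> R.
  by rewrite /cosT -[RHS](@intR_0 R); apply: intR_ext => y; rewrite mul0r.
have -> : sinT (fun=> 0) (pi * x) = 0 :> R.
  by rewrite /sinT -[RHS](@intR_0 R); apply: intR_ext => y; rewrite mul0r.
by rewrite oppr0.
Qed.

Lemma heisenberg_uniqueness_pairP (Lam : set (R * R)) :
  heisenberg_uniqueness_pair H Lam <->
  forall F : nat -> R -> R[i], (forall i, FA (F i)) ->
    (forall z, Lam z ->
      \sum_(i < N) expi (- (pi * (hs i * z.2))) * F i z.1 = 0) ->
    forall i, (i < N)%N -> forall x, F i x = 0.
Proof.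
split=> [hup F FF F0 i iN x|hup mu Xmu mu0 A mA]; last first.
  have [phi Lphi [phiF phiA]] := X_lines_density Xmu.
  have Fphi i : FA (fourier (phi i)) by exists (phi i).
  have {}hup := hup _ Fphi (fun z Lz => etrans (esym (phiF z)) (mu0 z Lz)).
  have [u v] : (forall i, (i < N)%N -> {ae leb, forall x, Re (phi i x) = 0}) /\
      (forall i, (i < N)%N -> {ae leb, forall x, Im (phi i x) = 0}).
    by split=> i iN; have [] := fourier_inj (Lphi i) (hup i iN).
  rewrite phiA// !big1// => i _.
    have [_ Li] := Lphi i; apply: L1R_ae0; [exact: L1R_meas Li| |exact: v].
    exact: measurable_indic (measurable_slice (hs i) mA).
  have [Li _] := Lphi i; apply: L1R_ae0; [exact: L1R_meas Li| |exact: u].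
  exact: measurable_indic (measurable_slice (hs i) mA).
have /choice[phi phiF] : forall i, exists phi, L1 phi /\ F i =1 fourier phi.
  by move=> j; have [phi] := FF j; exists phi.
have Lphi j := (phiF j).1.
have Lu j : L1R (fun y => Re (phi j y)) := (Lphi j).1.
have Lv j : L1R (fun y => Im (phi j y)) := (Lphi j).2.
have [nu nuE] := charge_of_densities N hs Lu.
have [nu' nuE'] := charge_of_densities N hs Lv.
have Xmu := X_lines_of_densities Lu Lv nuE nuE'.
(* This produces densities psi of its own for the measure built from phi; testing on sets B x {hs j}
   shows that they agree with phi almost everywhere, so the transforms coincide. *)
have [psi Lpsi [psiF psiA]] := X_lines_density Xmu.
have mS j (B : set R) : measurable B -> measurable (B `*` [set hs j]).
  by move=> mB; apply: measurableX.
have key j : (j < N)%N -> fourier (phi j) =1 fourier (psi j).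
  move=> jN; have [Lr Li] := Lpsi j.
  apply: fourier_ae_eq => //; apply: ae_eq_of_integrals => // B mB.
    have := psiA _ (mS j B mB); rewrite /cmeasure/= (nuE _ (mS j B mB)) (nuE' _ (mS j B mB))/= => -[E _].
    exact: (etrans (esym (slice_sum (fun i x => Re (phi i x)) B jN))
      (etrans E (slice_sum (fun i x => Re (psi i x)) B jN))).
  have := psiA _ (mS j B mB); rewrite /cmeasure/= (nuE _ (mS j B mB)) (nuE' _ (mS j B mB))/= => -[_ E].
  exact: (etrans (esym (slice_sum (fun i x => Im (phi i x)) B jN))
    (etrans E (slice_sum (fun i x => Im (psi i x)) B jN))).
have mu0 : forall A, measurable A -> ComplexMeasure nu nu' A = 0.
  apply: hup => // z Lz; rewrite psiF -[RHS](F0 z Lz); apply: eq_bigr => j _.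
  by rewrite (phiF j).2 key.
rewrite (phiF i).2 -(fourier_0 x); apply: fourier_ae_eq => //; first exact: L1_0.
  apply: ae_eq_of_integrals => //; first exact: L1R_0.
  move=> B mB; have := mu0 _ (mS i B mB); rewrite /cmeasure/= (nuE _ (mS i B mB))/= => -[E _].
  rewrite (etrans (esym (slice_sum (fun i x => Re (phi i x)) B iN)) E).
  by rewrite -[LHS](@intR_0 R); apply: intR_ext => y; rewrite mul0r.
apply: ae_eq_of_integrals => //; first exact: L1R_0.
move=> B mB; have := mu0 _ (mS i B mB); rewrite /cmeasure/= (nuE' _ (mS i B mB))/= => -[_ E].
rewrite (etrans (esym (slice_sum (fun i x => Im (phi i x)) B iN)) E).
by rewrite -[LHS](@intR_0 R); apply: intR_ext => y; rewrite mul0r.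
Qed.

End HeisenbergLines.

(** * Reduction of powers modulo a monic relation *)

Section PowerReduction.
Variable R : realType.
Implicit Types (c F : nat -> R -> R[i]).

(** The coefficients [U] depend on x but not on the root a, so one choice serves all points of a
    fibre. They are polynomials in the [c k] with constants among them, hence multipliers. Each step
    multiplies by a and rewrites the term that overflows. *)
Lemma power_reduction c r p : (0 < r)%N -> (forall k, MA (c k)) ->
  exists2 U : nat -> R -> R[i], (forall k, MA (U k)) &
    forall x a, a ^+ r = \sum_(k < r) c k x * a ^+ k ->
      a ^+ p = \sum_(k < r) U k x * a ^+ k.
Proof.
case: r => // r _ Mc; elim: p => [|p [U MU UE]].
  exists (fun k _ => (k == 0)%:R); first by move=> k; exact: MA_cst.
  move=> x a _; rewrite big_ord_recl/= mul1r big1 ?addr0// => i _.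
  by rewrite mul0r.
exists (fun k x => (if k is k'.+1 then U k' x else 0) + U r x * c k x).
  move=> k; apply: MA_D; last exact: MA_M.
  by case: k => [|k]; [exact: MA_cst|exact: MU].
move=> x a ar; pose V k := if k is k'.+1 then U k' x else 0.
have -> : \sum_(k < r.+1) (V k + U r x * c k x) * a ^+ k =
    \sum_(k < r.+1) V k * a ^+ k + U r x * a ^+ r.+1.
  by rewrite ar mulr_sumr -big_split/=; apply: eq_bigr => k _; ring.
rewrite exprS (UE x a ar) mulr_sumr big_ord_recr [in RHS]big_ord_recl/= mul0r add0r.
congr (_ + _); last by rewrite exprS; ring.
by apply: eq_bigr => i _; rewrite /bump/= add1n exprS; ring.
Qed.

End PowerReduction.

(** * Complex-valued functions and points of the circle *)

Section ContinuousComplex.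
Variable R : realType.
Local Notation Re := complex.Re.
Local Notation Im := complex.Im.
Implicit Types F G : R -> R[i].

(** The squared modulus as an element of R: multiplicative, free of roots, and continuous as soon as
    the two components are. *)
Definition normsq (z : R[i]) : R := Re z ^+ 2 + Im z ^+ 2.

Lemma normsqM z w : normsq (z * w) = normsq z * normsq w.
Proof. by case: z w => [a b] [c d]; rewrite mulcE /normsq/=; ring. Qed.

Lemma normsq1 : normsq 1 = 1.
Proof. by rewrite /normsq/= expr1n expr0n addr0. Qed.

Lemma normsq_sub z w : normsq (z - w) = normsq (w - z).
Proof. by case: z w => [a b] [c d]; rewrite /normsq/=; ring. Qed.

Lemma normsq_ge0 z : 0 <= normsq z.
Proof. by rewrite addr_ge0 ?sqr_ge0. Qed.

Lemma normsq_eq0 z : (normsq z == 0) = (z == 0).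
Proof.
by rewrite paddr_eq0 ?sqr_ge0// !sqrf_eq0 eq_complex/=.
Qed.

Lemma normsq_prod s (f : nat -> R[i]) :
  normsq (\prod_(j < s) f j) = \prod_(j < s) normsq (f j).
Proof.
elim: s => [|s IHs]; first by rewrite !big_ord0 normsq1.
by rewrite !big_ord_recr/= normsqM IHs.
Qed.

Definition ccontinuous F :=
  continuous (fun x => Re (F x)) /\ continuous (fun x => Im (F x)).

Lemma ccontinuous_cst c : ccontinuous (fun=> c).
Proof. by split=> x; exact: cvg_cst. Qed.

Lemma ccontinuous_D F G : ccontinuous F -> ccontinuous G ->
  ccontinuous (fun x => F x + G x).
Proof.
move=> [F1 F2] [G1 G2]; split.
  rewrite (_ : (fun x => _) = (fun x => Re (F x) + Re (G x))).
    by move=> x; apply: cvgD; [exact: F1|exact: G1].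
  by apply/funext => x; case: (F x) (G x) => [a b] [c d].
rewrite (_ : (fun x => _) = (fun x => Im (F x) + Im (G x))).
  by move=> x; apply: cvgD; [exact: F2|exact: G2].
by apply/funext => x; case: (F x) (G x) => [a b] [c d].
Qed.

Lemma ccontinuous_M F G : ccontinuous F -> ccontinuous G ->
  ccontinuous (fun x => F x * G x).
Proof.
move=> [F1 F2] [G1 G2]; split.
  rewrite (_ : (fun x => _) = (fun x => Re (F x) * Re (G x) - Im (F x) * Im (G x))).
    by move=> x; apply: cvgB; apply: cvgM;
      [exact: F1|exact: G1|exact: F2|exact: G2].
  by apply/funext => x; case: (F x) (G x) => [a b] [c d].
rewrite (_ : (fun x => _) = (fun x => Re (F x) * Im (G x) + Im (F x) * Re (G x))).
  by move=> x; apply: cvgD; apply: cvgM;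
    [exact: F1|exact: G2|exact: F2|exact: G1].
by apply/funext => x; case: (F x) (G x) => [a b] [c d].
Qed.

Lemma ccontinuous_sum s (F : nat -> R -> R[i]) : (forall k, (k < s)%N -> ccontinuous (F k)) ->
  ccontinuous (fun x => \sum_(k < s) F k x).
Proof.
elim: s => [|s IHs] cF.
  rewrite (_ : (fun x => _) = fun=> 0); first exact: ccontinuous_cst.
  by apply/funext => x; rewrite big_ord0.
rewrite (_ : (fun x => _) = fun x => \sum_(k < s) F k x + F s x).
  by apply: ccontinuous_D; [apply: IHs => k /ltnW; exact: cF|exact: cF].
by apply/funext => x; rewrite big_ord_recr.
Qed.

Lemma continuous_normsq F : ccontinuous F -> continuous (fun x => normsq (F x)).
Proof.
move=> [F1 F2] x; apply: cvgD; apply: cvgM; by [exact: F1|exact: F2].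
Qed.

Lemma near_radius (P : R -> Prop) x : (\forall y \near x, P y) ->
  exists2 d, 0 < d & forall y, `|y - x| < d -> P y.
Proof.
move=> /nbhs_ballP[d /= d0 dP]; exists d => // y yd; apply: dP.
by rewrite /ball/= distrC.
Qed.

Lemma ccontinuous_neq0 F x : ccontinuous F -> F x != 0 ->
  exists2 d, 0 < d & forall y, `|y - x| < d -> F y != 0.
Proof.
move=> /continuous_normsq cF Fx; apply: near_radius.
have : \forall y \near x, 0 < normsq (F y).
  by apply: (cvgr_gt _ (cF x)); rewrite lt_neqAle normsq_ge0 andbT eq_sym normsq_eq0.
by apply: filterS => y; rewrite lt_neqAle eq_sym normsq_eq0 => /andP[].
Qed.

Lemma open_ball0 (x d : R) : 0 < d ->
  open [set y | `|y - x| < d] /\ [set y | `|y - x| < d] !=set0.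
Proof.
move=> d0; split; last by exists x; rewrite /= subrr normr0.
rewrite (_ : [set y | _] = ball x d); first exact: ball_open.
by apply/seteqP; split=> y; rewrite /ball/= distrC.
Qed.

Lemma ccontinuous_dense F (S : set R) : ccontinuous F -> dense S ->
  (forall x, S x -> F x = 0) -> forall x, F x = 0.
Proof.
move=> cF dS S0 x; apply/eqP; apply: contrapT => /negP/(ccontinuous_neq0 cF)[d d0 Fd].
have [oB B0] := open_ball0 x d0; have [y [/= yx Sy]] := dS _ B0 oB.
by have := Fd _ yx; rewrite S0// eqxx.
Qed.

End ContinuousComplex.

Section Expi.
Variable R : realType.
Implicit Types s t : R.

Lemma expi0 : expi (0 : R) = 1.
Proof. by rewrite /expi cos0 sin0. Qed.

Lemma expi_conj t : (expi t)^*%C = expi (- t).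
Proof. by rewrite /expi/= cosN sinN. Qed.

Lemma expiM t k : expi (t *+ k) = expi t ^+ k.
Proof.
by elim: k => [|k IHk]; [rewrite mulr0n expi0|rewrite mulrS expiD IHk exprS].
Qed.

Lemma expi_2pi_int (m : int) : expi (pi * (2 * m%:~R)) = 1 :> R[i].
Proof.
have E (k : nat) : expi (pi * (2 * k%:R)) = 1 :> R[i].
  have -> : pi * (2 * k%:R) = (pi *+ 2) *+ k :> R.
    by rewrite -[RHS]mulr_natr [pi *+ 2]mulr2n mulrA mulrDr mulr1.
  by rewrite expiM /expi cos2pi sin2pi expr1n.
case: (intP m) => [|k|k]; [by have := E 0|by have := E k.+1|].
have := congr1 (@conjc R) (E k.+1); rewrite expi_conj rmorph1 => <-.
by rewrite mulrNz !mulrN.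
Qed.

Lemma normsq_expi_sub s t : normsq (expi s - expi t) = 2 * (1 - cos (s - t)).
Proof.
rewrite /normsq /expi/= cosB.
have h1 := cos2Dsin2 s; have h2 := cos2Dsin2 t.
transitivity ((cos s ^+ 2 + sin s ^+ 2) + (cos t ^+ 2 + sin t ^+ 2) -
   2 * (cos s * cos t + sin s * sin t)); first by ring.
by rewrite h1 h2; ring.
Qed.

Lemma reduce_mod2 s t : exists2 m : int, -1 <= s + 2 * m%:~R - t < 1 &
  cos (pi * (s - t)) = cos (pi * (s + 2 * m%:~R - t)).
Proof.
pose m := - Num.floor ((s - t + 1) / 2); exists m.
  have := floor_itv ((s - t + 1) / 2).
  by rewrite /m mulrNz intrD => /andP[] h1 h2; apply/andP; split; lra.
set u := s + 2 * m%:~R - t.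
have uE : pi * (s - t) = pi * u + pi * (2 * (- m)%:~R).
  by rewrite /u mulrNz; ring.
have [c1 s0] := expi_2pi_int (- m).
by rewrite uE cosD c1 s0; ring.
Qed.

Lemma onem_cos_gt0 (d : R) : 0 < d -> d <= 1 -> 0 < 1 - cos (pi * d).
Proof.
move=> d0 d1; have p0 := pi_gt0 R.
have dI : pi * d \in `[0, pi].
  by rewrite in_itv/= mulr_ge0 ?(ltW p0) ?(ltW d0)//= ger_pMr.
have oI : 0 \in `[0, pi : R] by rewrite in_itv/= lexx (ltW p0).
by rewrite subr_gt0 -[ltRHS]cos0 ltr_cos// mulr_gt0.
Qed.

(** The squared chord is 2 (1 - cos (pi u)), where u is the distance of s and t modulo 2, and cosine
    decreases on [0, pi]. *)
Lemma expi_close (d : R) s t : 0 < d -> d <= 1 ->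
  normsq (expi (pi * s) - expi (pi * t)) < 2 * (1 - cos (pi * d)) ->
  exists m : int, `|s + 2 * m%:~R - t| < d.
Proof.
move=> d0 d1; rewrite normsq_expi_sub -mulrBr; have p0 := pi_gt0 R.
have [m /andP[u1 u2] ->] := reduce_mod2 s t => H; exists m; move: H; set u := _ - t => H.
rewrite ltNge; apply/negP => du; move: H; apply/negP; rewrite -leNgt.
rewrite ler_pM2l// lerB// -(cos_norm (pi * u)) normrM (gtr0_norm p0).
have uI : pi * `|u| \in `[0, pi].
  by rewrite in_itv/= mulr_ge0 ?(ltW p0)//= ger_pMr// ler_norml u1 ltW.
have dI : pi * d \in `[0, pi].
  by rewrite in_itv/= mulr_ge0 ?(ltW p0) ?(ltW d0)//= ger_pMr.
by rewrite leNgt ltr_cos// -leNgt ler_pM2l.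
Qed.

Lemma expi_inj_mod2 s t : expi (pi * s) = expi (pi * t) ->
  exists m : int, s + 2 * m%:~R = t.
Proof.
move=> st; have [m /andP[u1 u2] cu] := reduce_mod2 s t; exists m.
apply/eqP; rewrite -subr_eq0; apply/negPn/negP; rewrite -normr_gt0 => n0.
have := onem_cos_gt0 n0; rewrite ler_norml u1 (ltW u2) => /(_ isT).
have -> : pi * `|s + 2 * m%:~R - t| = `|pi * (s + 2 * m%:~R - t)|.
  by rewrite normrM (gtr0_norm (pi_gt0 R)).
have := normsq_expi_sub (pi * s) (pi * t); rewrite st subrr.
have -> : normsq (0 : R[i]) = 0 by apply/eqP; rewrite normsq_eq0.
by rewrite -mulrBr cu cos_norm => h1 h2; clear st; lra.
Qed.

Lemma expi_add2 s (m : int) : expi (pi * (s + 2 * m%:~R)) = expi (pi * s).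
Proof. by rewrite mulrDr expiD expi_2pi_int mulr1. Qed.

Lemma expi_inj s t : 0 <= s < 2 -> 0 <= t < 2 -> expi (pi * s) = expi (pi * t) -> s = t.
Proof.
move=> /andP[s0 s2] /andP[t0 t2] /expi_inj_mod2[m mt].
have m1 : (m%:~R < 1 :> R) by lra.
have m2 : (-1 < m%:~R :> R) by lra.
have m0 : m = 0.
  move: m1 m2; rewrite -[1 in X in X -> _]/(1%:~R) -[-1 in X in _ -> X -> _]/((-1)%:~R) !ltr_int.
  by case: m {mt} => [[|k]|[|k]].
by rewrite -mt m0 mulr0 addr0.
Qed.

End Expi.

Local Open Scope card_scope.

(** * The fibres of Lambda *)

Section DistinctIn.
Variable R : realType.
Implicit Types (S : set R) (e : nat -> R).

Lemma distinct_in_inj m S e : distinct_in m S e -> {in gtn m &, injective e}.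
Proof.
by move=> [_ inj] i j im jm; apply: inj; apply: mem_set.
Qed.

Lemma distinct_in_card m S e : distinct_in m S e -> `I_m #<= S.
Proof.
move=> [eS inj]; have := inj_card_eq inj; rewrite card_eq_le => /andP[_].
by move=> /card_le_trans; apply; apply: subset_card_le => _ [j jm <-]; exact: eS.
Qed.

(** Otherwise y could be appended to [e], giving m + 1 distinct points in a set of m elements. *)
Lemma distinct_in_full m S e y : S #= `I_m -> distinct_in m S e -> S y ->
  exists2 j, (j < m)%N & e j = y.
Proof.
move=> Sm De Sy; apply: contrapT => ny.
have : distinct_in m.+1 S (fun j => if (j < m)%N then e j else y).
  split=> [j|i j /set_mem /= im /set_mem /= jm].
    by case: ifP => // jm _; apply: De.1.
  case: ltnP => mi; case: ltnP => mj.
  - by apply: (distinct_in_inj De).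
  - by move=> ey; case: ny; exists i.
  - by move=> ye; case: ny; exists j.
  - by move=> _; apply/eqP; rewrite eqn_leq; lia.
move=> /distinct_in_card h; move: Sm; rewrite card_eq_le => /andP[+ _].
by move=> /(card_le_trans h); rewrite card_le_II ltnn.
Qed.

Lemma card_cases n S : `I_n.+1 #<= S \/ exists2 m, (m <= n)%N & S #= `I_m.
Proof.
have [/finite_setP[m Sm]|infS] := pselect (finite_set S).
  have [mn|nm] := leqP m n; first by right; exists m.
  left; move: Sm; rewrite card_eq_le => /andP[_].
  by apply: card_le_trans; rewrite card_le_II.
left; have /infiniteP : infinite_set S by [].
by apply: card_le_trans; exact: subset_card_le.
Qed.

End DistinctIn.

(** * Uniqueness pairs for the heights 0, ..., n, p *)

Section Heights.
Variables (R : realType) (n p : nat).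
Hypothesis np : (n < p)%N.

Let hs (i : nat) : R := if (i <= n)%N then i%:R else p%:R.

Let hs_inj : {in `I_n.+2 &, injective hs}.
Proof.
move=> i j /set_mem /= hi /set_mem /= hj; rewrite /hs.
by case: (leqP i n) => ni; case: (leqP j n) => nj => /eqP; rewrite ?eqr_nat => /eqP; lia.
Qed.

Let heightsE : heights n p = [set hs i | i in `I_n.+2].
Proof.
apply/seteqP; split=> y.
  case=> [[k /= kn <-]|->].
    by exists k => /=; [exact: ltnW|rewrite /hs -ltnS kn].
  by exists n.+1 => //=; rewrite /hs ltnn.
move=> [i /= ni <-]; rewrite /hs; case: leqP => h; last by right.
by left; exists i.
Qed.

Let conj_expi (t : R) k : (expi (pi * t) ^+ k)^*%C = expi (- (pi * (k%:R * t))).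
Proof.
rewrite -expiM expi_conj; congr (expi (- _)).
by rewrite -mulr_natr; ring.
Qed.

Let sumE (F : nat -> R -> R[i]) G x y : let a := expi (pi * y) in
  \sum_(i < n.+2) expi (- (pi * (hs i * y))) *
     (if (i <= n)%N then (F i x)^*%C else (G x)^*%C) =
  (\sum_(i < n.+1) F i x * a ^+ i + G x * a ^+ p)^*%C.
Proof.
rewrite /= big_ord_recr/= {2}/hs ltnn rmorphD rmorph_sum rmorphM /= conj_expi.
congr (_ + _); last by rewrite mulrC.
apply: eq_bigr => i _; rewrite /hs/= -ltnS ltn_ord rmorphM /= conj_expi.
by rewrite mulrC.
Qed.

(* Complex conjugation turns the exponentials e^(- i pi k eta) into the powers
   a^k of a = e^(i pi eta). *)
Lemma heisenberg_uniqueness_heights (Lam : set (R * R)) :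
  heisenberg_uniqueness_pair (heights n p) Lam <->
  forall (F : nat -> R -> R[i]) (G : R -> R[i]), (forall i, FA (F i)) -> FA G ->
    (forall x y, Lam (x, y) ->
      \sum_(i < n.+1) F i x * expi (pi * y) ^+ i + G x * expi (pi * y) ^+ p = 0) ->
    (forall i x, (i <= n)%N -> F i x = 0) /\ (forall x, G x = 0).
Proof.
rewrite heightsE; split.
  move=> /(heisenberg_uniqueness_pairP hs_inj) hup F G FF FG FG0.
  pose F' i x := if (i <= n)%N then (F i x)^*%C else (G x)^*%C.
  have FF' i : FA (F' i).
    by rewrite /F'; case: (i <= n)%N; apply: FA_conj.
  have F'0 i : (i < n.+2)%N -> forall x, F' i x = 0.
    by apply: (hup F' FF') => -[x y] Lxy; rewrite [LHS](sumE F G x y) FG0// rmorph0.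
  split=> [i x ni|x].
    have := F'0 i (leqW ni : (i < n.+2)%N) x; rewrite /F' ni => /eqP.
    by rewrite fmorph_eq0 => /eqP.
  have := F'0 n.+1 (ltnSn _) x; rewrite /F' ltnn => /eqP.
  by rewrite fmorph_eq0 => /eqP.
move=> hup; apply/(heisenberg_uniqueness_pairP hs_inj) => F' FF' F'0.
pose F i x := (F' i x)^*%C; pose G x := (F' n.+1 x)^*%C.
have [|F0 G0] := hup F G (fun i => FA_conj (FF' i)) (FA_conj (FF' n.+1)).
  move=> x y Lxy; have := F'0 _ Lxy.
  rewrite (_ : \sum_(i < n.+2) _ =
      (\sum_(i < n.+1) F i x * expi (pi * y) ^+ i + G x * expi (pi * y) ^+ p)^*%C).
    by move=> /eqP; rewrite fmorph_eq0 => /eqP.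
  rewrite -sumE; apply: eq_bigr => i _; congr (_ * _).
  case: (leqP i n) => ni; rewrite /F /G conjcK//.
  by congr (F' _ x); have := ltn_ord i; lia.
move=> i ni x; rewrite -[F' i x]conjcK; case: (leqP i n) => h.
  by have := F0 i x h; rewrite /F => ->; exact: rmorph0.
rewrite (_ : i = n.+1); last lia.
by have := G0 x; rewrite /G => ->; exact: rmorph0.
Qed.

End Heights.

Section LambdaFacts.
Variables (R : realType) (n p : nat) (Lam : set (R * R)).
Hypotheses (np : (n < p)%N) (perL : periodic2 Lam).

Lemma periodic2_int x y (m : int) : Lam (x, y) -> Lam (x, y + 2 * m%:~R).
Proof.
have H (k : nat) z : Lam (x, z) <-> Lam (x, z + 2 * k%:R).
  elim: k => [|k [IH1 IH2]]; first by rewrite mulr0 addr0.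
  have -> : z + 2 * k.+1%:R = (z + 2 * k%:R) + 2 :> R by rewrite -natr1; ring.
  by split=> h; [apply/(perL _ _).1/IH1|apply/IH2/(perL _ _).2].
case: (intP m) => [|k|k] Lxy; [by rewrite mulr0z mulr0 addr0|exact: (H k.+1 y).1 Lxy|].
by apply: (H k.+1 _).2; rewrite mulrNz mulrN subrK.
Qed.

Lemma Sigma_rep x y : Lam (x, y) ->
  exists2 y', Sigma Lam x y' & expi (pi * y') = expi (pi * y).
Proof.
move=> Lxy; pose m := - Num.floor (y / 2).
exists (y + 2 * m%:~R); last exact: expi_add2.
split; last exact: periodic2_int.
have := floor_itv (y / 2); rewrite /m mulrNz intrD => /andP[h1 h2].
by apply/andP; split; lra.
Qed.

Lemma Pi_cover x : Pi Lam x -> exists2 m, (1 <= m <= n.+2)%N & Pi_part n p Lam m x.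
Proof.
move=> Px; have [y Lxy] := Px; have [y' Sy' _] := Sigma_rep Lxy.
have [big|[m mn Sm]] := card_cases n (Sigma Lam x); last first.
  have m0 : (0 < m)%N.
    case: m Sm {mn} => // /card_esym.
    rewrite II0 card_eq_sym card_eq0 => /eqP S0.
    by move: Sy'; rewrite S0.
  exists m; first by rewrite m0 (leq_trans mn)// leqW.
  by rewrite /Pi_part mn.
have [ag|nag] := pselect (forall eta, distinct_in n.+2 (Sigma Lam x) eta ->
    hsym_agree n p eta).
  by exists n.+1; rewrite ?leqnSn// /Pi_part ltnn eqxx.
exists n.+2; rewrite ?leqnn// /Pi_part ltnNge leqnSn/= eqxx.
rewrite (_ : (n.+2 == n.+1) = false); last by apply/eqP; lia.
split=> //; apply: contrapT => h; apply: nag => eta De.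
by apply: contrapT => nh; apply: h; exists eta.
Qed.

Lemma Pi_part_many m e x : (1 <= m <= n.+1)%N -> distinct_in m (Sigma Lam x) e ->
  exists2 m', (m <= m' <= n.+2)%N & Pi_part n p Lam m' x.
Proof.
move=> /andP[m0 mn] De; have [S0 _] := De.1 _ m0.
have [m' /andP[m'0 m'n] Px] := Pi_cover (ex_intro _ _ (De.1 _ m0).2).
exists m' => //; rewrite m'n andbT.
move: Px; rewrite /Pi_part; case: (leqP m' n) => m'n'; last by rewrite (leq_trans mn).
move=> [_]; rewrite card_eq_le => /andP[+ _].
by move=> /(card_le_trans (distinct_in_card De)); rewrite card_le_II.
Qed.

Section selected.
Variable eta : R -> nat -> R.
Hypothesis sel : selection n p Lam eta.
Local Notation a x := (fun j => expi (pi * eta x j)).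

Lemma selection_Lam m x j : (1 <= m <= n.+1)%N -> Pi_part n p Lam m x -> (j < m)%N ->
  Lam (x, eta x j).
Proof. by move=> m1 Px jm; have [/(_ j jm)[_ +] _] := sel m1 Px. Qed.

Lemma selection_inj m x : (1 <= m <= n.+1)%N -> Pi_part n p Lam m x ->
  {in gtn m &, injective (a x)}.
Proof.
move=> m1 Px i j im jm /expi_inj; have De := sel m1 Px.
by move=> /(_ (De.1 i im).1 (De.1 j jm).1); exact: distinct_in_inj De i j im jm.
Qed.

Lemma selection_full m x y : (1 <= m <= n)%N -> Pi_part n p Lam m x -> Lam (x, y) ->
  exists2 j, (j < m)%N & expi (pi * y) = a x j.
Proof.
move=> /andP[m1 mn] Px /Sigma_rep[y' Sy' <-].
have De : distinct_in m (Sigma Lam x) (eta x) by apply: sel => //; rewrite m1 leqW.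
move: Px; rewrite /Pi_part mn => -[_ Sm].
by have [j jm <-] := distinct_in_full Sm De Sy'; exists j.
Qed.

Lemma lacunary_extend x (f : nat -> R[i]) g y : Pi_part n p Lam n.+1 x ->
  (forall j, (j <= n)%N ->
    \sum_(i < n.+1) f i * a x j ^+ i + g * a x j ^+ p = 0) -> Lam (x, y) ->
  \sum_(i < n.+1) f i * expi (pi * y) ^+ i + g * expi (pi * y) ^+ p = 0.
Proof.
move=> Px fa Lxy; have n1 : (1 <= n.+1 <= n.+1)%N by rewrite leqnn.
have De := sel n1 Px; have inj := selection_inj n1 Px.
have [y' Sy' <-] := Sigma_rep Lxy.
have [[j jn ->]|ny] := pselect (exists2 j, (j <= n)%N & y' = eta x j); first exact: fa.
(* The new point comes last, so that [hsym_agree] equates exactly the two values of h_(p-n) whose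
   difference appears in [lacunary_value]. *)
pose e j := if (j <= n)%N then eta x j else y'.
have De' : distinct_in n.+2 (Sigma Lam x) e.
  split=> [j|i j /set_mem /= im /set_mem /= jm]; rewrite /e.
    by case: ifP => // jn _; exact: De.1.
  case: leqP => mi; case: leqP => mj.
  - exact: (distinct_in_inj De).
  - by move=> ey; case: ny; exists i.
  - by move=> ye; case: ny; exists j.
  - by move=> _; apply/eqP; rewrite eqn_leq; lia.
have := Px; rewrite /Pi_part ltnn eqxx => -[_ _ /(_ e De')].
rewrite /hsym_agree !hsymE /= /e leqnn ltnn => ag.
have injn : {in gtn n &, injective (a x)}.
  by move=> i j im jm; apply: inj; exact: ltnW.
rewrite (lacunary_value (expi (pi * y')) injn (ltnW np) fa); last first.
  apply/negP => /mapP[j]; rewrite mem_iota add0n => /= jn.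
  by move=> /(inj n j (ltnSn n) (ltnW jn)) E; move: jn; rewrite -E ltnn.
move: ag; rewrite eqxx.
rewrite (@hcomplete_ext _ _ (a x) n); last by move=> j jn; rewrite (ltnW jn).
rewrite (@hcomplete_ext _ (fun j => if j == n then _ else _) (a x) n); last first.
  by move=> j jn; rewrite (ltn_eqF jn) (ltnW jn).
by move=> ->; rewrite subrr mulr0.
Qed.

(** At the last of the n + 2 points, [lacunary_value] equates 0 with g times two nonzero factors,
    the product of differences and the gap between the h_(p-n); so g = 0. A polynomial of degree at
    most n with n + 1 zeros remains. *)
Lemma Pi_part_top x (f : nat -> R[i]) g : Pi_part n p Lam n.+2 x ->
  (forall y, Lam (x, y) ->
    \sum_(i < n.+1) f i * expi (pi * y) ^+ i + g * expi (pi * y) ^+ p = 0) ->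
  g = 0 /\ forall i, (i <= n)%N -> f i = 0.
Proof.
rewrite /Pi_part ltnNge leqnSn/= eqxx.
rewrite (_ : (n.+2 == n.+1) = false); last by apply/eqP; lia.
move=> [_ [e De nag]] fg; pose b j := expi (pi * e j).
have inj : {in gtn n.+2 &, injective b}.
  move=> i j im jm ij; apply: (distinct_in_inj De im jm).
  exact: (expi_inj (De.1 i im).1 (De.1 j jm).1 ij).
have fb j : (j <= n.+1)%N -> \sum_(i < n.+1) f i * b j ^+ i + g * b j ^+ p = 0.
  by move=> jn; apply: fg; exact: (De.1 j jn).2.
have injn k : (k <= n.+2)%N -> {in gtn k &, injective b}.
  by move=> kn i j im jm; apply: inj; exact: leq_trans kn.
have notin k : (n <= k < n.+2)%N -> b k \notin [seq b j | j <- iota 0 n].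
  move=> /andP[nk kn]; apply/negP => /mapP[j]; rewrite mem_iota add0n => /= jn.
  move=> /(inj k j kn (leq_trans jn (leqW (leqnSn n)))) E; move: jn.
  by rewrite -E ltnNge nk.
have g0 : g = 0.
  have := lacunary_value (b n.+1) (injn n (leqW (leqnSn n))) (ltnW np)
    (fun j jn => fb j (leqW jn)) (notin n _).
  rewrite leqnn leqnSn => /(_ isT); rewrite fb// => /esym/eqP.
  rewrite !mulf_eq0 => /orP[/orP[/eqP//|]|].
    rewrite prodf_seq_eq0 => /hasP[j _ /=]; rewrite subr_eq0 => /eqP E.
    have h : (n <= n.+1 < n.+2)%N by rewrite leqnSn ltnSn.
    have /negP := notin _ h; case; apply/mapP.
    by exists (j : nat) => //; rewrite mem_iota add0n ltn_ord.
  rewrite subr_eq0 => /eqP E; case: nag.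
  rewrite /hsym_agree !hsymE /= eqxx.
  rewrite (@hcomplete_ext _ (fun j => if j == n then _ else _) b n); first by rewrite E.
  by move=> j jn; rewrite (ltn_eqF jn).
split=> // i ni; apply: (sum_expr_eq0 (injn n.+1 (leqnSn _))) => // j jn.
by have := fb j (ltnW jn); rewrite g0 mul0r addr0.
Qed.

End selected.
End LambdaFacts.

(** * Closed projections, dense sets and common radii *)

Section Topology.
Variable R : realType.
Implicit Types (x y d e : R) (A O : set R).

Lemma closed_approx A x : closed A ->
  (forall e, 0 < e -> exists2 y, `|y - x| < e & A y) -> A x.
Proof.
move=> cA Ax; apply: cA => B /nbhs_ballP[e /= e0 eB].
have [y yx Ay] := Ax e e0; exists y; split=> //.
by apply: eB; rewrite /ball/= distrC.
Qed.

(** The bounds on y make the part of Lam above a bounded interval compact; the projection of an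
    unbounded closed set may fail to be closed. *)
Lemma closed_proj (Lam : set (R * R)) u v : closed Lam ->
  closed [set x | exists2 y, u <= y <= v & Lam (x, y)].
Proof.
move=> cL; set A := [set x | _].
move=> x0 Ax0.
pose C := Lam `&` (`[x0 - 1, x0 + 1] `*` `[u, v]).
have cC : compact C.
  rewrite /C setIC; apply: compact_closedI => //.
  by apply: compact_setX; exact: segment_compact.
have cD : closed (fst @` C).
  apply: compact_closed; first exact: Rhausdorff.
  apply: continuous_compact => //; apply: continuous_subspaceT => z.
  exact: cvg_fst.
suff [[x y] [/= Lxy [_ /= yv]] <-] : (fst @` C) x0.
  by exists y => //; move: yv; rewrite in_itv.
apply: closed_approx cD _ => e e0.
have e1 : 0 < Num.min e 1 by rewrite lt_min e0 ltr01.
have [x [[y yv Lxy]]] := Ax0 _ (nbhsx_ballx x0 _ e1).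
rewrite /ball/= distrC lt_min => /andP[xe /ltW x1].
exists x => //; exists (x, y) => //; split=> //; split; rewrite /= in_itv//=.
by move: x1; rewrite ler_norml => /andP[h1 h2]; apply/andP; split; lra.
Qed.

Lemma dense_closed A : dense A -> closed A -> forall x, A x.
Proof.
move=> dA cA x; apply: contrapT => nAx.
have [] := dA (~` A) (ex_intro _ x nAx); first exact: closed_openC.
by move=> y [].
Qed.

Lemma open_radius O x : open O -> O x ->
  exists2 d, 0 < d & forall y, `|y - x| < d -> O y.
Proof.
move=> oO Ox; have /near_radius[d d0 dO] : \forall y \near x, O y by exact: open_nbhs_nbhs.
by exists d.
Qed.

(** Asking for all smaller radii makes the condition stable under the minimum over finitely many
    indices. *)
Lemma common_radius m (P : nat -> R -> Prop) :
  (forall j, (j < m)%N -> exists2 d, 0 < d & forall e, 0 < e <= d -> P j e) ->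
  exists2 d, 0 < d & forall j, (j < m)%N -> forall e, 0 < e <= d -> P j e.
Proof.
elim: m => [|m IHm] Pd; first by exists 1.
have [j jm|d d0 dP] := IHm; first exact/Pd/ltnW.
have [d' d'0 d'P] := Pd m (ltnSn m).
exists (Num.min d d'); first by rewrite lt_min d0.
move=> j; rewrite ltnS leq_eqVlt => /orP[/eqP->|jm] e /andP[e0].
  by rewrite le_min => /andP[_ ed]; apply: d'P; rewrite e0.
by rewrite le_min => /andP[ed _]; apply: dP => //; rewrite e0.
Qed.

Lemma prodr_lt_exists m (f : nat -> R) (c : R) : 0 <= c ->
  \prod_(l < m) f l < c ^+ m -> exists2 l, (l < m)%N & f l < c.
Proof.
move=> c0; rewrite ltNge => /negP h; apply: contrapT => nl; apply: h.
rewrite -[X in c ^+ X]card_ord -prodr_const; apply: ler_prod => l _.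
rewrite c0/=; rewrite leNgt; apply/negP => fl; apply: nl.
by exists (l : nat).
Qed.

End Topology.

Section Sums.
Variable K : nzRingType.

Lemma sum_ltn_if (f : nat -> K) s N : (s <= N)%N ->
  \sum_(i < N) (if (i < s)%N then f i else 0) = \sum_(i < s) f i.
Proof. by move=> sN; rewrite (big_ord_widen _ f sN) [RHS]big_mkcond. Qed.

End Sums.

(** * Local behaviour of the strata Pi^m *)

Section LocalStructure.
Variables (R : realType) (n p : nat) (Lam : set (R * R)) (eta : R -> nat -> R).
Hypotheses (np : (n < p)%N) (cL : closed Lam) (perL : periodic2 Lam).
Hypotheses (dL : dense (Pi Lam)) (sel : selection n p Lam eta).
Local Notation a := (fun x j => expi (pi * eta x j)).
Local Notation PiL := (Pi_part n p Lam).

(** Periodicity brings the heights into [0, 2], where [closed_proj] applies; a closed dense set is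
    the whole line. *)
Lemma Pi_full x : Pi Lam x.
Proof.
have PiE : Pi Lam = [set x | exists2 y, 0 <= y <= 2 & Lam (x, y)].
  apply/seteqP; split=> [z [y /(Sigma_rep perL)[y' [/andP[h1 h2] Lz] _]]|z [y _ Lz]].
    by exists y' => //; rewrite h1 ltW.
  by exists y.
by apply: dense_closed => //; rewrite PiE; exact: closed_proj.
Qed.

Lemma Lloc_local E x0 psi : Lloc E x0 psi -> exists2 T : R -> R[i], FA T &
  exists2 d, 0 < d & forall x, `|x - x0| < d -> E x -> psi x = T x.
Proof.
move=> [I [oI x0I [phi Lphi psiE]]]; exists (fourier phi); first by exists phi.
have [d d0 dI] := open_radius oI x0I; exists d => // x xd Ex.
by apply: psiE => //; exact: dI.
Qed.

Lemma Pi_star_local m x0 : Pi_star n p Lam eta m x0 ->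
  exists2 T : nat -> R -> R[i], (forall k, FA (T k)) &
  exists2 d, 0 < d & forall x, `|x - x0| < d -> PiL m x -> forall j, (j < m)%N ->
    \sum_(k < m) T k x * a x j ^+ k = - a x j ^+ m.
Proof.
move=> [Px0 [tau tauE tauL]].
have H k : exists T : R -> R[i], FA T /\ ((k < m)%N -> exists2 d, 0 < d &
    forall x, `|x - x0| < d -> PiL m x -> tau k x = T x).
  case: (ltnP k m) => km; last by exists (fun=> 0); split=> //; exact: FA_0.
  by have [T FT Td] := Lloc_local (tauL k km); exists T.
have /choice[T /all_and2[FT Td]] := H.
exists T => //.
have [k km|d d0 dT] := @common_radius R m (fun k d =>
    forall x, `|x - x0| < d -> PiL m x -> tau k x = T k x).
  have [d d0 dT] := Td k km; exists d => // e /andP[_ ed] x xe.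
  by apply: dT; exact: lt_le_trans ed.
exists d => // x xd Px j jm; rewrite -(tauE x j Px jm); apply: eq_bigr => k _.
by rewrite (dT k (ltn_ord k) d _ x xd Px)// d0 lexx.
Qed.

(** Distinct points of [0, 2) are separated on the circle R / 2Z. The factor 2 makes the closed
    intervals of radius d around them disjoint modulo 2. *)
Lemma separation m (c : nat -> R) : (forall j, (j < m)%N -> 0 <= c j < 2) ->
  {in gtn m &, injective c} ->
  exists2 d, 0 < d <= 1 & forall i j, (i < m)%N -> (j < m)%N -> forall k : int,
    `|c i + 2 * k%:~R - c j| <= 2 * d -> i = j.
Proof.
move=> c2 cinj.
pose P i d := forall j, (j < m)%N -> forall k : int,
  `|c i + 2 * k%:~R - c j| <= 2 * d -> i = j.
have [i im|d d0 dP] := @common_radius R m P; last first.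
  exists (Num.min d 1); first by rewrite lt_min d0 ltr01 ge_min lexx orbT.
  move=> i j im jm k h; apply: (dP i im _ _ j jm k h).
  by rewrite lt_min d0 ltr01 ge_min lexx.
pose Q j d := forall k : int, `|c i + 2 * k%:~R - c j| <= 2 * d -> i = j.
have [j jm|d d0 dQ] := @common_radius R m Q; last first.
  by exists d => // e ed j jm; exact: dQ.
have [ij|ij] := eqVneq i j; first by exists 1 => // e _ k _.
have cij : c i != c j by apply: contra ij => /eqP /cinj -> //.
have /andP[i1 i2] := c2 i im; have /andP[j1 j2] := c2 j jm.
have D0 : 0 < `|c i - c j| by rewrite normr_gt0 subr_eq0.
have D2 : `|c i - c j| < 2 by rewrite ltr_norml; apply/andP; split; lra.
(* A third of the circular distance: twice this radius stays below both gaps, and only the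
   translations k = -1, 0, 1 have to be checked. *)
exists (Num.min (`|c i - c j|) (2 - `|c i - c j|) / 3).
  by rewrite divr_gt0// lt_min D0 subr_gt0.
move=> e /andP[e0]; rewrite ler_pdivlMr// le_min => /andP[e1 e2] k.
rewrite ler_norml => /andP[k1 k2]; exfalso.
have m1 : (k%:~R < 2 :> R).
  by move: e1 e2; rewrite ler_normr => *; lra.
have m2 : (-2 < k%:~R :> R) by lra.
have : k = -1 \/ k = 0 \/ k = 1.
  have k2' : (k < 2)%R by rewrite -(ltr_int R).
  have k2'' : (-2 < k)%R by rewrite -(ltr_int R).
  by clear -k2' k2''; lia.
move: D0 D2 e1 e2; case: (ler0P (c i - c j)) => h D0 D2 e1 e2 [|[]] kE;
  rewrite kE in k1 k2; move: k1 k2; rewrite ?mulrN1z ?mulr0z ?mulr1z; lra.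
Qed.

(* The closedness of Lam makes Pi^m relatively closed near a point of Pi^m* when
   no larger fibre occurs nearby: the monic polynomial with roots a_j(y), y in
   Pi^m near x0, is small at each a_j(x0), so each a_j(x0) is close to a root. *)
Lemma local_closed m (O : set R) (x0 : R) : (2 <= m <= n.+1)%N -> open O -> O x0 ->
  (forall (x : R) m', O x -> (m < m' <= n.+2)%N -> ~ PiL m' x) ->
  Pi_star n p Lam eta m x0 ->
  exists d, [/\ 0 < d, (forall x, `|x - x0| < d -> O x) &
    forall x, `|x - x0| < d ->
      (forall e, 0 < e -> exists y, [/\ `|y - x| < e, `|y - x0| < d & PiL m y]) ->
      PiL m x].
Proof.
move=> /andP[m2 mn] oO Ox0 Om starx0; have Px0 := starx0.1.
have m1 : (1 <= m <= n.+1)%N by rewrite (ltnW m2).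
have [T FT [d1 d10 TE]] := Pi_star_local starx0.
have De0 := sel m1 Px0.
have [dl /andP[dl0 dl1] sep] := separation (fun j jm => (De0.1 j jm).1) (distinct_in_inj De0).
(* The squared chord that subtends an angle pi dl: squared distances below [ep] give heights within
   [dl] modulo 2. *)
pose ep := 2 * (1 - cos (pi * dl)).
have ep0 : 0 < ep by rewrite mulr_gt0// onem_cos_gt0.
pose Q j x := a x0 j ^+ m + \sum_(k < m) T k x * a x0 j ^+ k.
have cQ j : ccontinuous (Q j).
  apply: ccontinuous_D; first exact: ccontinuous_cst.
  apply: (ccontinuous_sum (F := fun k x => T k x * a x0 j ^+ k)) => k _.
  by apply: ccontinuous_M; [exact: FA_continuous|exact: ccontinuous_cst].
have Q0 j : (j < m)%N -> Q j x0 = 0.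
  by move=> jm; rewrite /Q TE ?subrr ?normr0 ?addrN.
(* For y in Pi^m near x0, [Q j y] is the product of the distances, as complex differences, from
   a_j(x0) to the m roots at y; a product of m squared moduli below ep^m has a factor below ep. *)
have [j jm|d2 d20 Qd] := @common_radius R m (fun j d => forall x, `|x - x0| < d ->
    normsq (Q j x) < ep ^+ m).
  have : \forall x \near x0, normsq (Q j x) < ep ^+ m.
    have cn : continuous (fun x => normsq (Q j x)) by exact: continuous_normsq.
    apply: (cvgr_lt (normsq (Q j x0)) (cn x0)).
    rewrite Q0//; have /eqP -> : normsq (0 : R[i]) == 0 by rewrite normsq_eq0.
    exact: exprn_gt0.
  move=> /near_radius[d d0 dQ]; exists d => // e /andP[_ ed] x xe.
  by apply: dQ; exact: lt_le_trans ed.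
have [d3 d30 Od] := open_radius oO Ox0.
pose d := Num.min d1 (Num.min d2 d3).
have d0 : 0 < d by rewrite !lt_min d10 d20.
have dd1 : d <= d1 by rewrite ge_min lexx.
have dd2 : d <= d2 by rewrite !ge_min lexx orbT.
have dd3 : d <= d3 by rewrite !ge_min lexx !orbT.
exists d; split=> // [x xd|x xd approx]; first by apply: Od; exact: lt_le_trans dd3.
have close y j : `|y - x0| < d -> PiL m y -> (j < m)%N ->
    exists2 z, eta x0 j - dl <= z <= eta x0 j + dl & Lam (y, z).
  move=> yd Py jm.
  have := Qd j jm d2 _ y (lt_le_trans yd dd2); rewrite d20 lexx => /(_ isT).
  have inj := selection_inj sel m1 Py.
  have := monic_factors (t := fun k => T k y) (a x0 j) inj (TE y (lt_le_trans yd dd1) Py).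
  rewrite -/(Q j y) => ->; rewrite (normsq_prod m (fun l => a x0 j - a y l)).
  move=> /(prodr_lt_exists (f := fun l => normsq (a x0 j - a y l)) (ltW ep0))[l lm].
  rewrite /= normsq_sub => /(expi_close dl0 dl1)[k kd].
  exists (eta y l + 2 * k%:~R); last first.
    by apply: periodic2_int => //; exact: selection_Lam sel _ _ _ m1 Py lm.
  by move: kd; rewrite ltr_norml => /andP[h1 h2]; apply/andP; split; lra.
have /choice[z zP] : forall j, exists z, (j < m)%N ->
    eta x0 j - dl <= z <= eta x0 j + dl /\ Lam (x, z).
  move=> j; case: (ltnP j m) => jm; last by exists 0.
  (* The heights found at nearby points stay in a compact interval, so closedness of Lam passes one
     of them to the limit x. *)
  have [z zd Lz] : [set x | exists2 z, eta x0 j - dl <= z <= eta x0 j + dl & Lam (x, z)] x.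
    apply: closed_approx; first exact: closed_proj.
    move=> e e0; have [y [yx yd Py]] := approx e e0; exists y => //; exact: close.
  by exists z.
have /choice[w wP] : forall j, exists w, (j < m)%N ->
    Sigma Lam x w /\ expi (pi * w) = expi (pi * z j).
  move=> j; case: (ltnP j m) => jm; last by exists 0.
  by have [w Sw Ew] := Sigma_rep perL (zP j jm).2; exists w.
have Dw : distinct_in m (Sigma Lam x) w.
  split=> [j jm|i j /set_mem /= im /set_mem /= jm wij]; first exact: (wP j jm).1.
  have : expi (pi * z i) = expi (pi * z j) by rewrite -(wP i im).2 wij (wP j jm).2.
  move=> /expi_inj_mod2[k kE]; apply: (sep i j im jm k).
  have [/andP[h1 h2] _] := zP i im; have [/andP[h3 h4] _] := zP j jm.
  by rewrite ler_norml; apply/andP; split; lra.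
(* The fibre of x has at least m points, and the strata above m do not meet O. *)
have [m' /andP[mm' m'n] Pm'] := Pi_part_many np perL m1 Dw.
move: mm'; rewrite leq_eqVlt => /orP[/eqP ->//|mm'].
by case: (Om x m') => //; [apply: Od; exact: lt_le_trans dd3|rewrite mm'].
Qed.

End LocalStructure.

(** * Necessity *)

Section Forward.
Variables (R : realType) (n p : nat) (Lam : set (R * R)) (eta : R -> nat -> R).
Hypotheses (n0 : (0 < n)%N) (np : (n < p)%N) (cL : closed Lam) (perL : periodic2 Lam).
Hypotheses (dL : dense (Pi Lam)) (sel : selection n p Lam eta).
Local Notation a := (fun x j => expi (pi * eta x j)).
Local Notation PiL := (Pi_part n p Lam).

Lemma not_Pi_tilde x m : (1 <= m <= n.+2)%N -> PiL m x -> ~ Pi_tilde n p Lam eta x ->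
  [/\ (m <= n.+1)%N, m = 1%N -> Pi1_star n p Lam eta x &
      (2 <= m)%N -> Pi_star n p Lam eta m x].
Proof.
move=> /andP[m1 mn] Px nx; split.
- move: mn; rewrite leq_eqVlt => /orP[/eqP mE|//]; case: nx.
  by left; left; rewrite -mE.
- move=> mE; apply: contrapT => nst; apply: nx; right; split=> //.
  by rewrite -mE.
- move=> m2; apply: contrapT => nst; apply: nx; left.
  move: mn; rewrite leq_eqVlt => /orP[/eqP mE|mn]; first by left; rewrite -mE.
  by right; exists m => //=; rewrite m2.
Qed.

(** Induction on a bound m for the strata that meet O. If the top stratum contains x0 but does not
    fill a small ball around it, then by [local_closed] it misses a smaller ball inside, and there
    the bound drops. *)
Lemma constant_stratum m (O : set R) : (m <= n.+1)%N -> open O -> O !=set0 ->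
  (forall x, O x -> ~ Pi_tilde n p Lam eta x) ->
  (forall (x : R) m', O x -> (m < m' <= n.+2)%N -> ~ PiL m' x) ->
  exists m1 (x : R) d, [/\ (1 <= m1 <= n.+1)%N, 0 < d &
    forall y : R, `|y - x| < d -> O y /\ PiL m1 y].
Proof.
elim: m O => [|m IHm] O mn oO [x Ox] nO Om.
  have [m' m'1 Px] := Pi_cover np perL (Pi_full cL perL dL x).
  by case: (Om x m' Ox m'1 Px).
(* The bottom case has bound 1. Here Pi^1* provides no monic relation of degree 1, but since every
   fibre is nonempty all of O lies in Pi^1. *)
have [m0|m0] := posnP m.
  have [d d0 dO] := open_radius oO Ox; exists 1%N, x, d; split=> // y yd.
  split; first exact: dO.
  have [m' /andP[m'1 m'n] Py] := Pi_cover np perL (Pi_full cL perL dL y).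
  have [->//|] := eqVneq 1%N m' => m'N.
  case: (Om y m' (dO y yd)) => //; rewrite m0 m'n andbT; lia.
have [[x0 [Ox0 Px0]]|nP] := pselect (exists x0, O x0 /\ PiL m.+1 x0); last first.
  apply: (IHm O) => //; [exact: ltnW|by exists x|].
  move=> y m' Oy /andP[mm' m'n] Py; move: mm'; rewrite leq_eqVlt => /orP[/eqP mE|mm'].
    by apply: nP; exists y; rewrite mE.
  by apply: (Om y m' Oy _ Py); rewrite mm'.
have [_ _ st] : [/\ (m.+1 <= n.+1)%N, m.+1 = 1%N -> Pi1_star n p Lam eta x0 &
    (2 <= m.+1)%N -> Pi_star n p Lam eta m.+1 x0].
  by apply: not_Pi_tilde => //; [exact: leqW|exact: nO].
have m2 : (2 <= m.+1 <= n.+1)%N by rewrite ltnS m0.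
have [d [d0 dO dP]] := local_closed np cL perL sel m2 oO Ox0 Om (st m0).
have [all|/existsNP[x1 /not_implyP[x1d nP1]]] :=
    pselect (forall y : R, `|y - x0| < d -> PiL m.+1 y).
  exists m.+1, x0, d; split=> // y yd; split; [exact: dO|exact: all].
(* Contrapositive of relative closedness at x1: otherwise x1 would be a limit of points of the
   stratum within the ball, and would belong to it. *)
have [e e0 eP] : exists2 e, 0 < e &
    forall y : R, `|y - x1| < e -> `|y - x0| < d -> ~ PiL m.+1 y.
  apply: contrapT => ne; apply: nP1; apply: dP => // e e0.
  apply: contrapT => ny; apply: ne; exists e => // y y1 yd Py.
  by apply: ny; exists y.
pose e' := Num.min e (d - `|x1 - x0|).
have e'0 : 0 < e' by rewrite lt_min e0 subr_gt0.
have sub (y : R) : `|y - x1| < e' -> `|y - x1| < e /\ `|y - x0| < d.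
  rewrite lt_min => /andP[ye yd]; split=> //.
  have := ler_normD (y - x1) (x1 - x0); rewrite addrA subrK; lra.
have [oB B0] := open_ball0 x1 e'0.
have [||m1 [x2 [d2 [m1n d20 H]]]] := IHm [set y | `|y - x1| < e'] (ltnW mn) oB B0.
- by move=> y /sub[_ /dO]; exact: nO.
- move=> y m' /sub[ye yd] /andP[mm' m'n] Py.
  move: mm'; rewrite leq_eqVlt => /orP[/eqP mE|mm'].
    by apply: (eP y ye yd); rewrite mE.
  by apply: (Om y m' (dO y yd) _ Py); rewrite mm'.
- exists m1, x2, d2; split=> // y /H[/sub[_ yd] Py]; split=> //; exact: dO.
Qed.

Local Notation relation F G := (forall x y, Lam (x, y) ->
  \sum_(i < n.+1) F i x * expi (pi * y) ^+ i + G x * expi (pi * y) ^+ p = 0).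

Lemma relation_fibre1 (x0 : R) d : 0 < d -> (forall x, `|x - x0| < d -> PiL 1 x) ->
  Pi1_star n p Lam eta x0 ->
  exists (F : nat -> R -> R[i]) G, [/\ forall i, FA (F i), FA G,
    relation F G & G x0 != 0].
Proof.
move=> d0 dP [_ [I [oI x0I [phi Lphi phiE]]]].
have [d' d'0 dI] := open_radius oI x0I.
have d''0 : 0 < Num.min d d' by rewrite lt_min d0.
have [chi [Fchi chi0 chi_out]] := FA_bump x0 d''0.
exists (fun i x => if (i <= n)%N then fourier (phi i) x * chi x else 0), chi; split=> //.
  move=> i; case: (leqP i n) => ni; last exact: FA_0.
  by apply: FA_M => //; exists (phi i) => //; exact: Lphi.
move=> x y Lxy; case: (ltP `|x - x0| (Num.min d d')) => [|/chi_out->]; last first.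
  by rewrite mul0r addr0 big1// => i _; rewrite mulr0 if_same mul0r.
rewrite lt_min => /andP[xd xd'].
have n1 : (1 <= 1 <= n)%N by [].
have [[|//] _ bE] := selection_full perL sel n1 (dP x xd) Lxy.
have := phiE x (dI x xd') (dP x xd); rewrite -bE; set b := expi _ => E.
rewrite (eq_bigr (fun i : 'I_n.+1 => chi x * (fourier (phi i) x * b ^+ i))); last first.
  by move=> i _; rewrite -ltnS ltn_ord mulrA [chi x * _]mulrC.
by rewrite -mulr_sumr -mulrDr addrC E mulr0.
Qed.

Lemma relation_fibre (x0 : R) m d : (2 <= m <= n)%N -> 0 < d ->
  (forall x, `|x - x0| < d -> PiL m x) -> Pi_star n p Lam eta m x0 ->
  exists (F : nat -> R -> R[i]) G, [/\ forall i, FA (F i), FA G,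
    relation F G & F m x0 != 0].
Proof.
move=> /andP[m2 mn] d0 dP /Pi_star_local[T FT [d' d'0 TE]].
have d''0 : 0 < Num.min d d' by rewrite lt_min d0.
have [chi [Fchi chi0 chi_out]] := FA_bump x0 d''0.
(* With leading coefficient 1, [F m] is the bump itself, nonzero at x0; as m <= n, the monic
   relation fits among the heights 0, ..., n and G can be 0. *)
pose c i x : R[i] := if (i < m)%N then T i x else 1.
exists (fun i x => if (i < m.+1)%N then chi x * c i x else 0), (fun=> 0); split.
- move=> i; case: (ltnP i m.+1) => im; last exact: FA_0.
  rewrite /c; case: (ltnP i m) => im'; first exact: FA_M.
  by apply: FA_ext Fchi => x; rewrite mulr1.
- exact: FA_0.
- move=> x y Lxy; rewrite mul0r addr0; set b := expi _.
  rewrite (eq_bigr (fun i : 'I_n.+1 =>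
      if (i < m.+1)%N then chi x * (c i x * b ^+ i) else 0)); last first.
    by move=> i _; case: (_ < _)%N; rewrite ?mul0r// mulrA.
  rewrite (sum_ltn_if (fun i => chi x * (c i x * b ^+ i))) ?ltnS// -mulr_sumr.
  case: (ltP `|x - x0| (Num.min d d')) => [|/chi_out->]; last by rewrite mul0r.
  rewrite lt_min => /andP[xd xd'].
  have m1 : (1 <= m <= n)%N by rewrite (ltnW m2).
  have [j jm bE] := selection_full perL sel m1 (dP x xd) Lxy.
  rewrite big_ord_recr/= /c ltnn mul1r.
  rewrite (eq_bigr (fun k : 'I_m => T k x * b ^+ k)); last by move=> k _; rewrite ltn_ord.
  by rewrite /b bE (TE x xd' (dP x xd) j jm) addNr mulr0.
- by rewrite ltnSn /c ltnn mulr1.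
Qed.

(** The height n + 1 lies in Gamma only if p = n + 1, so the monic relation of degree n + 1 has to
    be traded for one that expresses a^p. *)
Lemma relation_fibre_top (x0 : R) d : 0 < d -> (forall x, `|x - x0| < d -> PiL n.+1 x) ->
  Pi_star n p Lam eta n.+1 x0 ->
  exists (F : nat -> R -> R[i]) G, [/\ forall i, FA (F i), FA G,
    relation F G & G x0 != 0].
Proof.
move=> d0 dP /Pi_star_local[T FT [d' d'0 TE]].
have d''0 : 0 < Num.min d d' by rewrite lt_min d0.
have [chi [Fchi chi0 chi_out]] := FA_bump x0 d''0.
have MT k : MA (fun x => - T k x).
  apply: FA_MA; apply: FA_ext (FA_Z (-1) (FT k)) => x; exact: mulN1r.
have [U MU UE] := power_reduction p (ltn0Sn n) MT.
exists (fun i x => - U i x * chi x), chi; split=> //.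
  move=> i; apply: FA_ext (FA_Z (-1) (MU i _ Fchi)) => x.
  by rewrite mulN1r mulNr.
move=> x y Lxy; case: (ltP `|x - x0| (Num.min d d')) => [|/chi_out->]; last first.
  by rewrite mul0r addr0 big1// => i _; rewrite mulr0 mul0r.
rewrite lt_min => /andP[xd xd'].
apply: (lacunary_extend np perL sel (f := fun i => - U i x * chi x) (dP x xd)) Lxy => j jn.
rewrite (UE x (a x j)).
  rewrite mulr_sumr -big_split big1//= => i _.
  by rewrite mulNr mulrA [chi x * _]mulrC mulNr addNr.
rewrite -[LHS]opprK -(TE x xd' (dP x xd) j jn) -sumrN.
by apply: eq_bigr => i _; rewrite mulNr.
Qed.

Lemma dense_of_uniqueness : heisenberg_uniqueness_pair (heights n p) Lam ->
  dense (Pi_tilde n p Lam eta).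
Proof.
move=> /(heisenberg_uniqueness_heights np) hup O O0 oO; apply: contrapT => nOP.
have nO x : O x -> ~ Pi_tilde n p Lam eta x by move=> Ox Px; apply: nOP; exists x.
have [|m [x0 [d [mn d0 H]]]] := constant_stratum (leqnn n.+1) oO O0 nO.
  move=> x m Ox h Px; apply: (nO x Ox); left; left.
  by rewrite (_ : n.+2 = m)//; lia.
have dP x : `|x - x0| < d -> PiL m x by move=> /H[].
have [Ox0 Px0] := H x0 ltac:(by rewrite subrr normr0).
have [_ st1 st] : [/\ (m <= n.+1)%N, m = 1%N -> Pi1_star n p Lam eta x0 &
    (2 <= m)%N -> Pi_star n p Lam eta m x0].
  apply: not_Pi_tilde => //; last exact: nO.
  by case/andP: mn => -> /leqW.
have [mE|m1] := eqVneq m 1%N.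
  have dP1 x : `|x - x0| < d -> PiL 1 x by rewrite -[in PiL 1]mE; exact: dP.
  have [F [G [FF FG FG0 G0]]] := relation_fibre1 d0 dP1 (st1 mE).
  by move: G0; rewrite (hup F G FF FG FG0).2 eqxx.
have m2 : (2 <= m)%N by case/andP: mn; lia.
have [mn'|nm] := leqP m n.
  have [F [G [FF FG FG0 F0]]] :=
    relation_fibre (d := d) (x0 := x0) (introT andP (conj m2 mn')) d0 dP (st m2).
  by move: F0; rewrite (hup F G FF FG FG0).1 ?eqxx.
have mE : m = n.+1 by case/andP: mn; lia.
move: (st m2) dP; rewrite mE => stn dP.
have [F [G [FF FG FG0 G0]]] := relation_fibre_top d0 dP stn.
by move: G0; rewrite (hup F G FF FG FG0).2 eqxx.
Qed.

End Forward.

(** * Sufficiency *)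

Section Converse.
Variables (R : realType) (n p : nat) (Lam : set (R * R)) (eta : R -> nat -> R).
Hypotheses (np : (n < p)%N) (cL : closed Lam) (perL : periodic2 Lam).
Hypotheses (dL : dense (Pi Lam)) (sel : selection n p Lam eta).
Local Notation a := (fun x j => expi (pi * eta x j)).
Local Notation PiL := (Pi_part n p Lam).

(** Coefficients are multipliers because [power_reduction] produces constants;
    [local_relation_fourier] turns them into transforms with a local unit. *)
Definition local_relation (x0 : R) : Prop := exists (U : nat -> R -> R[i]) d,
  [/\ forall k, MA (U k), 0 < d & forall x y, `|x - x0| < d -> Lam (x, y) ->
    expi (pi * y) ^+ p + \sum_(k < n.+1) U k x * expi (pi * y) ^+ k = 0].

Lemma in_itv_ball (x0 d x : R) : (x \in `]x0 - d, x0 + d[) = (`|x - x0| < d).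
Proof. by rewrite in_itv/= ltr_distl. Qed.

Lemma local_relation_fourier x0 : local_relation x0 ->
  exists (phi : nat -> R -> R[i]) (I : interval R),
    [/\ forall k, L1 (phi k), open [set` I], x0 \in I &
    forall x y, x \in I -> Lam (x, y) ->
      expi (pi * y) ^+ p + \sum_(k < n.+1) fourier (phi k) x * expi (pi * y) ^+ k = 0].
Proof.
move=> [U [d [MU d0 UE]]]; have [u Fu u1] := FA_unit x0 d0.
have /choice[phi phiE] : forall k, exists phi, L1 phi /\ forall x, U k x * u x = fourier phi x.
  by move=> k; have [phi Lphi E] := MU k u Fu; exists phi.
exists phi, `]x0 - d, x0 + d[; split.
- by move=> k; exact: (phiE k).1.
- exact: interval_open.
- by rewrite in_itv_ball subrr normr0.
- move=> x y; rewrite in_itv_ball => xd Lxy; rewrite -[RHS](UE x y xd Lxy).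
  congr (_ + _); apply: eq_bigr => k _.
  by rewrite -(phiE k).2 u1 ?mulr1// ltW.
Qed.

Lemma local_relation_Pi1_star x0 : PiL 1 x0 -> local_relation x0 ->
  Pi1_star n p Lam eta x0.
Proof.
move=> Px0 /local_relation_fourier[phi [I [Lphi oI x0I phiE]]].
split=> //; exists I; split=> //; exists phi => // x xI Px.
by apply: phiE => //; apply: (selection_Lam sel _ Px).
Qed.

Lemma local_relation_Pi_pstar m x0 : (2 <= m <= n.+1)%N -> PiL m x0 ->
  local_relation x0 -> Pi_pstar n p Lam eta m x0.
Proof.
move=> /andP[m2 mn] Px0 /local_relation_fourier[phi [I [Lphi oI x0I phiE]]].
split=> //.
(* [Pi_pstar] demands its equations on all of Pi^m, so tau is completed by interpolation outside
   I. *)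
have /choice[t tE] : forall x, exists t : nat -> R[i], forall j, (j < m)%N ->
    \sum_(k < n.+1) t k * a x j ^+ k = - a x j ^+ p.
  by move=> x; exact: (@expr_interpolation _ (a x) m n.+1 p mn).
exists (fun k x => if x \in I then fourier (phi k) x else t x k).
  move=> x j Px jm; case: (boolP (x \in I)) => xI; last exact: tE.
  apply/eqP; rewrite -addr_eq0 addrC phiE//.
  by apply: (selection_Lam sel _ Px jm); rewrite (ltnW m2).
move=> k _; exists I; split=> //; exists (phi k) => // x xI _.
by rewrite xI.
Qed.

Lemma Pi_tilde_p_local x0 : Pi_tilde_p n p Lam eta x0 ->
  PiL n.+2 x0 \/ ~ local_relation x0.
Proof.
case=> [[Px|[m /= m2 [Px nst]]]|[Px nst]]; [by left| |].
  by right => h; apply: nst; exact: local_relation_Pi_pstar.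
by right => h; apply: nst; exact: local_relation_Pi1_star.
Qed.

Lemma uniqueness_of_dense : dense (Pi_tilde_p n p Lam eta) ->
  heisenberg_uniqueness_pair (heights n p) Lam.
Proof.
move=> dP; apply/(heisenberg_uniqueness_heights np) => F G FF FG FG0.
have MN (f W : R -> R[i]) : FA f -> FA W -> MA (fun x => - (f x * W x)).
  move=> Ff FW; apply: FA_MA; apply: FA_ext (FA_Z (-1) (FA_M Ff FW)) => x.
  exact: mulN1r.
have G0 x : G x = 0.
  apply: (ccontinuous_dense (FA_continuous FG) dP) => {}x /Pi_tilde_p_local[Px|nloc].
    by have [] := Pi_part_top np (f := fun i => F i x) Px (fun y Lxy => FG0 x y Lxy).
  apply/eqP; apply: contrapT => /negP Gx; apply: nloc.
  have [W [d [FW d0 GW]]] := FA_inv FG Gx.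
  exists (fun k x => F k x * W x), d; split=> //.
    by move=> k; apply: FA_MA; exact: FA_M.
  move=> z y zd Lzy; have := congr1 (fun c => c * W z) (FG0 z y Lzy).
  rewrite mul0r mulrDl => E; rewrite -[RHS]E addrC; congr (_ + _).
    by rewrite mulr_suml; apply: eq_bigr => k _; rewrite mulrAC.
  by rewrite mulrAC GW// mul1r.
split=> //.
have Fsum s x y : (s <= n)%N -> (forall i, (s < i <= n)%N -> F i x = 0) -> Lam (x, y) ->
    \sum_(k < s.+1) F k x * expi (pi * y) ^+ k = 0.
  move=> sn F0 Lxy; rewrite -[RHS](FG0 x y Lxy) G0 mul0r addr0.
  rewrite -(sum_ltn_if (fun k => F k x * expi (pi * y) ^+ k) (sn : (s.+1 <= n.+1)%N)).
  apply: eq_bigr => k _; case: (ltnP k s.+1) => // sk.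
  by rewrite F0 ?mul0r// sk -ltnS ltn_ord.
(* k counts the top coefficients already known to vanish; the next index to treat is s = n - k. *)
have F0 k : (k <= n.+1)%N -> forall i, (n.+1 - k <= i <= n)%N -> forall x, F i x = 0.
  elim: k => [|k IHk] kn i; first by rewrite subn0 => /andP[h1 h2]; lia.
  set s := (n - k)%N; rewrite subSS -/s => /andP[si sn].
  move: si; rewrite leq_eqVlt => /orP[/eqP <-|si]; last first.
    by apply: IHk; [exact: ltnW|lia].
  have sn' : (s <= n)%N by rewrite leq_subr.
  have hi x y : Lam (x, y) -> \sum_(k < s.+1) F k x * expi (pi * y) ^+ k = 0.
    by move=> Lxy; apply: Fsum => // j sj; apply: IHk; [exact: ltnW|lia].
  move=> x; apply: (ccontinuous_dense (FA_continuous (FF s)) dP) => {}x Px.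
  (* For s = 0 no power of a is left: the relation at any point of the fibre reads F_0(x) = 0. *)
  have [s0|s0] := posnP s.
    have [y Lxy] := Pi_full cL perL dL x; have := hi x y Lxy.
    by rewrite s0 big_ord1 mulr1.
  case: (Pi_tilde_p_local Px) => [{}Px|nloc].
    by have [_] := Pi_part_top np (f := fun i => F i x) Px (fun y Lxy => FG0 x y Lxy); apply.
  apply/eqP; apply: contrapT => /negP Fx; apply: nloc.
  have [W [d [FW d0 FW1]]] := FA_inv (FF s) Fx.
  (* Dividing by F_s gives a monic relation of degree s near x, which expresses a^p through lower
     powers; the coefficients from s to n are filled up with 0 to form a [local_relation]. *)
  have [U MU UE] := power_reduction p s0 (fun k => MN _ _ (FF k) FW).
  exists (fun k x => if (k < s)%N then - U k x else 0), d; split=> //.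
    move=> j; case: (j < s)%N; last exact: MA_cst.
    by move=> f Ff; apply: FA_ext (FA_Z (-1) (MU j f Ff)) => z; rewrite mulN1r mulNr.
  move=> z y zd Lzy; set b := expi _.
  rewrite (UE z b); last first.
    have := congr1 (fun c => c * W z) (hi z y Lzy).
    rewrite mul0r big_ord_recr/= mulrDl mulrAC FW1// mul1r -/b => /eqP.
    rewrite addrC addr_eq0 => /eqP ->; rewrite mulr_suml -sumrN.
    by apply: eq_bigr => j _; rewrite mulNr mulrAC.
  rewrite (eq_bigr (fun j : 'I_n.+1 => if (j < s)%N then - U j z * b ^+ j else 0)); last first.
    by move=> j _; case: (_ < _)%N; rewrite ?mul0r.
  rewrite (sum_ltn_if (fun j => - U j z * b ^+ j)) ?(leq_trans sn')//.
  by rewrite -big_split big1//= => j _; rewrite mulNr addrN.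
by move=> i x ni; apply: (F0 n.+1) => //; rewrite subnn.
Qed.

End Converse.

Theorem theorem3p8 (R : realType) (n p : nat) (Lam : set (R * R))
    (eta : R -> nat -> R) :
  (1 <= n)%N -> (n.+1 <= p)%N ->
  closed Lam -> periodic2 Lam -> dense (Pi Lam) ->
  selection n p Lam eta ->
  (heisenberg_uniqueness_pair (heights n p) Lam ->
     dense (Pi_tilde n p Lam eta)) /\
  (dense (Pi_tilde_p n p Lam eta) ->
     heisenberg_uniqueness_pair (heights n p) Lam).
Proof.
move=> n0 np cL perL dL sel; split.
  exact: dense_of_uniqueness.
exact: uniqueness_of_dense.
Qed.
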